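(* Let $q=3^r$ with $r\ge 1$ an integer. **(1)** Let $n\ge 1$ be an odd integer. For $i=1,2$ put $N_i^-(n,q)=|DC_i^-(n,q)|$. Then $N_i^-(n,q)=A^-(n,q)B^-(n,q)$, and for all $h=1,2,3,\dots$ and $i=1,2$, $$\begin{aligned} \big((-1)^{h+1}+2^{-h}\big)T_{12}SK^{h} =&-\sum_{j=1}^{h-1}\big((-1)^{j+1}+2^{-j}\big)\binom{h}{j}B^{-}(n,q)^{h-j}\,T_{12}SK^{j}\\ &+q\,A^{-}(n,q)^{-h}\sum_{j=0}^{\min\{N_i^-(n,q),h\}}(-1)^j\big(C_{i,j}^-(n,q)-C_j^-(n,q)\big)\\ &\qquad\times\sum_{t=j}^{h}t!\,S(h,t)\,3^{h-t}\,2^{t-h-j}\binom{N_i^-(n,q)-j}{N_i^-(n,q)-t}, \end{aligned}$$ where the first sum is $0$ if $h=1$. Here $\{C_{1,j}^-(n,q)\}_{j=0}^{N_1^-(n,q)}$, $\{C_{2,j}^-(n,q)\}_{j=0}^{N_2^-(n,q)}$ and $\{C_j^-(n,q)\}_{j=0}^{N_i^-(n,q)}$ are respectively the weight distributions of the ternary linear codes $C(DC_1^-(n,q))$, $C(DC_2^-(n,q))$, $C(DC^-(n,q))$ given by (writing $A=A^-(n,q)$, $B=B^-(n,q)$, with $\beta$ ranging over $\mathbb F_q$ in the products) $$C_{1,j}^-(n,q)=\sum\binom{q^{-1}A(B+1)}{\nu_0,\mu_0}\binom{q^{-1}A(B+1)}{\nu_2,\mu_2}\prod_{\beta^2-2\beta\ne0\text{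 square}}\binom{q^{-1}A(B+q+1)}{\nu_\beta,\mu_\beta}\prod_{\beta^2-2\beta\text{ nonsquare}}\binom{q^{-1}A(B-q+1)}{\nu_\beta,\mu_\beta},$$ $$C_{2,j}^-(n,q)=\sum\binom{q^{-1}A(B+1)}{\nu_0,\mu_0}\binom{q^{-1}A(B+1)}{\nu_1,\mu_1}\prod_{\beta^2+2\beta\ne0\text{ square}}\binom{q^{-1}A(B+q+1)}{\nu_\beta,\mu_\beta}\prod_{\beta^2+2\beta\text{ nonsquare}}\binom{q^{-1}A(B-q+1)}{\nu_\beta,\mu_\beta},$$ $$C_{j}^-(n,q)=\sum\binom{q^{-1}A(B+1)}{\nu_1,\mu_1}\binom{q^{-1}A(B+1)}{\nu_{-1},\mu_{-1}}\prod_{\beta^2-1\ne0\text{ square}}\binom{q^{-1}A(B+q+1)}{\nu_\beta,\mu_\beta}\prod_{\beta^2-1\text{ nonsquare}}\binom{q^{-1}A(B-q+1)}{\nu_\beta,\mu_\beta}.$$ **(2)** Let $n\ge 2$ be an even integer. For $i=1,2$ put $N_i^+(n,q)=|DC_i^+(n,q)|$. Then $N_i^+(n,q)=A^+(n,q)B^+(n,q)$, and for all $h=1,2,3,\dots$ and $i=1,2$, $$\begin{aligned} \big((-1)^{h+1}+2^{-h}\big)T_{12}SK^{2h} =&-\sum_{j=0}^{h-1}\binom{h}{j}\Big\{(-1)^{j+1}\big(B^{+}(n,q)-q^2+q\big)^{h-j}\\ &\qquad\qquad+2^{-j}\big(B^+(n,q)+\tfrac12q^2-\tfrac12q\big)^{h-j}\Big\}\,T_{12}SK^{2j}\\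 &+q\,A^{+}(n,q)^{-h}\sum_{j=0}^{\min\{N_i^+(n,q),h\}}(-1)^j\big(C_{i,j}^+(n,q)-C_j^+(n,q)\big)\\ &\qquad\times\sum_{t=j}^{h}t!\,S(h,t)\,3^{h-t}\,2^{t-h-j}\binom{N_i^+(n,q)-j}{N_i^+(n,q)-t}. \end{aligned}$$ Here $\{C_{1,j}^+(n,q)\}_{j=0}^{N_1^+(n,q)}$, $\{C_{2,j}^+(n,q)\}_{j=0}^{N_2^+(n,q)}$ and $\{C_j^+(n,q)\}_{j=0}^{N_i^+(n,q)}$ are respectively the weight distributions of the ternary linear codes $C(DC_1^+(n,q))$, $C(DC_2^+(n,q))$, $C(DC^+(n,q))$ given by (writing $A=A^+(n,q)$, $B=B^+(n,q)$, with $\beta$ ranging over $\mathbb F_q$ in the first two products) $$C_{1,j}^+(n,q)=\sum\binom{q^{-1}A\,(B+q\delta(2,q;0)+(q-1)^3)}{\nu_1,\mu_1}\prod_{\beta\ne1}\binom{q^{-1}A\,(B+q\delta(2,q;\beta-1)-2q^2+3q-1)}{\nu_\beta,\mu_\beta},$$ $$C_{2,j}^+(n,q)=\sum\binom{q^{-1}A\,(B+q\delta(2,q;0)+(q-1)^3)}{\nu_{-1},\mu_{-1}}\prod_{\beta\ne-1}\binom{q^{-1}A\,(B+q\delta(2,q;\beta+1)-2q^2+3q-1)}{\nu_\beta,\mu_\beta},$$ $$C_{j}^+(n,q)=\sum\binom{q^{4}\,(\delta(2,q;0)+q^5-q^2-3q+3)}{\nu_{0},\mu_{0}}\prod_{\beta\in\mathbb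 F_q^*}\binom{q^{4}\,(\delta(2,q;\beta)+q^5-q^3-q^2-2q+3)}{\nu_\beta,\mu_\beta}.$$ In both parts, the unspecified sums run over all families of nonnegative integers $\{\nu_\beta\}_{\beta\in\mathbb F_q}$, $\{\mu_\beta\}_{\beta\in\mathbb F_q}$ satisfying $$\sum_{\beta\in\mathbb F_q}\nu_\beta+\sum_{\beta\in\mathbb F_q}\mu_\beta=j\quad\text{and}\quad \sum_{\beta\in\mathbb F_q}\nu_\beta\beta=\sum_{\beta\in\mathbb F_q}\mu_\beta\beta\ \text{ (in }\mathbb F_q).$$
   Context: **Kloosterman sums.** $q=3^r$; $tr(x)=x+x^3+\cdots+x^{3^{r-1}}$ is the trace $\mathbb F_q\to\mathbb F_3$; $\lambda(x)=e^{2\pi i\,tr(x)/3}$ is the canonical additive character of $\mathbb F_q$. For $a\in\mathbb F_q^*$, $K(\lambda;a)=\sum_{\alpha\in\mathbb F_q^*}\lambda(\alpha+a\alpha^{-1})$. For each integer $h\ge0$, $$T_{12}SK^h=\sum_{a\in\mathbb F_q^*,\ tr\,a\ne0}K(\lambda;a^2)^h ,$$ the $h$-th moment of Kloosterman sums with ''trace nonzero square arguments''. **Combinatorial notation.** For nonnegative integers $a,b,c$: $\binom{c}{a,b}=\frac{c!}{a!\,b!\,(c-a-b)!}$ if $a+b\le c$, and $\binom{c}{a,b}=0$ if $a+b>c$. $S(h,t)=\frac1{t!}\sum_{j=0}^t(-1)^{t-j}\binom tj j^h$ is the Stirling number of the second kind. As usual, ordinary binomial coefficients with negative lower entry are $0$.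 The $q$-binomial coefficients are $\left[{n\atop k}\right]_q=\prod_{j=0}^{k-1}(q^{n-j}-1)/(q^{k-j}-1)$. For $\beta\in\mathbb F_q$, $\delta(2,q;\beta)=|\{(\alpha_1,\alpha_2)\in(\mathbb F_q^* )^2:\alpha_1+\alpha_2+\alpha_1^{-1}+\alpha_2^{-1}=\beta\}|$. For $n$ odd: $$A^-(n,q)=q^{\frac14(5n^2-1)}\left[{n\atop1}\right]_q\prod_{j=1}^{(n-1)/2}(q^{2j-1}-1),\qquad B^-(n,q)=q^{\frac14(n-1)^2}(q^n-1)\prod_{j=1}^{(n-1)/2}(q^{2j}-1).$$ For $n$ even: $$A^+(n,q)=q^{\frac14(5n^2-2n)}\left[{n\atop2}\right]_q\prod_{j=1}^{(n-2)/2}(q^{2j-1}-1),\qquad B^+(n,q)=q^{\frac14(n-2)^2}(q^n-1)(q^{n-1}-1)\prod_{j=1}^{(n-2)/2}(q^{2j}-1).$$ **Orthogonal double cosets.** $O(2n+1,q)=\{w\in GL(2n+1,q):{}^twJw=J\}$ with $J=\begin{bmatrix}0&1_n&0\\1_n&0&0\\0&0&1\end{bmatrix}$. Let $$Q=Q(2n+1,q)=\left\{\begin{bmatrix}A&0&0\\0&{}^tA^{-1}&0\\0&0&1\end{bmatrix}\begin{bmatrix}1_n&B&-{}^th\\0&1_n&0\\0&h&1\end{bmatrix}: A\in GL(n,q),\ h\in\mathbb F_q^{1\times n},\ B\in\mathbb F_q^{n\times n},\ B+{}^tB+{}^thh=0\right\},$$ $\rho=\mathrm{diag}(1_n,1_n,-1)$,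 and for $0\le k\le n$ $$\sigma_k=\begin{bmatrix}0&0&1_k&0&0\\0&1_{n-k}&0&0&0\\1_k&0&0&0&0\\0&0&0&1_{n-k}&0\\0&0&0&0&1\end{bmatrix}.$$ For $n$ odd: $DC_1^-(n,q)=Q\sigma_{n-1}Q$, $DC_2^-(n,q)=\rho Q\sigma_{n-1}Q$. For $n$ even: $DC_1^+(n,q)=Q\sigma_{n-2}Q$, $DC_2^+(n,q)=\rho Q\sigma_{n-2}Q$. **Symplectic double cosets.** $DC^-(n,q)$ ($n$ odd) and $DC^+(n,q)$ ($n$ even) are the double cosets in the symplectic group $Sp(2n,q)$ similar to the orthogonal ones above. Explicitly (the standard form): $Sp(2n,q)=\{w\in GL(2n,q):{}^tw\hat Jw=\hat J\}$ with $\hat J=\begin{bmatrix}0&1_n\\-1_n&0\end{bmatrix}$; $\hat P=\left\{\begin{bmatrix}A&0\\0&{}^tA^{-1}\end{bmatrix}\begin{bmatrix}1_n&B\\0&1_n\end{bmatrix}:A\in GL(n,q),\ {}^tB=B\right\}$; $\hat\sigma_k=\begin{bmatrix}0&0&1_k&0\\0&1_{n-k}&0&0\\-1_k&0&0&0\\0&0&0&1_{n-k}\end{bmatrix}$; $DC^-(n,q)=\hat P\hat\sigma_{n-1}\hat P$ and $DC^+(n,q)=\hat P\hat\sigma_{n-2}\hat P$. In the recursions these enter only through the numbers $C_j^-(n,q)$ and $C_j^+(n,q)$ displayed in the claim. **Codes.** For a finite set $D$ of square matrices over $\mathbb F_q$ with a fixed ordering $g_1,\dots,g_N$ of its elements,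 let $v=(\mathrm{Tr}\,g_1,\dots,\mathrm{Tr}\,g_N)\in\mathbb F_q^N$ ($\mathrm{Tr}$ is the matrix trace) and $C(D)=\{u\in\mathbb F_3^N: u\cdot v=0\}$, where the dot is the usual inner product in $\mathbb F_q^N$. The weight distribution of $C(D)$ is the sequence whose $j$-th term is the number of codewords of Hamming weight $j$.
   Formalization: The printed formula for C_j^+(n,q) is false (it counts Sp(4,q), not DC^+(n,q)); proved instead with upper entries q^{-1}A(B+qδ(2,q;0)+(q-1)^3) at β=0 and q^{-1}A(B+qδ(2,q;β)-2q^2+3q-1) at β≠0. The recursion uses the true weight distribution. *)

(* Defs.v *)
From HB Require Import structures.
From mathcomp Require Import all_boot all_order all_algebra.
From mathcomp Require Import complex.
From mathcomp Require Import reals trigo.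

Set Implicit Arguments.
Unset Strict Implicit.
Unset Printing Implicit Defensive.

Import Order.TTheory GRing.Theory Num.Theory.

Local Open Scope ring_scope.

(* Throughout, F is the finite field with q = #|F| = 3 ^ r elements. *)

(** Kloosterman sums *)

Definition tr (F : finFieldType) (r : nat) (x : F) : F :=
  \sum_(i < r) x ^+ (3 ^ i).

(* The integer representative in {0, 1, 2} of an element of the prime field;
   junk value 0 elsewhere. *)
Definition F3rep (F : finFieldType) (y : F) : nat :=
  odflt ord0 [pick k : 'I_3 | (k : nat)%:R == y].

Definition expi (R : realType) (t : R) : R[i] := Complex (cos t) (sin t).

Definition lambda (R : realType) (F : finFieldType) (r : nat) (x : F) : R[i] :=
  expi (2 * pi * (F3rep (tr r x))%:R / 3).

Definition Kloosterman (R : realType) (F : finFieldType) (r : nat) (a : F)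
    : R[i] :=
  \sum_(x : F | x != 0) lambda R r (x + a * x^-1).

Definition T12SK (R : realType) (F : finFieldType) (r h : nat) : R[i] :=
  \sum_(a : F | (a != 0) && (tr r a != 0)) Kloosterman R r (a ^+ 2) ^+ h.

(** Combinatorial notation *)

Definition trinom (c a b : nat) : nat :=
  if (a + b <= c)%N then (c`! %/ (a`! * b`! * (c - a - b)`!))%N else 0%N.

Definition stirling2 (K : fieldType) (h t : nat) : K :=
  (t`!)%:R^-1 *
  \sum_(j < t.+1) (-1) ^+ (t - j) * 'C(t, j)%:R * (j%:R : K) ^+ h.

(* binom (N - j) (N - t), equal to 0 when N - t is a negative integer: the
   truncated subtraction of nat would give 1 instead. *)
Definition binom_compl (N j t : nat) : nat :=
  if (t <= N)%N then 'C(N - j, N - t) else 0%N.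

(* The nat division is exact: q-binomial coefficients are integers. *)
Definition qbinom (q n k : nat) : nat :=
  ((\prod_(j < k) (q ^ (n - j) - 1)) %/ (\prod_(j < k) (q ^ (k - j) - 1)))%N.

Definition delta2 (F : finFieldType) (b : F) : nat :=
  #|[set p : F * F | [&& p.1 != 0, p.2 != 0
                       & p.1 + p.2 + p.1^-1 + p.2^-1 == b]]|.

(* The divisions by 4 are exact for n odd (Am, Bm), resp. n even (Ap, Bp). *)
Definition Am (n q : nat) : nat :=
  (q ^ ((5 * n ^ 2 - 1) %/ 4) * qbinom q n 1 *
   \prod_(1 <= j < ((n - 1) %/ 2).+1) (q ^ (2 * j - 1) - 1))%N.

Definition Bm (n q : nat) : nat :=
  (q ^ ((n - 1) ^ 2 %/ 4) * (q ^ n - 1) *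
   \prod_(1 <= j < ((n - 1) %/ 2).+1) (q ^ (2 * j) - 1))%N.

Definition Ap (n q : nat) : nat :=
  (q ^ ((5 * n ^ 2 - 2 * n) %/ 4) * qbinom q n 2 *
   \prod_(1 <= j < ((n - 2) %/ 2).+1) (q ^ (2 * j - 1) - 1))%N.

Definition Bp (n q : nat) : nat :=
  (q ^ ((n - 2) ^ 2 %/ 4) * (q ^ n - 1) * (q ^ (n - 1) - 1) *
   \prod_(1 <= j < ((n - 2) %/ 2).+1) (q ^ (2 * j) - 1))%N.

(** Orthogonal double cosets *)

Definition Q (F : finFieldType) (n : nat) : {set 'M[F]_(n + n + 1)} :=
  [set w | [exists A : 'M[F]_n, [exists B : 'M[F]_n, [exists h : 'rV[F]_n,
    [&& A \in unitmx, B + B^T + h^T *m h == 0 &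
        w == block_mx (block_mx A 0 0 (invmx A^T)) 0 0 1%:M
             *m block_mx (block_mx 1%:M B 0 1%:M) (col_mx (- h^T) 0)
                         (row_mx 0 h) 1%:M]]]]].

Definition rho (F : finFieldType) (n : nat) : 'M[F]_(n + n + 1) :=
  block_mx 1%:M 0 0 (- 1%:M).

(* pid_mx k = diag(1_k, 0) and copid_mx k = diag(0, 1_(n-k)): merging the row
   and column blocks of sizes k, n-k gives blocks of size n. *)
Definition sigma (F : finFieldType) (n k : nat) : 'M[F]_(n + n + 1) :=
  block_mx (block_mx (copid_mx k) (pid_mx k) (pid_mx k) (copid_mx k)) 0 0 1%:M.

Definition QsigmaQ (F : finFieldType) (n k : nat) : {set 'M[F]_(n + n + 1)} :=
  [set x *m sigma F n k *m y | x in Q F n, y in Q F n].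

Definition rhoQsigmaQ (F : finFieldType) (n k : nat)
    : {set 'M[F]_(n + n + 1)} :=
  [set rho F n *m w | w in QsigmaQ F n k].

(* DCm F n i for n odd and DCp F n i for n even, with i = 1, 2. *)
Definition DCm (F : finFieldType) (n i : nat) : {set 'M[F]_(n + n + 1)} :=
  if i == 1%N then QsigmaQ F n (n - 1) else rhoQsigmaQ F n (n - 1).

Definition DCp (F : finFieldType) (n i : nat) : {set 'M[F]_(n + n + 1)} :=
  if i == 1%N then QsigmaQ F n (n - 2) else rhoQsigmaQ F n (n - 2).

(** Symplectic double cosets *)

Definition Phat (F : finFieldType) (n : nat) : {set 'M[F]_(n + n)} :=
  [set w | [exists A : 'M[F]_n, [exists B : 'M[F]_n,
    [&& A \in unitmx, B^T == B &
        w == block_mx A 0 0 (invmx A^T) *m block_mx 1%:M B 0 1%:M]]]].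

Definition sigmahat (F : finFieldType) (n k : nat) : 'M[F]_(n + n) :=
  block_mx (copid_mx k) (pid_mx k) (- pid_mx k) (copid_mx k).

Definition PsigmaP (F : finFieldType) (n k : nat) : {set 'M[F]_(n + n)} :=
  [set x *m sigmahat F n k *m y | x in Phat F n, y in Phat F n].

Definition DCSpm (F : finFieldType) (n : nat) : {set 'M[F]_(n + n)} :=
  PsigmaP F n (n - 1).

Definition DCSpp (F : finFieldType) (n : nat) : {set 'M[F]_(n + n)} :=
  PsigmaP F n (n - 2).

(** Codes *)

(* The elements of D are ordered by enum_val; an element x of 'F_3 is viewed
   in F as (x : nat)%:R. *)
Definition trace_vec (F : finFieldType) (m : nat) (D : {set 'M[F]_m})
    : 'rV[F]_#|D| :=
  \row_i \tr (enum_val i).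

Definition code (F : finFieldType) (m : nat) (D : {set 'M[F]_m})
    : {set 'rV['F_3]_#|D|} :=
  [set u : 'rV['F_3]_#|D| |
    \sum_i ((u 0 i : nat)%:R : F) * trace_vec D 0 i == 0].

Definition hamming_weight (N : nat) (u : 'rV['F_3]_N) : nat :=
  #|[set i | u 0 i != 0]|.

Definition weight_dist (F : finFieldType) (m : nat) (D : {set 'M[F]_m})
    (j : nat) : nat :=
  #|[set u in code D | hamming_weight u == j]|.

(** Closed formulas for the weight distributions *)

(* Sum of T nu mu over the families nu, mu of nonnegative integers indexed by
   F such that the sum of all nu_b and mu_b is j and the sums of nu_b * b and
   of mu_b * b agree in F; all the entries are then at most j. *)
Definition family_sum (F : finFieldType) (j : nat)
    (T : (F -> nat) -> (F -> nat) -> nat) : nat :=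
  (\sum_(nu : {ffun F -> 'I_j.+1})
   \sum_(mu : {ffun F -> 'I_j.+1} |
         (\sum_b (nu b : nat) + \sum_b (mu b : nat) == j)%N &&
         ((\sum_b b *+ nu b)%R == (\sum_b b *+ mu b)%R))
     T (fun b => nu b) (fun b => mu b))%N.

Definition is_square (F : finFieldType) (x : F) : bool :=
  [exists y : F, x == y ^+ 2].

(* In the definitions below the division by q is exact, and the subtractions
   of nat are never truncated: the upper entries of the trinomial coefficients
   are the numbers of elements of given trace in the double coset. *)

Definition top0 (A B q : nat) : nat := (A * (B + 1) %/ q)%N.
Definition topS (A B q : nat) : nat := (A * (B + q + 1) %/ q)%N.
Definition topN (A B q : nat) : nat := (A * (B + 1 - q) %/ q)%N.

Definition C1m (F : finFieldType) (n j : nat) : nat :=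
  let q := #|F| in let A := Am n q in let B := Bm n q in
  family_sum j (fun nu mu : F -> nat =>
    (trinom (top0 A B q) (nu 0%R) (mu 0%R) *
     trinom (top0 A B q) (nu 2%R) (mu 2%R) *
     \prod_(b : F | ((b ^+ 2 - 2 * b)%R != 0%R) && is_square (b ^+ 2 - 2 * b)%R)
       trinom (topS A B q) (nu b) (mu b) *
     \prod_(b : F | ~~ is_square (b ^+ 2 - 2 * b)%R)
       trinom (topN A B q) (nu b) (mu b))%N).

Definition C2m (F : finFieldType) (n j : nat) : nat :=
  let q := #|F| in let A := Am n q in let B := Bm n q in
  family_sum j (fun nu mu : F -> nat =>
    (trinom (top0 A B q) (nu 0%R) (mu 0%R) *
     trinom (top0 A B q) (nu 1%R) (mu 1%R) *
     \prod_(b : F | ((b ^+ 2 + 2 * b)%R != 0%R) && is_square (b ^+ 2 + 2 * b)%R)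
       trinom (topS A B q) (nu b) (mu b) *
     \prod_(b : F | ~~ is_square (b ^+ 2 + 2 * b)%R)
       trinom (topN A B q) (nu b) (mu b))%N).

Definition CSpm (F : finFieldType) (n j : nat) : nat :=
  let q := #|F| in let A := Am n q in let B := Bm n q in
  family_sum j (fun nu mu : F -> nat =>
    (trinom (top0 A B q) (nu 1%R) (mu 1%R) *
     trinom (top0 A B q) (nu (-1)%R) (mu (-1)%R) *
     \prod_(b : F | ((b ^+ 2 - 1)%R != 0%R) && is_square (b ^+ 2 - 1)%R)
       trinom (topS A B q) (nu b) (mu b) *
     \prod_(b : F | ~~ is_square (b ^+ 2 - 1)%R)
       trinom (topN A B q) (nu b) (mu b))%N).

(* d stands for a value of delta2. *)
Definition topE (A B q d : nat) : nat :=
  (A * (B + q * d + (q - 1) ^ 3) %/ q)%N.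
Definition topG (A B q d : nat) : nat :=
  (A * (B + q * d + 3 * q - (2 * q ^ 2 + 1)) %/ q)%N.

Definition C1p (F : finFieldType) (n j : nat) : nat :=
  let q := #|F| in let A := Ap n q in let B := Bp n q in
  family_sum j (fun nu mu : F -> nat =>
    (trinom (topE A B q (delta2 (0%R : F))) (nu 1%R) (mu 1%R) *
     \prod_(b : F | b != 1%R)
       trinom (topG A B q (delta2 (b - 1)%R)) (nu b) (mu b))%N).

Definition C2p (F : finFieldType) (n j : nat) : nat :=
  let q := #|F| in let A := Ap n q in let B := Bp n q in
  family_sum j (fun nu mu : F -> nat =>
    (trinom (topE A B q (delta2 (0%R : F))) (nu (-1)%R) (mu (-1)%R) *
     \prod_(b : F | b != (-1)%R)
       trinom (topG A B q (delta2 (b + 1)%R)) (nu b) (mu b))%N).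

(* The upper entries sometimes printed for this distribution, q^4 (delta2 0 +
   q^5 - q^2 - 3q + 3) and q^4 (delta2 b + q^5 - q^3 - q^2 - 2q + 3), are those
   of the whole group Sp(4, q): over b in F they add up to #|Sp(4, q)| and not
   to #|DCSpp F n| = Ap n q * Bp n q. The entries below are the numbers of
   elements of trace 0 and b in DCSpp F n. *)
Definition CSpp (F : finFieldType) (n j : nat) : nat :=
  let q := #|F| in let A := Ap n q in let B := Bp n q in
  family_sum j (fun nu mu : F -> nat =>
    (trinom (topE A B q (delta2 (0%R : F))) (nu 0%R) (mu 0%R) *
     \prod_(b : F | b != 0%R)
       trinom (topG A B q (delta2 b)) (nu b) (mu b))%N).

(* Main.v *)
(** Let D run through the double cosets. Moving the right factor of w = x s y to the left
    inside Tr w reduces the sum of lambda(a Tr w) over D to a sum over one parabolic. There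
    the sum over the unipotent part forces the upper left block of A to be symmetric of
    size k (orthogonal case) or alternating (symplectic case); what remains is a Gauss sum
    and a Kloosterman sum over GL(1) or GL(2), which is a polynomial in K(a^2). For k even
    the Gauss sums over the invertible symmetric matrices add up to q^k times the number
    of invertible alternating matrices, so the orthogonal and the symplectic sums differ
    exactly by the factor lambda(a) or lambda(-a). The dual codewords indexed by a thus
    have equal weights in the two codes when tr a = 0, and explicit weights otherwise;
    subtracting the two Pless power moment identities gives the recursion. Fourier
    inversion of the same sums gives the number of elements of each trace, hence the
    weight distributions. *)

Require Import Defs.
From mathcomp Require Import all_boot all_order all_algebra.
From mathcomp Require Import complex.
From mathcomp Require Import reals trigo.
From mathcomp Require Import all_field ring zify lra.

Set Implicit Arguments.
Unset Strict Implicit.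
Unset Printing Implicit Defensive.

Import Order.TTheory GRing.Theory Num.Theory.
Local Open Scope ring_scope.

(** * Additive character sums *)

(** The words compared are indexed by [a] in [F], with entries tr(a Tr g), and are counted with
    multiplicity: the MacWilliams identity comes from expanding every coordinate in characters of
    F_3 and summing over [a], so no dimension of a code is ever computed. The word at [a] has weight
    (2|D| - S(a) - S(-a))/3, where S is the character sum over D. If tr a is nonzero then lambda(a)
    + lambda(-a) = -1, so the factor lambda(a) or lambda(-a) turns the symplectic weight (2A/3)(B -
    s - k) into (2A/3)(B + s/2 + k/2); here k = K(a^2), s = 0 for n odd, and k = K(a^2)^2, s = q^2 -
    q for n even. Expanding the difference of the h-th powers produces the coefficients (-1)^(j+1)
    and 2^-j. The obstacle on the orthogonal side is that a single Gauss sum depends on the class of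
    the quadratic form. None is evaluated: exchanging the sum over the forms with the sum over the
    vectors h leaves only counts of invertible symmetric matrices by their corner entry. *)

Definition nontrivial_character (C : numFieldType) (F : finFieldType)
    (psi : F -> C) : Prop :=
  [/\ psi 0 = 1, {morph psi : x y / x + y >-> x * y} & \sum_x psi x = 0].

Section CharacterSums.
Variables (C : numFieldType) (F : finFieldType) (psi : F -> C).
Hypothesis hpsi : nontrivial_character psi.

Lemma char_nontriv : exists x, psi x != 1.
Proof.
case: hpsi => _ _ s0; apply/existsP; apply: contraT; rewrite negb_exists.
move/forallP=> h; have: \sum_(x : F) psi x = #|F|%:R.
  by rewrite (eq_bigr (fun=> 1)) ?sumr_const // => x _; apply/eqP/negPn/h.
move/esym/eqP; rewrite s0 pnatr_eq0; apply: contraLR => _.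
by rewrite -lt0n; apply/card_gt0P; exists 0.
Qed.

Lemma sum_char_hom (V : finZmodType) (f : V -> F) :
  {morph f : x y / x + y >-> x + y} ->
  (exists v, psi (f v) != 1) -> \sum_v psi (f v) = 0.
Proof.
case: hpsi => _ psiD _ fD [v0 hv0]; apply/eqP.
have: psi (f v0) * (\sum_v psi (f v)) = \sum_v psi (f v).
  rewrite mulr_sumr [RHS](reindex_inj (addrI v0)) /=.
  by apply: eq_bigr => v _; rewrite fD psiD.
move/eqP; rewrite -subr_eq0; set s := \sum_v _.
by rewrite -[X in _ - X]mul1r -mulrBl mulf_eq0 subr_eq0 (negPf hv0).
Qed.

Lemma sum_char_scale (a : F) : \sum_x psi (a * x) = (a == 0)%:R * #|F|%:R.
Proof.
case: eqVneq => [->|a0].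
  rewrite mul1r (eq_bigr (fun=> 1)) ?sumr_const // => x _.
  by rewrite mul0r; case: hpsi.
rewrite mul0r; apply: sum_char_hom; first by move=> x y; rewrite mulrDr.
by have [x hx] := char_nontriv; exists (a^-1 * x); rewrite mulVKf.
Qed.

Lemma sum_char_mxtrace m n (N : 'M[F]_(m, n)) :
  \sum_(U : 'M[F]_(n, m)) psi (\tr (N *m U)) = (N == 0)%:R * #|F|%:R ^+ (n * m).
Proof.
case: eqVneq => [->|N0].
  rewrite mul1r (eq_bigr (fun=> 1)); last first.
    by move=> x _; rewrite mul0mx mxtrace0; case: hpsi.
  by rewrite sumr_const card_mx natrX.
rewrite mul0r; apply: sum_char_hom; first by move=> x y; rewrite mulmxDr mxtraceD.
have /matrix0Pn[i [j Nij]] := N0.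
(* This multiple of [delta_mx j i] pairs with [N] to exactly [x], so the trace pairing reaches a
   point where [psi] is not 1. *)
have [x hx] := char_nontriv; exists ((N i j)^-1 * x *: delta_mx j i).
rewrite -scalemxAr mxtraceZ /mxtrace (bigD1 i) //= big1 ?addr0; last first.
  by move=> k ki; rewrite mxE big1 // => l _; rewrite mxE (negPf ki) andbF mulr0.
rewrite mxE (bigD1 j) //= big1 ?addr0; last first.
  by move=> l lj; rewrite mxE (negPf lj) mulr0.
by rewrite mxE !eqxx mulr1 mulrAC mulVf ?mul1r.
Qed.

End CharacterSums.

Lemma natmulE (u v : nat) : u *+ v = (v * u)%N.
Proof. by rewrite -mulr_natl natn. Qed.

(** * Character sums over symmetric and skew-symmetric matrices *)

Section EpsilonSymmetric.
Variable F : finFieldType.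
Implicit Types e a : F.

(** One sign covers both groups: [e = 1] gives symmetric and [e = -1] skew-symmetric matrices, which
    in characteristic 3 are the alternating ones. *)
Definition eps_sym e n : {set 'M[F]_n} := [set S | S^T == e *: S].
Arguments eps_sym e n : clear implicits.

(* In characteristic 3 the map U |-> U + e U^T splits as S = (- S) + e (- S)^T. *)
Lemma sum_eps_sym (C : numFieldType) e n (g : 'M[F]_n -> C) :
  3%N \in [pchar F] -> e * e = 1 ->
  \sum_(U : 'M[F]_n) g (U + e *: U^T) =
  #|eps_sym (- e) n|%:R * \sum_(S | S \in eps_sym e n) g S.
Proof.
move=> ch3 ee.
have im U : U + e *: U^T \in eps_sym e n.
  by rewrite inE linearD linearZ /= trmxK scalerDr scalerA ee scale1r addrC.
rewrite (partition_big (fun U => U + e *: U^T) (fun S => S \in eps_sym e n)) //.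
rewrite mulr_sumr; apply: eq_bigr => S; rewrite inE => /eqP symS.
have three : forall x : 'M[F]_n, x + x = - x.
  move=> x; apply/eqP; rewrite -addr_eq0 -mulr2n -mulrSr -scaler_nat.
  by rewrite (pcharf0 ch3) scale0r.
have fS : - S + e *: (- S)^T = S.
  by rewrite !linearN /= symS scalerA ee scale1r -opprD three opprK.
(* The fibre over [S] is the translate by [- S] of the kernel of U |-> U + e U^T, and this kernel is
   [eps_sym (- e)]. *)
have cardS : #|[set U : 'M[F]_n | U + e *: U^T == S]| = #|eps_sym (- e) n|.
  rewrite -!sum1_card (reindex_inj (addIr (- S))); apply: eq_bigl => V.
  rewrite inE linearD scalerDr addrACA fS -subr_eq0 addrK.
  rewrite [in RHS]inE scaleNr -[in RHS]subr_eq0 opprK.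
  apply/eqP/eqP => /(congr1 (fun x => e *: x)).
    by rewrite scalerDr scalerA ee scale1r scaler0 addrC.
  by rewrite scalerDr scalerA ee scale1r scaler0 addrC.
rewrite -cardS mulr_natl -sumr_const; apply: eq_big => [U|U /eqP->] //.
by rewrite inE.
Qed.

Lemma eps_sym_block e k n (x : 'M[F]_k) (b : 'M[F]_(k, n)) c (D : 'M[F]_n) :
  e * e = 1 ->
  (block_mx x b c D \in eps_sym e (k + n)) =
  [&& x \in eps_sym e k, c == e *: b^T & D \in eps_sym e n].
Proof.
move=> ee; rewrite !inE tr_block_mx scale_block_mx.
apply/eqP/and3P => [/eq_block_mx[-> _ -> ->]|[/eqP-> /eqP-> /eqP->]].
  by rewrite scalerA ee scale1r; split.
by rewrite linearZ /= trmxK scalerA ee scale1r.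
Qed.

Lemma sum_eps_symD (C : nmodType) e k n (g : 'M[F]_(k + n) -> C) : e * e = 1 ->
  \sum_(S | S \in eps_sym e (k + n)) g S =
  \sum_(x | x \in eps_sym e k) \sum_b \sum_(D | D \in eps_sym e n)
     g (block_mx x b (e *: b^T) D).
Proof.
move=> ee; rewrite pair_big /= pair_big /=.
rewrite (reindex (fun p : 'M[F]_k * 'M[F]_(k, n) * 'M[F]_n =>
   block_mx p.1.1 p.1.2 (e *: p.1.2^T) p.2)) /=; last first.
  exists (fun S => (ulsubmx S, ursubmx S, drsubmx S)) => [[[x b] D]|S] hS /=.
    by rewrite block_mxKul block_mxKur block_mxKdr.
  have: S \in eps_sym e (k + n) by [].
  by rewrite -{1}[S]submxK eps_sym_block // => /and3P[_ /eqP<- _]; rewrite submxK.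
apply: eq_bigl => [[[x b] D]] /=.
by rewrite eps_sym_block // eqxx andbT.
Qed.

(** These are the unipotent parameters that remain in the stabilisers, see [orth_stab] and
    [symp_stab]. *)
Lemma card_eps_sym_ul0 e k n : e * e = 1 ->
  #|[set S in eps_sym e (k + n) | ulsubmx S == 0]| =
    (#|F| ^ (k * n) * #|eps_sym e n|)%N.
Proof.
move=> ee; rewrite -sum1_card (eq_bigl (fun S : 'M[F]_(k + n) =>
  (S \in eps_sym e (k + n)) && (ulsubmx S == 0))); last by move=> S; rewrite inE.
rewrite big_mkcondr /=.
have := @sum_eps_symD nat e k n (fun S => if ulsubmx S == 0 then 1%N else 0%N) ee.
rewrite (bigD1 (0 : 'M_k)) /=; last by rewrite inE trmx0 scaler0.
rewrite [X in (_ + X)%R](_ : _ = 0); last first.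
  rewrite big1 // => x /andP[_ /negPf x0]; rewrite big1 // => b _.
  by rewrite big1 // => D _; rewrite block_mxKul x0.
rewrite addr0 => ->.
under eq_bigr => b _ do under eq_bigr => D _ do rewrite block_mxKul eqxx.
by rewrite !sumr_const !natmulE muln1 card_mx.
Qed.

(** For the trace form, [eps_sym (- e)] is the orthogonal of [eps_sym e]. The sum over [S] is lifted
    along U |-> U + e U^T to all matrices, where full orthogonality applies; the common factor
    [#|eps_sym (- e) n|] is then cancelled. *)
Lemma sum_char_eps_sym (C : numFieldType) (psi : F -> C) e n a (N : 'M[F]_n) :
  nontrivial_character psi -> 3%N \in [pchar F] -> e * e = 1 -> a != 0 ->
  \sum_(S in eps_sym e n) psi (a * \tr (N *m S)) =
  (N \in eps_sym (- e) n)%:R * #|eps_sym e n|%:R.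
Proof.
move=> hpsi ch3 ee a0.
have nz e' : (#|eps_sym e' n|%:R : C) != 0.
  rewrite pnatr_eq0 -lt0n; apply/card_gt0P; exists 0.
  by rewrite inE trmx0 scaler0.
have splitU (N' : 'M[F]_n) : \sum_(U : 'M[F]_n) psi (a * \tr (N' *m (U + e *: U^T)))
  =
   (N' \in eps_sym (- e) n)%:R * (#|F| ^ (n * n))%:R.
  under eq_bigr => U _.
    have -> : a * \tr (N' *m (U + e *: U^T)) = \tr (a *: (N' + e *: N'^T) *m U).
      rewrite mulmxDr mxtraceD -scalemxAr mxtraceZ -[\tr (N' *m U^T)]mxtrace_tr.
      rewrite trmx_mul trmxK [\tr (U *m _)]mxtrace_mulC.
      rewrite -scalemxAl mxtraceZ mulmxDl mxtraceD -scalemxAl mxtraceZ.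
      by [].
    over.
  rewrite sum_char_mxtrace // scaler_eq0 (negPf a0) /= natrX; congr (_%:R * _).
  rewrite inE scaleNr; congr (nat_of_bool _).
  apply/eqP/eqP => [/eqP|->]; last by rewrite scalerN scalerA ee scale1r subrr.
  rewrite addr_eq0 => /eqP/(congr1 (fun X => e *: X)) ->.
  by rewrite scalerN scalerA ee scale1r opprK.
apply: (mulfI (nz (- e))); rewrite -sum_eps_sym // splitU mulrCA; congr (_ * _).
have := @sum_eps_sym C e n (fun=> 1) ch3 ee.
by rewrite !sumr_const card_mx.
Qed.

End EpsilonSymmetric.
Arguments eps_sym {F} e n.

(** * Invertible symmetric and alternating matrices *)

Section Units.
Variable F : fieldType.

Lemma unitmx_kerP n (A : 'M[F]_n) :
  reflect (forall v : 'rV_n, v *m A = 0 -> v = 0) (A \in unitmx).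
Proof.
rewrite unitmxE unitfE; apply: (iffP idP) => [dA v vA|h].
  apply/eqP; apply: contraNT dA => v0.
  by apply/det0P; exists v.
by apply/det0P => -[v /eqP v0 vA]; apply/v0/h.
Qed.

Lemma unitmx_lblock n1 n2 (A : 'M[F]_n1) (B : 'M_(n2, n1)) (D : 'M_n2) :
  (block_mx A 0 B D \in unitmx) = (A \in unitmx) && (D \in unitmx).
Proof. by rewrite !unitmxE det_lblock unitrM. Qed.

Lemma unitmx_schur n1 n2 (A : 'M[F]_n1) B C (D : 'M_n2) : A \in unitmx ->
  (block_mx A B C D \in unitmx) = (D - C *m invmx A *m B \in unitmx).
Proof.
move=> uA.
have -> : block_mx A B C D = block_mx 1%:M 0 (C *m invmx A) 1%:M *m
                             block_mx A B 0 (D - C *m invmx A *m B).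
  rewrite mulmx_block !mul1mx !mul0mx !addr0 mulmxKV //.
  by rewrite addrC subrK.
by rewrite unitmx_mul unitmx_lblock !unitmx1 unitmxE det_ublock unitrM -!unitmxE uA.
Qed.

(** Transitivity of GL on nonzero rows; it reduces a nonzero [b] or [h] to the first basis
    vector. *)
Lemma row_complete n (b : 'rV[F]_n.+1) : b != 0 ->
  exists2 P : 'M_n.+1, P \in unitmx & b = delta_mx 0 0 *m P.
Proof.
move=> b0; pose f : 'M_n.+1 := delta_mx 0 0 *m b.
have df : delta_mx 0 0 *m f = b by rewrite mulmxA mul_delta_mx -rowE row_id.
have [|P uP PE] := @complete_unitmx F 1 n.+1 (delta_mx 0 0) f.
  by rewrite df rank_rV b0 mxrank_delta.
by exists P => //; rewrite -PE df.
Qed.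

(* The first two basis vectors span a hyperbolic (or symplectic) plane. *)
Lemma unitmx_hyperbolic (e : F) k (x : 'M_1) (y : 'rV_k) (z : 'cV_k) (E : 'M_k) :
  e != 0 ->
  (block_mx 0 (delta_mx 0 0) (e *: (delta_mx 0 0 : 'rV_(1 + k))^T)
     (block_mx x y z E : 'M_(1 + k)) \in unitmx) = (E \in unitmx).
Proof.
move=> e0.
have dE : delta_mx 0 0 = row_mx 1%:M 0 :> 'rV[F]_(1 + k).
  apply/rowP => j; rewrite mxE; case: (split_ordP j) => i ->.
    by rewrite row_mxEl ord1 mxE; congr (_%:R).
  by rewrite row_mxEr mxE.
rewrite dE tr_row_mx trmx1 trmx0 scale_col_mx scaler0.
have eq v0 v1 v2 : row_mx v0 (row_mx v1 v2) *m
   (block_mx 0 (row_mx 1%:M 0) (col_mx (e *: 1%:M) 0) (block_mx x y z E))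
   = row_mx (e *: v1) (row_mx (v0 + (v1 *m x + v2 *m z)) (v1 *m y + v2 *m E)).
  rewrite mul_row_block mulmx0 add0r mul_row_col mulmx0 addr0 -scalemxAr mulmx1.
  by rewrite mul_mx_row mulmx1 mulmx0 mul_row_block add_row_mx add0r.
apply/unitmx_kerP/unitmx_kerP => h.
  move=> v2 vE; have := h (row_mx (- (v2 *m z)) (row_mx 0 v2)).
  rewrite eq scaler0 !mul0mx add0r vE addr0 addNr !row_mx0 => /(_ erefl)/eqP.
  by rewrite row_mx_eq0 row_mx_eq0 => /and3P[_ _ /eqP].
move=> v; rewrite -[v]hsubmxK -[rsubmx v]hsubmxK.
move: (lsubmx v) (lsubmx _) (rsubmx _) => v0 v1 v2.
rewrite eq => /eqP; rewrite !row_mx_eq0 scaler_eq0 (negPf e0) /=.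
case/and3P=> /eqP-> ; rewrite !mul0mx !add0r => /eqP h0 /eqP/h v20.
by move: h0; rewrite v20 mul0mx addr0 => ->; rewrite !row_mx0.
Qed.

End Units.

Section InvertibleSymmetric.
Variable F : finFieldType.
Implicit Types e a : F.
Local Notation q := #|F|.

Definition inv_sym e n : nat :=
  #|[set S in eps_sym e n | S \in unitmx]|.

Arguments inv_sym e%_R n.

Lemma card_eps_symS e n : e * e = 1 ->
  #|eps_sym e n.+1| = (#|eps_sym e 1| * q ^ n * #|eps_sym e n|)%N.
Proof.
move=> ee; have := @sum_eps_symD F nat e 1 n (fun=> 1%N) ee;
  rewrite !sumr_const -!mulrnA !natn.
rewrite card_mx mul1n => ->; ring.
Qed.

Lemma card_sym1 : #|eps_sym (1 : F) 1| = q.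
Proof.
rewrite -[RHS](card_mx F 1 1); apply: eq_card => A.
by rewrite !inE scale1r [A]mx11_scalar tr_scalar_mx eqxx.
Qed.

Lemma card_skew1 : 3%N \in [pchar F] -> #|eps_sym (-1 : F) 1| = 1%N.
Proof.
move=> ch3; apply: (@eq_card1 _ (0 : 'M_1)) => A.
rewrite !inE [A]mx11_scalar tr_scalar_mx scaleN1r -addr_eq0 -mulr2n.
rewrite -subr_eq0 subr0.
have -> : (A 0 0)%:M *+ 2 = - (A 0 0)%:M :> 'M_1.
  by apply/eqP; rewrite -addr_eq0 -mulrSr -scaler_nat (pcharf0 ch3) scale0r.
by rewrite oppr_eq0.
Qed.

Lemma card_eps_sym0 e : #|eps_sym e 0| = 1%N.
Proof.
apply: (@eq_card1 _ (0 : 'M_0)) => A.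
by rewrite !inE [A]flatmx0 trmx0 scaler0 !eqxx.
Qed.

Lemma card_sym n : #|eps_sym (1 : F) n| = (q ^ 'C(n.+1, 2))%N.
Proof.
elim: n => [|n IH]; first by rewrite card_eps_sym0.
rewrite card_eps_symS ?mulr1 // IH card_sym1 -expnS -expnD [in RHS]binS bin1.
by rewrite addnC.
Qed.

Lemma card_skew n : 3%N \in [pchar F] -> #|eps_sym (-1 : F) n| = (q ^ 'C(n, 2))%N.
Proof.
move=> ch3; elim: n => [|n IH]; first by rewrite card_eps_sym0.
by rewrite card_eps_symS ?mulrNN ?mulr1 // IH card_skew1 // mul1n -expnD
  [in RHS]binS bin1 addnC.
Qed.

(** Invertibility depends only on the Schur complement, and subtracting the symmetric matrix b^T
    x^-1 b permutes the symmetric [D]. *)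
Lemma card_schur n (x : 'M_1) (b : 'rV[F]_n) : x \in unitmx ->
  #|[set D in eps_sym 1 n | (block_mx x b (1 *: b^T) D \in unitmx)]|
  = inv_sym 1 n.
Proof.
move=> ux; rewrite /inv_sym -!sum1_card scale1r.
set T := b^T *m invmx x *m b.
have Ts : T^T = T.
  rewrite /T !trmx_mul trmxK mulmxA; congr (_ *m _ *m _).
  by rewrite [invmx x]mx11_scalar tr_scalar_mx.
rewrite (reindex_inj (addIr T)) /=; apply: eq_bigl => D; rewrite !inE.
rewrite unitmx_schur // addrK; congr (_ && _).
by rewrite linearD /= Ts !scale1r (inj_eq (addIr _)).
Qed.

(** A congruence moves [b] to the first basis vector. The first two basis vectors then span a
    nondegenerate plane, so only the lower right block of [D] of size [k] decides invertibility, and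
    the remaining entries of [D] are free. *)
Lemma card_hyperbolic e k (b : 'rV[F]_(1 + k)) : e * e = 1 -> b != 0 ->
  #|[set D in eps_sym e (1 + k) | (block_mx (0 : 'M_1) b (e *: b^T) D \in unitmx)]|
  = (#|eps_sym e 1| * q ^ k * inv_sym e k)%N.
Proof.
move=> ee b0; have e0 : e != 0.
  by apply: contraTneq isT => e0; move/eqP: ee; rewrite e0 mul0r eq_sym oner_eq0.
have [P uP bP] := row_complete b0.
rewrite -sum1_card (reindex (fun D => P^T *m D *m P)) /=; last first.
  exists (fun D => (invmx P)^T *m D *m invmx P) => D _.
    rewrite !mulmxA -trmx_mul mulmxV // trmx1 mul1mx -!mulmxA.
    by rewrite mulmxV // mulmx1.
  by rewrite !mulmxA -trmx_mul mulVmx // trmx1 mul1mx -!mulmxA mulVmx // mulmx1.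
have eqD D : block_mx 0 b (e *: b^T) (P^T *m D *m P) =
   block_mx (1%:M : 'M_1) 0 0 P^T *m
   block_mx (0 : 'M_1) (delta_mx 0 0) (e *: (delta_mx 0 0)^T) D *m block_mx 1%:M 0 0
     P.
  rewrite !mulmx_block !mul1mx !mul0mx !mulmx0 !add0r !addr0 mulmx1 -!mulmxA.
  by rewrite -bP mulmx1 -scalemxAr -trmx_mul -bP.
rewrite (eq_bigl (fun D => (D \in eps_sym e (1 + k)) && 
    (block_mx (0 : 'M_1) (delta_mx 0 0) (e *: (delta_mx 0 0)^T) D \in unitmx)));
      last first.
  move=> D; rewrite [LHS]inE eqD !unitmx_mul !block_diag_mx_unit unitmx1 unitmx_tr
    uP andbT.
  congr (_ && _); last by rewrite andbT.
  rewrite !inE !trmx_mul trmxK mulmxA scalemxAl scalemxAr.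
  apply/eqP/eqP => [/(congr1 (fun X => (invmx P)^T *m X *m invmx P))|-> //].
  rewrite !mulmxA -trmx_mul mulmxV // trmx1 !mul1mx -!mulmxA.
  by rewrite mulmxV // !mulmx1.
rewrite big_mkcondr /=.
rewrite (@sum_eps_symD F nat e 1 k
  (fun D => if block_mx (0 : 'M_1) (delta_mx 0 0) (e *: (delta_mx 0 0)^T) D \in
    unitmx then 1%N else 0%N)) //.
under eq_bigr => x _. under eq_bigr => y _. under eq_bigr => E _.
rewrite unitmx_hyperbolic //.
over. rewrite -big_mkcondr sum1_card. over. rewrite sumr_const. over.
rewrite sumr_const.
rewrite !natmulE card_mx mul1n mulnA.
by congr (_ * _)%N; rewrite /inv_sym -[RHS]sum1_card -sum1_card;
  apply: eq_bigl => S; rewrite inE.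
Qed.

(** The number of invertible matrices of [eps_sym e] of size [n + 1] with corner entry 0, that is,
    of nondegenerate forms whose first basis vector is isotropic. *)
Definition isotropic_count e n :=
  (\sum_b #|[set D in eps_sym e n | block_mx (0 : 'M_1) b (e *: b^T) D \in
    unitmx]|)%N.

Arguments isotropic_count e%_R n.

Lemma card_nonzero : #|[pred x : F | x != 0]| = (q - 1)%N.
Proof. by rewrite subn1 -(cardC1 (0 : F)); apply: eq_card => x; rewrite !inE. Qed.

Lemma isotropic_count0 e : isotropic_count e 0 = 0%N.
Proof.
rewrite /isotropic_count big1 // => b _; apply/eqP; rewrite cards_eq0.
apply/eqP/setP => D; rewrite !inE (_ : _ \in unitmx = false) ?andbF //.
by rewrite [b]thinmx0 trmx0 scaler0 unitmxE det_ublock det0 mul0r unitr0.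
Qed.

Lemma isotropic_countS e k : e * e = 1 -> isotropic_count e k.+1 =
  ((q ^ k.+1 - 1) * (#|eps_sym e 1| * q ^ k * inv_sym e k))%N.
Proof.
move=> ee; rewrite /isotropic_count (bigD1 0) //= [X in (X + _)%N](_ : _ = 0%N).
  rewrite add0n (eq_bigr (fun=> (#|eps_sym e 1| * q ^ k * inv_sym e k)%N)).
    rewrite sum_nat_const; congr (_ * _)%N.
    rewrite (_ : #|_| = #|[set~ (0 : 'rV[F]_k.+1)]|).
      by rewrite cardsC1 card_mx mul1n subn1.
    by apply: eq_card => b; rewrite !inE.
  by move=> b b0; rewrite card_hyperbolic.
apply/eqP; rewrite cards_eq0.
apply/eqP/setP => D; rewrite !inE (_ : _ \in unitmx = false) ?andbF //.
by rewrite trmx0 scaler0 unitmxE det_ublock det0 mul0r unitr0.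
Qed.

Lemma sum_inv_eps_sym (C : nzRingType) e n (g : F -> C) : e * e = 1 ->
  \sum_(S in eps_sym e (1 + n) | S \in unitmx) g (S 0 0) =
  \sum_(x in eps_sym e 1) g (x 0 0) *
    (\sum_(b : 'rV_n) #|[set D in eps_sym e n |
                         block_mx x b (e *: b^T) D \in unitmx]|)%:R.
Proof.
move=> ee; rewrite big_mkcondr /= (@sum_eps_symD F C e 1 n
  (fun S => if S \in unitmx then g (S 0 0) else 0)) //.
apply: eq_bigr => x xs; rewrite natr_sum mulr_sumr; apply: eq_bigr => b _.
rewrite -big_mkcondr /= (eq_bigr (fun=> g (x 0 0))); last first.
  move=> D _; congr g; rewrite -[in LHS](lshift0 _ 0) block_mxEul.
  by [].
by rewrite mulr_natr -sumr_const; apply: eq_bigl => D; rewrite inE.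
Qed.

Lemma inv_skewS n : 3%N \in [pchar F] ->
  inv_sym (-1) n.+1 = isotropic_count (-1) n.
Proof.
move=> ch3; have ee : -1 * -1 = 1 :> F by rewrite mulrNN mulr1.
have := @sum_inv_eps_sym int (-1) n (fun=> 1) ee.
have -> : eps_sym (-1 : F) 1 = [set 0].
  apply/eqP; rewrite eq_sym eqEcard cards1 card_skew1 // leqnn andbT.
  by apply/subsetP => x; rewrite !inE => /eqP ->; rewrite trmx0 scaler0.
rewrite big_set1 mul1r -/(isotropic_count _ _) => /eqP.
rewrite (eq_bigl (fun S => S \in [set S in eps_sym (-1) (1 + n) | S \in unitmx])).
  by rewrite sumr_const eqr_nat => /eqP.
by move=> S; rewrite inE.
Qed.

(** Sorting by the corner entry: 0 is the isotropic case, and by the Schur complement every nonzero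
    value occurs equally often. With [g] a character this evaluates the sum of psi(a h A h^T) for
    [h] the first basis vector; with [g = 1] it gives the recursion [inv_symS]. *)
Lemma sum_inv_sym (C : nzRingType) n (g : F -> C) :
  \sum_(S in eps_sym 1 (1 + n) | S \in unitmx) g (S 0 0) =
  g 0 * (isotropic_count 1 n)%:R +
  (\sum_(x | x != 0) g x) * (q ^ n * inv_sym 1 n)%:R.
Proof.
rewrite sum_inv_eps_sym ?mulr1 // (reindex (fun t : F => t%:M : 'M_1)) /=;
  last first.
  exists (fun A : 'M_1 => A 0 0) => [t _|A _]; first by rewrite mxE eqxx.
  by rewrite -mx11_scalar.
rewrite (eq_bigl xpredT); last first.
  by move=> t; rewrite inE tr_scalar_mx scale1r eqxx.
rewrite (bigD1 0) //= mxE /=; congr (_ + _).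
  by rewrite raddf0.
rewrite mulr_suml; apply: eq_bigr => x x0; rewrite mxE eqxx mulr1n.
congr (_ * _%:R).
rewrite (eq_bigr (fun=> inv_sym 1 n)); first by rewrite sum_nat_const card_mx mul1n.
by move=> b _; rewrite card_schur // unitmxE det_scalar1 unitfE.
Qed.

Lemma inv_sym0 e : inv_sym e 0 = 1%N.
Proof.
apply: (@eq_card1 _ (0 : 'M_0)) => A.
by rewrite !inE [A]flatmx0 trmx0 scaler0 !eqxx unitmxE det_mx00 unitr1.
Qed.

Lemma inv_symS n :
  inv_sym 1 n.+1 = (isotropic_count 1 n + (q - 1) * (q ^ n * inv_sym 1 n))%N.
Proof.
have := @sum_inv_sym int n (fun=> 1).
rewrite mul1r (eq_bigl (fun S => S \in
  [set S in eps_sym 1 (1 + n) | S \in unitmx])); last first.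
  by move=> S; rewrite inE.
rewrite !sumr_const.
rewrite [in X in _ + X]card_nonzero.
by rewrite -natrM -natrD => /eqP; rewrite eqr_nat => /eqP.
Qed.

Lemma inv_skewSS k : 3%N \in [pchar F] ->
  inv_sym (-1) k.+2 = ((q ^ k.+1 - 1) * (q ^ k * inv_sym (-1) k))%N.
Proof.
move=> ch3; rewrite inv_skewS // isotropic_countS ?mulrNN ?mulr1 //.
by rewrite card_skew1 // mul1n.
Qed.

Lemma inv_symSS k : inv_sym 1 k.+2 =
  ((q ^ k.+1 - 1) * (q ^ k.+1 * inv_sym 1 k) +
   (q - 1) * (q ^ k.+1 * inv_sym 1 k.+1))%N.
Proof. by rewrite inv_symS isotropic_countS ?mulr1 // card_sym1 expnS. Qed.

(** The recursion [inv_symSS] goes back two sizes, so the even and the odd identity are carried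
    through one induction. The intermediate [E2], s_n = q^n s_(n-1) for even n, is the cancellation
    later used for the Gauss sums. *)
Lemma inv_sym_even m : 3%N \in [pchar F] ->
  inv_sym 1 m.*2 = (q ^ m.*2 * inv_sym (-1) m.*2)%N /\
  inv_sym 1 m.*2.+1 = ((q ^ m.*2.+1 - 1) * inv_sym 1 m.*2)%N.
Proof.
move=> ch3; have q0 : (0 < q)%N by apply/card_gt0P; exists 0.
elim: m => [|m []].
  by rewrite inv_symS !inv_sym0 isotropic_count0.
rewrite doubleS inv_skewSS //; set k := m.*2 => IH1 IH2.
(* Writing [q] as a successor removes the truncated subtraction and leaves a polynomial identity. *)
have [p qE] : exists p, q = p.+1 by exists q.-1; rewrite prednK.
have E2 : inv_sym 1 k.+2 = (q ^ k.+2 * inv_sym 1 k.+1)%N.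
  rewrite inv_symSS IH2 [(q ^ k.+2)%N]expnS [in (q - 1)%N]qE subSS subn0.
  transitivity (p.+1 * q ^ k.+1 * ((q ^ k.+1 - 1) * inv_sym 1 k))%N;
    last by rewrite -qE.
  ring.
split.
  rewrite E2 IH2 IH1; ring.
rewrite inv_symSS.
have [P PE] : exists P, (q ^ k.+2 = P.+1)%N.
  by exists (q ^ k.+2).-1; rewrite prednK // expn_gt0 q0.
rewrite -E2 [(q ^ k.+3)%N]expnS PE qE.
rewrite (_ : (p.+1 * P.+1 - 1 = P + p * P.+1)%N); last by rewrite mulSn addSn subn1.
by rewrite !subn1 /=; ring.
Qed.

End InvertibleSymmetric.

(** * Gauss sums over invertible symmetric matrices *)

Section GaussSums.
Variables (C : numFieldType) (F : finFieldType) (psi : F -> C).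
Hypothesis hpsi : nontrivial_character psi.
Hypothesis ch3 : 3%N \in [pchar F].
Local Notation q := #|F|.

(* Each h <> 0 contributes s_n - q^n s_(n-1), where s_n is the number of invertible
   symmetric matrices of size n; this vanishes for n even. *)
Lemma sum_gauss_sym m (a : F) : a != 0 -> 
  \sum_(A in eps_sym (1 : F) m.*2 | A \in unitmx) \sum_(h : 'rV_m.*2)
    psi (a * (h *m A *m h^T) 0 0) = (q ^ m.*2 * inv_sym (-1 : F) m.*2)%:R.
Proof.
move=> a0; have q0 : (0 < q)%N by apply/card_gt0P; exists 0.
have [psi0 psiD psiS] := hpsi.
case: m => [|m].
  rewrite inv_sym0 muln1.
  have E0 : [set S in eps_sym (1 : F) 0 | S \in unitmx] = [set 0].
    by apply/setP=> S; rewrite !inE [S]flatmx0 trmx0 scaler0 !eqxx unitmxE det_mx00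
      unitr1.
  rewrite (eq_bigl (fun S => S \in [set S in eps_sym (1 : F) 0 | S \in unitmx])).
    rewrite E0 big_set1 (eq_bigr (fun=> 1)) ?sumr_const ?card_mx //.
    by move=> h _; rewrite mulmx0 mul0mx mxE mulr0.
  by move=> S; rewrite inE.
rewrite doubleS; set n := m.*2.+1.
rewrite exchange_big (bigD1 0) //=.
have sN0 : \sum_(x | x != 0) psi (a * x) = -1.
  have := sum_char_scale hpsi a; rewrite (negPf a0) mul0r (bigD1 0) //= mulr0 psi0.
  by move/eqP; rewrite addrC addr_eq0 => /eqP.
(* Completing [h] to a basis and changing [A] by congruence turns the value h A h^T into the corner
   entry of [A]. *)
have col0 (h : 'rV_n.+1) : h != 0 ->
  \sum_(A in eps_sym 1 n.+1 | A \in unitmx) psi (a * (h *m A *m h^T) 0 0) =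
  \sum_(A in eps_sym 1 (1 + n) | A \in unitmx) psi (a * A 0 0).
  move=> /row_complete[P uP hP].
  rewrite (reindex (fun A => invmx P *m A *m (invmx P)^T)) /=; last first.
    exists (fun A => P *m A *m P^T) => A _.
      rewrite !mulmxA mulmxV // mul1mx -!mulmxA -trmx_mul mulmxV //.
      by rewrite trmx1 mulmx1.
    rewrite !mulmxA mulVmx // mul1mx -!mulmxA -trmx_mul mulVmx //.
    by rewrite trmx1 mulmx1.
  apply: eq_big => [A|A _].
    rewrite !unitmx_mul unitmx_tr unitmx_inv uP andbT !inE; congr (_ && _).
    rewrite !trmx_mul trmxK mulmxA !scale1r.
    apply/eqP/eqP => [/(congr1 (fun X => P *m X *m P^T))|-> //].
    rewrite !mulmxA mulmxV // !mul1mx -!mulmxA -trmx_mul.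
    by rewrite mulmxV // trmx1 !mulmx1.
  rewrite hP !trmx_mul !mulmxA -[_ *m P *m _]mulmxA mulmxV // mulmx1.
  rewrite -[_ *m (invmx P)^T *m P^T]mulmxA -trmx_mul mulmxV // trmx1 mulmx1.
  by rewrite -rowE -[X in _ *m X]trmxK trmxK trmx_delta -colE !mxE.
have [_ IH2] := inv_sym_even m ch3; have [IH1 _] := inv_sym_even m ch3.
have E1 : inv_sym (1 : F) n = inv_sym (-1 : F) n.+1.
  by rewrite IH2 /n inv_skewSS // IH1.
have [E2 _] := inv_sym_even m.+1 ch3; rewrite doubleS -/n in E2.
rewrite [X in _ + X]big1 ?addr0; last first.
  move=> h h0; rewrite col0 // (sum_inv_sym n (fun x => psi (a * x))) sN0 mulr0
    psi0.
  apply/eqP; rewrite mul1r mulN1r subr_eq0 eqr_nat; apply/eqP.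
  have := inv_symS F n; rewrite E2 E1.
  have [p qE] : exists p, q = p.+1 by exists q.-1; rewrite prednK.
  rewrite expnS -mulnA [X in (X * _)%N = _]qE mulSn qE subn1 /= -qE => /eqP.
  by rewrite eqn_add2r eq_sym => /eqP.
rewrite (eq_bigl (fun S => S \in [set S in eps_sym (1 : F) n.+1 | S \in unitmx])).
  rewrite (eq_bigr (fun=> 1)) ?sumr_const -?E2 //.
  by move=> A _; rewrite !mul0mx mxE mulr0.
by move=> S; rewrite inE.
Qed.
End GaussSums.

(** * Kloosterman sums over GL(1) and GL(2) *)

Section KloostermanGL.
Variables (C : numFieldType) (F : finFieldType) (psi : F -> C).
Hypothesis hpsi : nontrivial_character psi.
Local Notation q := #|F|.

(** This is the Kloosterman sum with argument [a ^+ 2], by the substitution in [KloostermanE]; the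
    symmetric form is the one that the traces of a matrix and its inverse produce. *)
Definition kloosterman_sum (a : F) : C := \sum_(x | x != 0) psi (a * (x + x^-1)).

Definition kloosterman_GL m (a : F) : C :=
  \sum_(A : 'M[F]_m | A \in unitmx) psi (a * (\tr A + \tr (invmx A))).

Lemma kloosterman_GL1 a : kloosterman_GL 1 a = kloosterman_sum a.
Proof.
rewrite /kloosterman_GL (reindex (fun t : F => t%:M : 'M_1)) /=; last first.
  exists (fun A : 'M_1 => A 0 0) => [t _|A _]; first by rewrite mxE eqxx.
  by rewrite -mx11_scalar.
apply: eq_big => t; first by rewrite unitmxE det_scalar1 unitfE.
by rewrite invmx_scalar !mxtrace_scalar !mulr1n.
Qed.

(** With c = s1 s2 - d, these pairs are the off-diagonal entries of the 2 x 2 matrices with diagonal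
    (s1, s2) and determinant d. *)
Lemma sum_mul_eq (c : F) :
  (#|[set p : F * F | (p.1 * p.2 == c)%R]|%:R : C) = q%:R - 1 + (c == 0)%:R * q%:R.
Proof.
have q0 : (0 < q)%N by apply/card_gt0P; exists 0.
rewrite -sum1_card natr_sum (eq_bigl (fun p : F * F => p.1 * p.2 == c)); last first.
  by move=> p; rewrite inE.
rewrite -(pair_big_dep xpredT (fun x y => x * y == c) (fun _ _ => 1)) /=.
rewrite (bigD1 0) //= addrC; congr (_ + _).
  rewrite (eq_bigr (fun=> 1)).
    by rewrite sumr_const card_nonzero natrB.
  move=> x x0; rewrite (big_pred1 (x^-1 * c)) // => y /=.
  by rewrite -[RHS](inj_eq (mulfI x0)) mulVKf.
case: eqVneq => [->|c0].
  rewrite mul1r (eq_bigl xpredT) ?sumr_const // => y.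
  by rewrite mul0r eqxx.
by rewrite mul0r big1 // => y; rewrite mul0r eq_sym (negPf c0).
Qed.

(** For size 2 the trace of A^-1 is tr A / det A, so the summand depends only on the diagonal and
    the determinant d. The number of off-diagonal pairs is q - 1, plus q when the product of the
    diagonal entries is d; the first part yields (q - 1) q^2 and the second q times the square of
    the Kloosterman sum. *)
Lemma kloosterman_GL2 a : a != 0 ->
  kloosterman_GL 2 a = q%:R * (kloosterman_sum a ^+ 2 + q%:R ^+ 2 - q%:R).
Proof.
move=> a0; have [psi0 psiD _] := hpsi.
pose M (p : F * F * (F * F)) : 'M[F]_(1 + 1) :=
  block_mx p.1.1%:M p.2.1%:M p.2.2%:M p.1.2%:M.
rewrite /kloosterman_GL (reindex M) /=; last first.
  exists (fun A : 'M_(1 + 1) =>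
    (ulsubmx A 0 0, drsubmx A 0 0, (ursubmx A 0 0, dlsubmx A 0 0))).
    move=> [[x y] [z t]] _; rewrite /M /= block_mxKul block_mxKur block_mxKdl
      block_mxKdr.
    by rewrite !mxE !eqxx.
  by move=> A _; rewrite /M /= -!mx11_scalar submxK.
pose dt (p : F * F * (F * F)) := p.1.1 * p.1.2 - p.2.1 * p.2.2.
have detM p : \det (M p) = dt p.
  have lr : lift (lshift 1 (0 : 'I_1)) 0 = rshift 1 (0 : 'I_1) by apply: val_inj.
  have rl : lift (rshift 1 (0 : 'I_1)) 0 = lshift 1 (0 : 'I_1) by apply: val_inj.
  rewrite (expand_det_row _ (lshift 1 0)) big_split_ord !big_ord1 /cofactor.
  have sl : split (lshift 1 (0 : 'I_1)) = inl 0 := unsplitK (inl 0).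
  have sr : split (rshift 1 (0 : 'I_1)) = inr 0 := unsplitK (inr 0).
  rewrite !det_mx11 !mxE lr rl !sl !sr !row_mxEl !row_mxEr !mxE !eqxx /= /dt; ring.
have trM p : \tr (M p) = p.1.1 + p.1.2.
  by rewrite /M mxtrace_block !mxtrace_scalar !mulr1n.
have invM p : M p \in unitmx -> \tr (invmx (M p)) = (p.1.1 + p.1.2) / dt p.
  rewrite unitmxE unitfE detM => d0.
  pose B : 'M[F]_(1 + 1) := (dt p)^-1 *: M (p.1.2, p.1.1, (- p.2.1, - p.2.2)).
  have MB : M p *m B = 1%:M.
    rewrite -scalemxAr mulmx_block -!scalar_mxM -!raddfD /=.
    rewrite (_ : _ * _ + _ = dt p); last by rewrite /dt; ring.
    rewrite (_ : _ * _ + _ = 0); last by ring.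
    rewrite (_ : _ * _ + _ = 0); last by ring.
    rewrite (_ : _ * _ + _ = dt p); last by rewrite /dt; ring.
    rewrite raddf0 -scalar_mx_block.
    by rewrite scale_scalar_mx mulVf.
  have [uM _] := mulmx1_unit MB.
  have -> : invmx (M p) = B by rewrite -[RHS](mulKmx uM) MB mulmx1.
  by rewrite mxtraceZ trM mulrC addrC.
transitivity (\sum_(s : F * F) \sum_(p : F * F | s.1 * s.2 - p.1 * p.2 != 0)
   psi (a * (s.1 + s.2) * (1 + (s.1 * s.2 - p.1 * p.2)^-1))).
  rewrite pair_big_dep /=; apply: eq_big => [p|p uM].
    by rewrite unitmxE unitfE detM.
  by rewrite invM // trM /dt; congr psi; ring.
transitivity (\sum_(s : F * F) \sum_(d | d != 0)
   psi (a * (s.1 + s.2) * (1 + d^-1)) * (q%:R - 1 + (s.1 * s.2 == d)%:R * q%:R)).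
  apply: eq_bigr => s _.
  rewrite (partition_big (fun p : F * F => s.1 * s.2 - p.1 * p.2) (fun d => d != 0))
    //=.
  apply: eq_bigr => d d0.
  rewrite -[s.1 * s.2 == d]subr_eq0 -sum_mul_eq mulr_natr -sumr_const.
  apply: eq_big => [p|p /andP[_ /eqP -> //]].
  rewrite inE andbC; case: (eqVneq _ d) => [hd|hd] /=.
    by rewrite hd d0 -hd opprB addrCA subrr addr0 eqxx.
  by apply/esym; apply: contraNF hd => /eqP ->; rewrite opprB addrCA subrr addr0.
under eq_bigr => s _ do under eq_bigr => d _ do rewrite mulrDr.
under eq_bigr => s _ do rewrite big_split /=.
rewrite big_split /= [in X in X + _]exchange_big /=.
(* For fixed [d], summing over the diagonal gives 0 unless 1 + d^-1 = 0, so only d = -1 survives,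
   with q^2 diagonals. *)
rewrite [X in X + _](_ : _ = (q%:R - 1) * q%:R ^+ 2); last first.
  rewrite (bigD1 (-1)) ?oppr_eq0 ?oner_eq0 //= [X in _ + X]big1 ?addr0.
    rewrite (eq_bigr (fun=> q%:R - 1)).
rewrite sumr_const -[LHS]mulr_natr expr2 -natrM; congr (_ * _%:R). exact: card_prod.
    by move=> s _; rewrite invrN invr1 subrr mulr0 psi0 mul1r.
  move=> d /andP[d0 d1]; rewrite -mulr_suml.
  have c0 : 1 + d^-1 != 0.
    apply: contra d1 => /eqP h.
    by rewrite -addr_eq0 -[d in d + 1]mulr1 -[X in _ + X](mulfV d0) -mulrDr h mulr0.
  set c := 1 + d^-1 in c0 *.
  rewrite -(pair_big xpredT xpredT (fun x y => psi (a * (x + y) * c))) /=.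
  rewrite big1 ?mul0r // => x _.
  under eq_bigr => y _ do rewrite [a * (_ + _)]mulrDr mulrDl psiD mulrAC
    [a * y * c]mulrAC.
  by rewrite -mulr_sumr sum_char_scale // mulf_eq0 (negPf a0) (negPf c0) mul0r
    mulr0.
(* When d = s1 s2, the argument (s1 + s2)(1 + d^-1) is s1 + s1^-1 + s2 + s2^-1, and the sum splits
   into two Kloosterman sums. *)
rewrite [X in _ + X](_ : _ = q%:R * kloosterman_sum a ^+ 2); last first.
  rewrite /kloosterman_sum expr2 big_distrlr /= [in RHS]pair_big /= mulr_sumr.
  rewrite [RHS]big_mkcond /=.  apply: eq_bigr => s _.
  have [s0|] := boolP ((s.1 != 0) && (s.2 != 0)).
    have s12 : s.1 * s.2 != 0 by rewrite mulf_eq0 negb_or.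
    rewrite (bigD1 (s.1 * s.2)) //=.
    rewrite eqxx mul1r mulrC big1 ?addr0.
      rewrite -psiD; congr (_ * psi _).
      case/andP: s0 => s1 s2; field; exact/andP.
    by move=> d /andP[_]; rewrite eq_sym => /negPf ->; rewrite mul0r mulr0.
  rewrite -negb_or -mulf_eq0 negbK => /eqP ->.
  by rewrite big1 // => d; rewrite eq_sym => /negPf ->; rewrite mul0r mulr0.
ring.
Qed.

End KloostermanGL.

(** * Double cosets of finite matrix groups *)

Section DoubleCoset.
Variables (C : numFieldType) (F : finFieldType) (m : nat).
Variables (G : {set 'M[F]_m}) (s r : 'M[F]_m).
Hypothesis G1 : 1%:M \in G.
Hypothesis GM : forall x y, x \in G -> y \in G -> x *m y \in G.
Hypothesis Gu : forall x, x \in G -> x \in unitmx.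
Hypothesis us : s \in unitmx.
Hypothesis rr : r *m r = 1%:M.
Hypothesis rG : forall x, x \in G -> r *m x *m r \in G.

(** A finite set of invertible matrices closed under products is a group: left translation by [x] is
    injective, hence onto, and so reaches [1%:M]. *)
Lemma mulmx_set_inv x : x \in G -> invmx x \in G.
Proof.
move=> xG; have /imsetP[y yG yE] : 1%:M \in [set x *m y | y in G].
  rewrite (_ : [set _ | y in G] = G) //.
  apply/eqP; rewrite eqEcard card_imset ?leqnn ?andbT.
    by apply/subsetP => _ /imsetP[y yG ->]; exact: GM.
  exact: (can_inj (mulKmx (Gu xG))).
by rewrite -[invmx x]mulmx1 yE mulKmx ?Gu.
Qed.

(** The intersection of G with s^-1 G s; its order is the common size of the fibres of (x, y) |-> x
    s y. *)
Definition coset_stab := [set y in G | s *m y *m invmx s \in G].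

Lemma card_coset_fibre x0 y0 : x0 \in G -> y0 \in G ->
  #|[set p : 'M[F]_m * 'M[F]_m | [&& p.1 \in G, p.2 \in G &
     p.1 *m s *m p.2 == x0 *m s *m y0]]| = #|coset_stab|.
Proof.
move=> x0G y0G; pose f b := (x0 *m (s *m b *m invmx s), invmx b *m y0).
rewrite -(@card_in_imset _ _ f coset_stab); last first.
  move=> b c bB cB [/(can_inj (mulKmx (Gu x0G))) + _].
  move=> h; apply: (can_inj (mulKmx us)).
  by apply: (can_inj (mulmxK _)) h; rewrite unitmx_inv.
apply: eq_card => -[x y]; rewrite !inE /=; apply/and3P/imsetP.
  case=> xG yG /eqP E; exists (y0 *m invmx y).
    rewrite inE GM ?mulmx_set_inv //=.
    suff -> : s *m (y0 *m invmx y) *m invmx s = invmx x0 *m x.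
      by rewrite GM ?mulmx_set_inv.
    apply: (can_inj (mulKmx (Gu x0G))); rewrite mulKVmx ?Gu // !mulmxA -E.
    by rewrite mulmxK ?Gu // mulmxK.
  rewrite /f; congr (_, _).
    by rewrite !mulmxA -E mulmxK ?Gu // mulmxK.
  have uy : y0 *m invmx y \in unitmx by rewrite Gu // GM ?mulmx_set_inv.
  by apply: (can_inj (mulKmx uy)); rewrite mulKVmx // mulmxKV ?Gu.
case=> b; rewrite inE => /andP[bG bsG] [-> ->]; split.
- exact: GM.
- by rewrite GM ?mulmx_set_inv.
- by rewrite !mulmxA mulmxKV // mulmxK ?Gu.
Qed.

(* Since the trace is invariant under conjugation, the right factor y of x s y can be
   moved to the left, where the sum over x absorbs r^-1 y r. *)
Lemma sum_double_coset (f : F -> C) :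
  #|coset_stab|%:R * \sum_(w in [set x *m s *m y | x in G, y in G]) f (\tr (r *m w))
  = #|G|%:R * \sum_(x in G) f (\tr (r *m (x *m s))).
Proof.
transitivity (\sum_(y in G) \sum_(x in G) f (\tr (r *m (x *m s *m y)))).
  rewrite exchange_big pair_big /= mulr_sumr.
  rewrite (partition_big (fun p : 'M[F]_m * 'M[F]_m => p.1 *m s *m p.2)
     (fun w => w \in [set x *m s *m y | x in G, y in G])) /=; last first.
    by move=> [x y] /andP[xG yG]; apply/imset2P; exists x y.
  apply: eq_bigr => w /imset2P[x0 y0 x0G y0G ->].
  rewrite -(card_coset_fibre x0G y0G) mulr_natl -sumr_const.
  apply: eq_big => [p|p]; rewrite inE; first by rewrite andbA.
  by case/and3P=> _ _ /eqP ->.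
rewrite mulr_natl -sumr_const; apply: eq_bigr => y yG.
have ryG := rG yG; have uy := Gu ryG.
rewrite (reindex (fun x => invmx (r *m y *m r) *m x)) /=; last first.
  exists (fun x => (r *m y *m r) *m x) => x _; [exact: mulKVmx | exact: mulKmx].
apply: eq_big => [x|x xG].
  apply/idP/idP => [h|xG]; last by rewrite GM ?mulmx_set_inv.
  by rewrite -[x](mulKVmx uy) GM.
congr f; rewrite mulmxA mxtrace_mulC.
rewrite -[in RHS](mulKVmx uy x); set z := invmx _ *m x.
by rewrite !mulmxA rr mul1mx.
Qed.

Lemma card_double_coset :
  (#|coset_stab| * #|[set x *m s *m y | x in G, y in G]| = #|G| * #|G|)%N.
Proof.
apply/eqP; rewrite -(eqr_nat C) !natrM; apply/eqP.
by have := sum_double_coset (fun=> 1); rewrite !sumr_const.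
Qed.

End DoubleCoset.

(** * The maximal parabolic subgroups *)

Lemma form_mul (F : comNzRingType) m (J x y : 'M[F]_m) :
  x^T *m J *m x = J -> y^T *m J *m y = J -> (x *m y)^T *m J *m (x *m y) = J.
Proof.
move=> xJ yJ; rewrite trmx_mul -[RHS]yJ -[in RHS]xJ -!mulmxA.
by [].
Qed.

Section OrthogonalParabolic.
Variable F : finFieldType.

Definition orth_form n : 'M[F]_(n + n + 1) :=
  block_mx (block_mx 0 1%:M 1%:M 0) 0 0 1%:M.

(** The zero pattern of [Q] without the relations imposed by the form; it is closed under products
    by [orth_blockM]. *)
Definition orth_block n (A X D : 'M[F]_n) (u : 'cV[F]_n) (h : 'rV[F]_n) :
  'M[F]_(n + n + 1) :=
  block_mx (block_mx A X 0 D) (col_mx u 0) (row_mx 0 h) 1%:M.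

Definition orth_param n (A B : 'M[F]_n) (h : 'rV[F]_n) :=
  orth_block A (A *m B) (invmx A^T) (- (A *m h^T)) h.

Lemma orth_paramE n (A B : 'M[F]_n) (h : 'rV[F]_n) : orth_param A B h =
  block_mx (block_mx A 0 0 (invmx A^T)) 0 0 1%:M
    *m block_mx (block_mx 1%:M B 0 1%:M) (col_mx (- h^T) 0) (row_mx 0 h) 1%:M.
Proof.
rewrite mulmx_block !mulmx_block mul_block_col !mul0mx !mulmx0 !addr0 !add0r.
by rewrite !mulmx1 !mul1mx mulmxN.
Qed.

Lemma orth_blockM n (A X D A' X' D' : 'M[F]_n) u h u' h' :
  orth_block A X D u h *m orth_block A' X' D' u' h' =
  orth_block (A *m A') (A *m X' + X *m D' + u *m h') (D *m D') (A *m u' + u)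
    (h *m D' + h').
Proof.
rewrite mulmx_block mulmx_block mul_block_col mul_row_block mul_row_col.
rewrite !mul_col_row add_block_mx !mulmx1 !mul1mx !mul0mx !mulmx0 !addr0 !add0r.
by rewrite add_col_mx addr0 add_row_mx add0r.
Qed.

Lemma orth_block_inj n (A X D A' X' D' : 'M[F]_n) u h u' h' :
  orth_block A X D u h = orth_block A' X' D' u' h' ->
  [/\ A = A', X = X', D = D', u = u' & h = h'].
Proof.
by case/eq_block_mx=> /eq_block_mx[-> -> _ ->] /eq_col_mx[-> _] /eq_row_mx[_ ->].
Qed.

Lemma orth_block_form n (A X D : 'M[F]_n) u h :
  (orth_block A X D u h)^T *m orth_form n *m orth_block A X D u h = orth_form n <->
  [/\ A^T *m D = 1%:M, X^T *m D + D^T *m X + h^T *m h = 0 & D^T *m u + h^T = 0].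
Proof.
rewrite /orth_block tr_block_mx tr_block_mx tr_col_mx tr_row_mx !trmx0 trmx1.
rewrite /orth_form mulmx_block mulmx_block mul_row_block !(mulmx0, mulmx1, mul0mx)
  !(addr0, add0r).
rewrite mulmx_block mulmx_block mul_row_block mul_block_col mul_row_col.
rewrite mul_col_row add_block_mx !(mulmx0, mulmx1, mul0mx, mul1mx) !(addr0, add0r).
rewrite add_col_mx add_row_mx !(addr0, add0r).
rewrite !mul0mx add0r; split=> [/eq_block_mx[/eq_block_mx[_ -> _ e2]]|[e1 e2 e3]].
  move/eqP; rewrite col_mx_eq0 => /andP[_ /eqP->] _ _.
  by split=> //; rewrite [_^T *m D + _]addrC e2.
rewrite e1 e3 [D^T *m X + _]addrC e2; congr block_mx.
- by congr block_mx; rewrite -[LHS]trmxK trmx_mul trmxK e1 trmx1.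
- by rewrite col_mx0.
- rewrite (_ : _ + h = 0) ?row_mx0 //.
  by apply: trmx_inj; rewrite linearD /= trmx_mul trmxK e3 trmx0.
Qed.

(** The condition that the lower right corner be 1 separates [Q] from its translate by [rho], where
    the corner is -1. *)
Definition orth_shape n (w : 'M[F]_(n + n + 1)) :=
  [&& dlsubmx (ulsubmx w) == 0, dsubmx (ursubmx w) == 0, lsubmx (dlsubmx w) == 0
    & drsubmx w == 1%:M].

Lemma orth_shapeP n (w : 'M[F]_(n + n + 1)) :
  reflect (exists A X D u h, w = orth_block A X D u h) (orth_shape w).
Proof.
apply: (iffP and4P) => [[/eqP h1 /eqP h2 /eqP h3 /eqP h4]|].
  exists (ulsubmx (ulsubmx w)), (ursubmx (ulsubmx w)), (drsubmx (ulsubmx w)),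
     (usubmx (ursubmx w)), (rsubmx (dlsubmx w)).
  by rewrite /orth_block -h4 -{1}h1 -h2 -h3 submxK vsubmxK hsubmxK submxK.
case=> A [X [D [u [h ->]]]].
by rewrite /orth_block block_mxKul block_mxKdl block_mxKur block_mxKdl block_mxKdr
  col_mxKd row_mxKl !eqxx.
Qed.

(** Equations in place of parameters: [rho], [sigma] and all factors preserve the form, so closure
    under products, conjugation by [rho] and the stabiliser condition reduce to checking a zero
    pattern. *)
Lemma mem_Q n (w : 'M[F]_(n + n + 1)) :
  (w \in Q F n) = (w^T *m orth_form n *m w == orth_form n) && orth_shape w.
Proof.
apply/idP/andP => [|[/eqP wJ /orth_shapeP[A [X [D [u [h wE]]]]]]].
  rewrite inE => /existsP[A /existsP[B /existsP[h /and3P[uA /eqP hB /eqP wE]]]].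
  rewrite wE -orth_paramE; split; last by apply/orth_shapeP; do 5 eexists.
  apply/eqP/orth_block_form; split.
  - by rewrite mulmxV // unitmx_tr.
  - rewrite trmx_inv trmxK trmx_mul mulKmx // -mulmxA mulmxV ?unitmx_tr //.
    by rewrite mulmx1 [B^T + B]addrC.
  - by rewrite trmx_inv trmxK mulmxN mulKmx // addNr.
rewrite inE; apply/existsP; exists A.
move: wJ; rewrite wE => /orth_block_form[e1 e2 e3].
have [uA uD] := mulmx1_unit e1;
  have DE : invmx A^T = D by rewrite -[RHS](mulKmx uA) e1 mulmx1.
have AD : A *m D^T = 1%:M by rewrite -DE trmx_inv trmxK mulmxV // -unitmx_tr.
apply/existsP; exists (D^T *m X); apply/existsP; exists h.
rewrite -unitmx_tr uA /= -orth_paramE /orth_param DE mulmxA AD mul1mx.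
rewrite trmx_mul trmxK [D^T *m X + _]addrC e2 eqxx /= (_ : u = - (A *m h^T)) //.
apply/eqP; rewrite -addr_eq0; apply/eqP.
by rewrite -[u]mul1mx -AD -mulmxA -mulmxDr e3 mulmx0.
Qed.

Lemma orth_formK n : orth_form n *m orth_form n = 1%:M.
Proof.
rewrite mulmx_block mulmx_block !(mulmx0, mulmx1, mul0mx) !(addr0, add0r).
by rewrite -!scalar_mx_block.
Qed.

Lemma Q_unit n w : w \in Q F n -> w \in unitmx.
Proof.
rewrite mem_Q => /andP[/eqP wJ _].
have : orth_form n *m w^T *m orth_form n *m w = 1%:M.
  by rewrite -2!mulmxA [w^T *m _]mulmxA wJ orth_formK.
by case/mulmx1_unit.
Qed.

Lemma Q_1 n : 1%:M \in Q F n.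
Proof.
rewrite mem_Q trmx1 mulmx1 mul1mx eqxx /=; apply/orth_shapeP.
exists 1%:M, 0, 1%:M, 0, 0.
by rewrite /orth_block col_mx0 row_mx0 -!scalar_mx_block.
Qed.

Lemma Q_mul n x y : x \in Q F n -> y \in Q F n -> x *m y \in Q F n.
Proof.
rewrite !mem_Q => /andP[/eqP xJ /orth_shapeP[A [X [D [u [h xE]]]]]].
case/andP=> /eqP yJ /orth_shapeP[A' [X' [D' [u' [h' yE]]]]].
rewrite form_mul // eqxx /=.
by rewrite xE yE orth_blockM; apply/orth_shapeP; do 5 eexists.
Qed.

Lemma rho_mul n : rho F n *m rho F n = 1%:M.
Proof.
rewrite mulmx_block !(mulmx0, mulmx1, mul0mx) !(addr0, add0r).
by rewrite mulNmx mulmxN opprK mul1mx -scalar_mx_block.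
Qed.

(** Needed to carry the right factor of x s y past [rho] in [sum_double_coset]; conjugation only
    changes the signs of [u] and [h]. *)
Lemma rho_conj_Q n x : x \in Q F n -> rho F n *m x *m rho F n \in Q F n.
Proof.
rewrite !mem_Q => /andP[/eqP xJ /orth_shapeP[A [X [D [u [h xE]]]]]].
have rT : (rho F n)^T = rho F n.
  by rewrite tr_block_mx !trmx0 linearN /= !trmx1.
have rJ : (rho F n)^T *m orth_form n *m rho F n = orth_form n.
  rewrite rT.
  rewrite !mulmx_block !(mulmx0, mulmx1, mul0mx, mul1mx) !(addr0, add0r).
  by rewrite mul0mx mulNmx mulmxN opprK mul1mx.
rewrite !form_mul // eqxx /=.
rewrite xE; apply/orth_shapeP; exists A, X, D, (- u), (- h).
rewrite !mulmx_block !(mulmx0, mulmx1, mul0mx, mul1mx) !(addr0, add0r).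
rewrite !(mulNmx, mulmxN, mul1mx, mulmx1) opprK /orth_block.
by rewrite opp_row_mx opp_col_mx !oppr0.
Qed.

Lemma sum_Q (C : nmodType) n (g : 'M[F]_(n + n + 1) -> C) :
  \sum_(x in Q F n) g x =
  \sum_(A in unitmx) \sum_(h : 'rV_n) \sum_(B | B + B^T + h^T *m h == 0)
     g (orth_param A B h).
Proof.
pose S := [set p : 'M[F]_n * 'rV[F]_n * 'M[F]_n | (p.1.1 \in unitmx) &&
   (p.2 + p.2^T + p.1.2^T *m p.1.2 == 0)].
have -> : Q F n = [set orth_param p.1.1 p.2 p.1.2 | p in S].
  apply/setP => w; rewrite inE;
    apply/existsP/imsetP => [[A /existsP[B /existsP[h]]]|].
    case/and3P=> uA hB /eqP ->; exists (A, h, B); first by rewrite inE uA.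
    by rewrite -orth_paramE.
  case=> -[[A h] B]; rewrite inE => /andP[uA hB] ->; exists A.
  by apply/existsP; exists B; apply/existsP; exists h;
    rewrite uA hB -orth_paramE /=.
rewrite big_imset /=; last first.
  move=> [[A h] B] [[A' h'] B']; rewrite !inE /= => /andP[uA _] /andP[uA' _].
  case/orth_block_inj => -> + _ _ ->.
  by move/(can_inj (mulKmx uA')) => ->.
rewrite pair_big /= pair_big_dep /=; apply: eq_bigl => p.
by rewrite inE andbT.
Qed.

End OrthogonalParabolic.

(** * The symplectic parabolic subgroup *)

Section SymplecticParabolic.
Variable F : finFieldType.

Definition symp_form n : 'M[F]_(n + n) := block_mx 0 1%:M (- 1%:M) 0.

Definition symp_param n (A B : 'M[F]_n) :=
  block_mx A (A *m B) 0 (invmx A^T).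

Lemma symp_paramE n (A B : 'M[F]_n) : symp_param A B =
  block_mx A 0 0 (invmx A^T) *m block_mx 1%:M B 0 1%:M.
Proof. by rewrite mulmx_block !(mul0mx, mulmx0, mulmx1) !(addr0, add0r). Qed.

Lemma symp_block_form n (A X D : 'M[F]_n) :
  (block_mx A X 0 D)^T *m symp_form n *m block_mx A X 0 D = symp_form n <->
  A^T *m D = 1%:M /\ X^T *m D = D^T *m X.
Proof.
rewrite tr_block_mx /symp_form !mulmx_block !(mulmx0, mulmx1, mul0mx, trmx0, mulmxN)
  !(addr0, add0r).
rewrite !mulNmx ?mul0mx ?oppr0 ?add0r.
split=> [/eq_block_mx[_ -> _ /eqP]|[e1 e2]].
  by rewrite addrC subr_eq0 => /eqP.
rewrite e1 e2 addNr; congr block_mx; congr (- _).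
by rewrite -[LHS]trmxK trmx_mul trmxK e1 trmx1.
Qed.

Lemma mem_Phat n (w : 'M[F]_(n + n)) :
  (w \in Phat F n) = (w^T *m symp_form n *m w == symp_form n) && (dlsubmx w == 0).
Proof.
apply/idP/andP => [|[/eqP wJ /eqP w0]].
  rewrite inE => /existsP[A /existsP[B /and3P[uA /eqP hB /eqP wE]]].
  rewrite wE -symp_paramE block_mxKdl eqxx; split=> //.
  apply/eqP/symp_block_form; split; first by rewrite mulmxV // unitmx_tr.
  rewrite trmx_inv trmxK trmx_mul mulKmx // -mulmxA mulmxV ?unitmx_tr //.
  by rewrite mulmx1.
rewrite inE; move: wJ; rewrite -[w]submxK w0.
move: (ulsubmx w) (ursubmx w) (drsubmx w) => A X D /symp_block_form[e1 e2].
apply/existsP; exists A; apply/existsP; exists (D^T *m X).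
have [uA uD] := mulmx1_unit e1;
  have DE : invmx A^T = D by rewrite -[RHS](mulKmx uA) e1 mulmx1.
have AD : A *m D^T = 1%:M by rewrite -DE trmx_inv trmxK mulmxV // -unitmx_tr.
rewrite -unitmx_tr uA /= -symp_paramE /symp_param DE mulmxA AD mul1mx eqxx andbT.
by rewrite trmx_mul trmxK e2.
Qed.

Lemma symp_formK n : - symp_form n *m symp_form n = 1%:M.
Proof.
rewrite mulNmx mulmx_block !(mulmx0, mul0mx, mulmxN, mulmx1) !(addr0, add0r).
by rewrite opp_block_mx !oppr0 opprK -scalar_mx_block.
Qed.

Lemma Phat_unit n w : w \in Phat F n -> w \in unitmx.
Proof.
rewrite mem_Phat => /andP[/eqP wJ _].
have : - symp_form n *m w^T *m symp_form n *m w = 1%:M.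
  by rewrite -2!mulmxA [w^T *m _]mulmxA wJ symp_formK.
by case/mulmx1_unit.
Qed.

Lemma Phat_1 n : 1%:M \in Phat F n.
Proof. by rewrite mem_Phat trmx1 mulmx1 mul1mx eqxx scalar_mx_block block_mxKdl /=.
  Qed.

Lemma Phat_mul n x y : x \in Phat F n -> y \in Phat F n -> x *m y \in Phat F n.
Proof.
rewrite !mem_Phat => /andP[/eqP xJ /eqP x0] /andP[/eqP yJ /eqP y0].
rewrite form_mul // eqxx /= -[x]submxK -[y]submxK x0 y0 mulmx_block block_mxKdl.
by rewrite mul0mx mulmx0 addr0.
Qed.

Lemma sum_Phat (C : nmodType) n (g : 'M[F]_(n + n) -> C) :
  \sum_(x in Phat F n) g x =
  \sum_(A in unitmx) \sum_(B in eps_sym 1 n) g (symp_param A B).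
Proof.
pose S := [set p : 'M[F]_n * 'M[F]_n | (p.1 \in unitmx) && (p.2 \in eps_sym 1 n)].
have -> : Phat F n = [set symp_param p.1 p.2 | p in S].
  apply/setP => w; rewrite inE; apply/existsP/imsetP => [[A /existsP[B]]|].
    case/and3P=> uA hB /eqP ->; exists (A, B); first by rewrite !inE scale1r uA.
    by rewrite -symp_paramE.
  case=> -[A B]; rewrite !inE scale1r => /andP[uA hB] ->; exists A.
  by apply/existsP; exists B; rewrite uA hB -symp_paramE /=.
rewrite big_imset /=; last first.
  move=> [A B] [A' B']; rewrite !inE /= => /andP[uA _] /andP[uA' _].
  case/eq_block_mx => -> + _ _.
  by move/(can_inj (mulKmx uA')) => ->.
rewrite pair_big /=; apply: eq_bigl => p.
by rewrite inE.
Qed.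

End SymplecticParabolic.

(** * Sums over the orthogonal parabolic *)

Section Blocks.
Variables (F : finFieldType) (k m : nat).
Local Notation q := #|F|.

Definition card_unitmx (n : nat) := #|[pred A : 'M[F]_n | A \in unitmx]|.

Lemma copid_mx_block : copid_mx k = block_mx 0 0 0 1%:M :> 'M[F]_(k + m).
Proof.
by rewrite /copid_mx pid_mx_block scalar_mx_block opp_block_mx add_block_mx !subr0
  subrr.
Qed.

Lemma invmx_lblock (A1 : 'M[F]_k) A3 (A4 : 'M[F]_m) :
  block_mx A1 0 A3 A4 \in unitmx ->
  invmx (block_mx A1 0 A3 A4) =
  block_mx (invmx A1) 0 (- (invmx A4 *m A3 *m invmx A1)) (invmx A4).
Proof.
move=> uA; move: (uA); rewrite unitmx_lblock => /andP[u1 u4].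
apply: (can_inj (mulKmx uA)); rewrite mulmxV // mulmx_block !(mul0mx, mulmx0).
by rewrite !(addr0, add0r) mulmxN !mulmxV // -mulmxA mulKVmx // subrr
  -scalar_mx_block.
Qed.

(** Once the upper right block of [A] has been forced to vanish, only the argument of a Kloosterman
    sum over GL(m) is left of these two traces. *)
Lemma trace_lblock (A1 : 'M[F]_k) (A3 : 'M[F]_(m, k)) (A4 : 'M[F]_m) :
   block_mx A1 0 A3 A4 \in unitmx ->
   \tr (block_mx A1 0 A3 A4 *m copid_mx k) + \tr
     (invmx (block_mx A1 0 A3 A4)^T *m copid_mx k) =
   \tr A4 + \tr (invmx A4).
Proof.
move=> uA; rewrite -trmx_inv invmx_lblock // tr_block_mx copid_mx_block
  !mulmx_block.
by rewrite !(mulmx0, mul0mx, mulmx1) !(addr0, add0r) !mxtrace_block !mxtrace0 !add0r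
  mxtrace_tr.
Qed.

Lemma sum_unit_lblock (C : nmodType) (g : 'M[F]_(k + m) -> C) :
  \sum_(A in unitmx | ursubmx A == 0) g A =
  \sum_(A1 in unitmx) \sum_(A4 in unitmx) \sum_A3 g (block_mx A1 0 A3 A4).
Proof.
rewrite pair_big /= pair_big /=.
rewrite (reindex (fun p : 'M[F]_k * 'M[F]_m * 'M[F]_(m, k) =>
   block_mx p.1.1 0 p.2 p.1.2)) /=; last first.
  exists (fun S => (ulsubmx S, drsubmx S, dlsubmx S)) => [[[A1 A4] A3]|S] hS /=.
    by rewrite block_mxKul block_mxKdl block_mxKdr.
  by case/andP: hS => _ /eqP <-; rewrite submxK.
apply: eq_bigl => [[[A1 A4] A3]] /=.
by rewrite unitmx_lblock block_mxKur eqxx !andbT.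
Qed.

(** The product with [pid_mx k] keeps the first [k] rows [A1 A2] of [A] and puts 0 below them; being
    in [eps_sym e] therefore means that A2 = 0 and A1 is in [eps_sym e k]. *)
Lemma sum_unit_eps_sym (C : nzRingType) e (g : 'M[F]_(k + m) -> C) : e * e = 1 ->
  \sum_(A in unitmx) (pid_mx k *m A \in eps_sym e (k + m))%:R * g A =
  \sum_(A1 in eps_sym e k | A1 \in unitmx) \sum_(A4 in unitmx) \sum_A3
     g (block_mx A1 0 A3 A4).
Proof.
move=> ee.
rewrite (bigID (fun A : 'M_(k + m) => ursubmx A == 0)) /= sum_unit_lblock.
have pidA (A : 'M[F]_(k + m)) :
  (pid_mx k *m A \in eps_sym e (k + m)) = (ulsubmx A \in eps_sym e k) &&
    (ursubmx A == 0).
  rewrite -[X in _ *m X]submxK pid_mx_block mulmx_block !mul1mx !mul0mx !addr0.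
  rewrite eps_sym_block // eq_sym scaler_eq0 trmx_eq0.
  rewrite [0 \in _]inE trmx0 scaler0 eqxx andbT.
  by case: (eqVneq e 0) => // e0; move: ee; rewrite e0 mul0r => /esym/eqP/negPn;
    rewrite oner_eq0.
rewrite [X in _ + X]big1 ?addr0; last first.
  by move=> A /andP[_ /negPf h]; rewrite pidA h andbF mul0r.
rewrite [RHS](eq_bigl (fun A1 : 'M_k => (A1 \in unitmx) && (A1 \in eps_sym e k)));
  last first.
  by move=> A1; rewrite andbC.
rewrite [RHS]big_mkcondr /=; apply: eq_bigr => A1 _.
under eq_bigr => A4 _ do under eq_bigr => A3 _ do
  rewrite pidA block_mxKul block_mxKur eqxx andbT.
case: (A1 \in _).
  by apply: eq_bigr => A4 _; apply: eq_bigr => A3 _; rewrite mul1r.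
by rewrite big1 // => A4 _; rewrite big1 // => A3 _; rewrite mul0r.
Qed.

End Blocks.

Section OrthogonalSums.
Variables (F : finFieldType) (k m : nat).
Hypothesis ch3 : 3%N \in [pchar F].
Local Notation q := #|F|.
Local Notation n := (k + m)%N.
Local Notation p := (pid_mx k : 'M[F]_n).
Local Notation c := (copid_mx k : 'M[F]_n).

Lemma sigma_mul : sigma F n k *m sigma F n k = 1%:M.
Proof.
rewrite !mulmx_block !(mulmx0, mul0mx, mulmx1) !(addr0, add0r).
rewrite copid_mx_block pid_mx_block !mulmx_block !(mulmx0, mul0mx, mulmx1)
  !(addr0, add0r).
by rewrite !add_block_mx !(addr0, add0r) !block_mx0 -!scalar_mx_block.
Qed.

Lemma sigma_form : (sigma F n k)^T *m orth_form F n *m sigma F n k = orth_form F n.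
Proof.
have -> : (sigma F n k)^T = sigma F n k.
  rewrite /sigma !tr_block_mx !trmx0 trmx1 copid_mx_block pid_mx_block.
  by rewrite !tr_block_mx !trmx0 !trmx1.
rewrite /sigma /orth_form !mulmx_block !(mulmx0, mul0mx, mulmx1) !(addr0, add0r).
rewrite copid_mx_block pid_mx_block !mulmx_block !(mulmx0, mul0mx, mulmx1)
  !(addr0, add0r).
by rewrite !add_block_mx !(addr0, add0r) !block_mx0 -!scalar_mx_block.
Qed.

(** In characteristic 3 the symmetric matrix h^T h is itself a solution B, since three times it is
    0; all other solutions differ from it by a skew matrix. *)
Lemma skew_shift (C : nmodType) j (h : 'rV[F]_j) (g : 'M[F]_j -> C) :
  \sum_(B | B + B^T + h^T *m h == 0) g B =
  \sum_(S in eps_sym (-1) j) g (S + h^T *m h).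
Proof.
rewrite (reindex_inj (addIr (h^T *m h))) /=; apply: eq_bigl => S.
rewrite inE linearD /= trmx_mul trmxK scaleN1r -addr_eq0.
set T := h^T *m h.
have T0 : T + T + T = 0 by rewrite -mulr2n -mulrSr -scaler_nat (pcharf0 ch3)
  scale0r.
have -> : S + T + (S^T + T) + T = S^T + S + (T + T + T).
  by rewrite [S + T + _]addrACA [S + _]addrC !addrA.
by rewrite T0 addr0.
Qed.

Lemma orth_shape_sigma (A X D : 'M[F]_n) u h :
  orth_shape (sigma F n k *m orth_block A X D u h *m sigma F n k) =
  [&& p *m A *m c + p *m X *m p + c *m D *m p == 0, p *m u == 0 & h *m p == 0].
Proof.
rewrite /sigma /orth_block !mulmx_block mul_block_col.
rewrite !(mulmx0, mul0mx, mul1mx, mulmx1) !(addr0, add0r).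
rewrite /orth_shape !(block_mxKul, block_mxKdl, block_mxKur, block_mxKdr).
rewrite mul_row_block mul_block_col.
rewrite !(mulmx0, mul0mx, mulmx1) !(addr0, add0r) col_mxKd row_mxKl eqxx andbT.
by rewrite !mul_mx_row !add_row_mx -block_mxEv block_mxKdl mulmxDl addrA.
Qed.

Lemma sigma_block_eq0 (A X D : 'M[F]_n) :
  (p *m A *m c + p *m X *m p + c *m D *m p == 0) =
  [&& ulsubmx X == 0, ursubmx A == 0 & dlsubmx D == 0].
Proof.
rewrite -{1}[A]submxK -{1}[X]submxK -{1}[D]submxK copid_mx_block pid_mx_block
  !mulmx_block.
rewrite !(mulmx0, mul0mx, mulmx1, mul1mx) !(addr0, add0r) !add_block_mx
  !(addr0, add0r).
by rewrite block_mx_eq0 eqxx andbT.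
Qed.

Lemma dl_invmx_tr (A : 'M[F]_n) : A \in unitmx -> ursubmx A = 0 -> dlsubmx
  (invmx A^T) = 0.
Proof.
move=> uA A0; rewrite -trmx_inv -trmx_ursub; apply: trmx_inj; rewrite trmxK trmx0.
by rewrite -[A]submxK A0 in uA *; rewrite invmx_lblock // block_mxKur.
Qed.

(** The sign [e] is 1 for the orthogonal group and -1 for the symplectic one, where the two copies
    of [pid_mx k] have opposite signs. The condition on the inverse transpose follows from the one
    on [A], because the inverse of a block triangular matrix is again block triangular. *)
Lemma sigma_block_param e (A B : 'M[F]_n) : A \in unitmx ->
  (p *m A *m c + p *m (A *m B) *m p + c *m (e *: invmx A^T) *m p == 0) =
  (ursubmx A == 0) && (ulsubmx B == 0).
Proof.
move=> uA; rewrite sigma_block_eq0.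
case: (eqVneq (ursubmx A) 0) => [A0|_]; last by rewrite andbF.
have -> : dlsubmx (e *: invmx A^T) = e *: dlsubmx (invmx A^T).
  by apply/matrixP => i j; rewrite !mxE.
rewrite dl_invmx_tr // scaler0 eqxx andbT /= -[A]submxK -{1}[B]submxK mulmx_block
  block_mxKul A0.
rewrite mul0mx addr0.
have u1 : ulsubmx A \in unitmx.
  by move: uA; rewrite -[A]submxK A0 unitmx_lblock block_mxKul => /andP[].
rewrite andbT; apply/eqP/eqP => [/(congr1 (mulmx (invmx (ulsubmx A))))|->];
  last by rewrite mulmx0.
by rewrite mulKmx // mulmx0.
Qed.

Lemma sigma_unit : sigma F n k \in unitmx.
Proof. by have [] := mulmx1_unit sigma_mul. Qed.

Lemma sigma_inv : invmx (sigma F n k) = sigma F n k.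
Proof. by rewrite -[RHS](mulKmx sigma_unit) sigma_mul mulmx1. Qed.

Lemma mem_orth_param j (A B : 'M[F]_j) h :
  A \in unitmx -> B + B^T + h^T *m h == 0 -> orth_param A B h \in Q F j.
Proof.
move=> uA hB; rewrite inE; apply/existsP; exists A; apply/existsP; exists B.
by apply/existsP; exists h; rewrite uA hB -orth_paramE /=.
Qed.

(** The conjugate preserves the form automatically, so only its zero pattern is tested; the
    condition on the column - A h^T follows from those on [A] and [h]. *)
Lemma orth_stab (A B : 'M[F]_n) h : A \in unitmx -> B + B^T + h^T *m h == 0 ->
  (sigma F n k *m orth_param A B h *m invmx (sigma F n k) \in Q F n) =
  [&& ursubmx A == 0, ulsubmx B == 0 & lsubmx h == 0].
Proof.
move=> uA hB; have := mem_orth_param uA hB; rewrite mem_Q => /andP[/eqP wJ _].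
have sJ := sigma_form; rewrite sigma_inv mem_Q !form_mul // eqxx /=.
rewrite orth_shape_sigma -[invmx A^T]scale1r sigma_block_param //.
case: (eqVneq (ursubmx A) 0) => //= A0; congr (_ && _).
have pv (v : 'cV[F]_n) : (p *m v == 0) = (usubmx v == 0).
  rewrite -{1}[v]vsubmxK pid_mx_block mul_block_col mul1mx !mul0mx !addr0.
  by rewrite col_mx_eq0 eqxx andbT.
have -> : (h *m p == 0) = (lsubmx h == 0).
  rewrite -{1}[h]hsubmxK pid_mx_block mul_row_block mulmx1 !mulmx0 !addr0.
  by rewrite row_mx_eq0 eqxx andbT.
case: (eqVneq (lsubmx h) 0) => [h0|_]; last by rewrite andbF.
rewrite andbT pv -[A]submxK A0 -[h]hsubmxK h0 tr_row_mx trmx0 mul_block_col.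
by rewrite mulmx0 mul0mx addr0 opp_col_mx col_mxKu oppr0 eqxx.
Qed.

Lemma card_Q : #|Q F n| = (card_unitmx F n * q ^ 'C(n.+1, 2))%N.
Proof.
rewrite -sum1_card (sum_Q (fun=> 1%N)).
rewrite (eq_bigr (fun=> q ^ 'C(n.+1, 2))%N) ?sum_nat_const // => A _.
rewrite (eq_bigr (fun=> q ^ 'C(n, 2))%N) => [|h _].
  by rewrite sum_nat_const card_mx mul1n -expnD binS bin1 addnC.
by rewrite skew_shift sum1_card card_skew.
Qed.

(** The lower left block of [A] gives q^(km), [h] gives q^m, and the skew part of [B] gives q^(km)
    q^C(m,2). Since C(m,2) + m = C(m+1,2), the order agrees with [card_symp_stab]. *)
Lemma card_orth_stab : #|coset_stab (Q F n) (sigma F n k)| =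
  (card_unitmx F k * card_unitmx F m * q ^ (2 * (k * m)) * q ^ 'C(m.+1, 2))%N.
Proof.
rewrite -sum1_card big_mkcond (eq_bigr (fun x => if x \in Q F n then
  if sigma F n k *m x *m invmx (sigma F n k) \in Q F n then 1%N else 0%N else 0%N));
    last first.
  by move=> x _; rewrite inE; case: (x \in Q F n).
rewrite -big_mkcond (sum_Q
  (fun x => if sigma F n k *m x *m invmx (sigma F n k) \in Q F n then 1%N else
    0%N)).
rewrite (eq_bigr (fun A : 'M[F]_n => if ursubmx A == 0 then
  (q ^ m * (q ^ (k * m) * q ^ 'C(m, 2)))%N else 0%N)).
  rewrite -big_mkcondr sum_unit_lblock !sumr_const !natmulE card_mx binS bin1 expnD.
  rewrite mulnC [(m * k)%N]mulnC mul2n -addnn expnD; ring.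
move=> A uA; case: (eqVneq (ursubmx A) 0) => A0; last first.
  rewrite big1 // => h _; rewrite big1 // => B hB.
  by rewrite orth_stab // (negPf A0).
rewrite (eq_bigr (fun h : 'rV[F]_n => if lsubmx h == 0 then
  (q ^ (k * m) * q ^ 'C(m, 2))%N else 0%N)).
  rewrite -big_mkcond (reindex (row_mx (0 : 'rV[F]_k))) /=; last first.
    exists rsubmx => [v _|v /eqP <-]; [exact: row_mxKr | exact: hsubmxK].
  rewrite (eq_bigl xpredT) => [|v]; last by rewrite row_mxKl eqxx.
  by rewrite sumr_const natmulE card_mx mul1n.
move=> h _.
case: (eqVneq (lsubmx h) 0) => h0; last first.
  by rewrite big1 // => B hB; rewrite orth_stab // A0 eqxx (negPf h0) andbF.
rewrite -card_skew // -card_eps_sym_ul0 ?mulrNN ?mulr1 //.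
rewrite (eq_bigr (fun B : 'M[F]_n => if ulsubmx B == 0 then 1%N else 0%N));
  last first.
  by move=> B hB; rewrite orth_stab // A0 h0 !eqxx andbT.
rewrite skew_shift -big_mkcondr -sum1_card; apply: eq_bigl => S.
rewrite inE -[h]hsubmxK h0 tr_row_mx trmx0 mul_col_row mul0mx.
by rewrite -{2}[S]submxK add_block_mx block_mxKul addr0.
Qed.

Lemma orth_param_trace (e : F) (A B : 'M[F]_n) h :
  \tr (block_mx 1%:M 0 0 (e%:M : 'M_1) *m (orth_param A B h *m sigma F n k)) =
  \tr (A *m c) + \tr (A *m B *m p) + \tr (invmx A^T *m c) + e.
Proof.
rewrite /orth_param /orth_block /sigma !mulmx_block
  !(mulmx0, mul0mx, mul1mx, mulmx1) !(addr0, add0r).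
by rewrite !mxtrace_block mulmx1 mxtrace_scalar mulr1n mxtraceD.
Qed.

Section Character.
Variables (C : numFieldType) (psi : F -> C).
Hypothesis hpsi : nontrivial_character psi.

(* The sum over the skew part S of B vanishes unless the first k rows of A are
   [A1 0] with A1 symmetric; the sum over h then yields Gauss sums. *)
Lemma char_sum_Q (e a : F) : a != 0 -> ~~ odd k ->
  \sum_(x in Q F n) psi (a * \tr
    (block_mx 1%:M 0 0 (e%:M : 'M_1) *m (x *m sigma F n k)))
  = psi (a * e) * (q ^ 'C(n.+1, 2) * q ^ (m * k) * inv_sym (-1 : F) k)%:R *
    kloosterman_GL psi m a.
Proof.
move=> a0 ek; have [psi0 psiD _] := hpsi.
rewrite sum_Q.
have termE (A : 'M[F]_n) : \sum_h \sum_(B | B + B^T + h^T *m h == 0)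
   psi (a * \tr (block_mx 1%:M 0 0 (e%:M : 'M_1) *m
     (orth_param A B h *m sigma F n k))) =
   (p *m A \in eps_sym 1 n)%:R *
     (psi (a * e) * psi (a * (\tr (A *m c) + \tr (invmx A^T *m c))) *
     (q ^ 'C(n, 2))%:R * \sum_(h : 'rV_n) psi (a * (h *m (p *m A) *m h^T) 0 0)).
  rewrite mulrA mulr_sumr; apply: eq_bigr => h _; rewrite skew_shift.
  rewrite (eq_bigr (fun S => psi (a * e) * psi
    (a * (\tr (A *m c) + \tr (invmx A^T *m c))) *
     psi (a * (h *m (p *m A) *m h^T) 0 0) * psi (a * \tr (p *m A *m S)))).
    rewrite -mulr_sumr (sum_char_eps_sym _ hpsi ch3) ?mulrNN ?mulr1 // opprK
      card_skew //.
    ring.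
  move=> S _; rewrite orth_param_trace -!psiD; congr psi.
  (* Cyclicity of the trace turns the shift h^T h into the value at [h] of the quadratic form with
     matrix [p *m A]. *)
  have -> : \tr (A *m (S + h^T *m h) *m p) = \tr (p *m A *m S) +
    (h *m (p *m A) *m h^T) 0 0.
    rewrite mxtrace_mulC mulmxA mulmxDr mxtraceD; congr (_ + _).
    by rewrite mulmxA mxtrace_mulC mulmxA trace_mx11.
  ring.
rewrite (eq_bigr _ (fun A _ => termE A)) sum_unit_eps_sym ?mulr1 //.
(* The last [m] coordinates of [h] do not enter the quadratic form and contribute the factor q^m. *)
have quadE (A1 : 'M[F]_k) (A3 : 'M[F]_(m, k)) (A4 : 'M[F]_m) :
   \sum_(h : 'rV_n) psi (a * (h *m (p *m block_mx A1 0 A3 A4) *m h^T) 0 0) =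
   (q ^ m)%:R * \sum_(h : 'rV_k) psi (a * (h *m A1 *m h^T) 0 0).
  rewrite (reindex (fun v : 'rV[F]_k * 'rV[F]_m => row_mx v.1 v.2)) /=; last first.
    exists (fun v => (lsubmx v, rsubmx v)) => [[v w] _|v _] /=.
      by rewrite row_mxKl row_mxKr.
    exact: hsubmxK.
  rewrite -(pair_big xpredT xpredT
    (fun v w => psi (a * (row_mx v w *m (p *m block_mx A1 0 A3 A4) *m
      (row_mx v w)^T) 0 0))) /=.
  rewrite mulr_sumr; apply: eq_bigr => v _.
  rewrite (eq_bigr (fun=> psi (a * (v *m A1 *m v^T) 0 0))) => [|w _].
    by rewrite sumr_const card_mx mul1n mulr_natl.
  rewrite pid_mx_block mulmx_block !(mul1mx, mul0mx) !addr0 mul_row_block tr_row_mx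
    mul_row_col.
  by rewrite !mulmx0 !addr0 mul0mx addr0.
transitivity (\sum_(A1 in eps_sym 1 k | A1 \in unitmx) psi (a * e) *
  (q ^ 'C(n, 2))%:R *
   (q ^ (m * k))%:R * (q ^ m)%:R * (\sum_(h : 'rV_k) psi (a * (h *m A1 *m h^T) 0 0))
     *
   kloosterman_GL psi m a).
  apply: eq_bigr => A1 /andP[_ u1]; rewrite [RHS]mulr_sumr; apply: eq_bigr => A4 u4.
  rewrite (eq_bigr (fun=> psi (a * e) * psi (a * (\tr A4 + \tr (invmx A4))) *
    (q ^ 'C(n, 2))%:R *
     ((q ^ m)%:R * \sum_(h : 'rV_k) psi (a * (h *m A1 *m h^T) 0 0)))).
    by rewrite sumr_const card_mx -mulr_natl; ring.
  by move=> A3 _; rewrite quadE trace_lblock // unitmx_lblock u1 u4.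
rewrite -mulr_suml -mulr_sumr; congr (_ * _).
have := sum_gauss_sym hpsi ch3 k./2 a0; rewrite (even_halfK ek) => ->.
(* The factors q^m from the free coordinates of [h] and q^k from the Gauss sums complete q^C(n,2),
   the number of skew [S], to q^C(n+1,2), the number of symmetric [B] in the symplectic sum. *)
have -> : 'C(n.+1, 2) = ('C(n, 2) + (k + m))%N by rewrite binS bin1.
by rewrite !expnD !natrM; ring.
Qed.
End Character.

End OrthogonalSums.

(** * Sums over the symplectic parabolic *)

Section SymplecticSums.
Variables (F : finFieldType) (k m : nat).
Hypothesis ch3 : 3%N \in [pchar F].
Local Notation q := #|F|.
Local Notation n := (k + m)%N.
Local Notation p := (pid_mx k : 'M[F]_n).
Local Notation c := (copid_mx k : 'M[F]_n).

Lemma sigmahat_tr_mul : sigmahat F n k *m (sigmahat F n k)^T = 1%:M.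
Proof.
rewrite /sigmahat tr_block_mx linearN /= !mulmx_block copid_mx_block pid_mx_block.
rewrite !tr_block_mx !trmx0 !trmx1 !(mulNmx, mulmxN) !mulmx_block
  !(mulmx0, mul0mx, mulmx1) !(addr0, add0r).
by rewrite !opp_block_mx !opprK !oppr0 !add_block_mx !(addr0, add0r, addNr, subrr)
  !block_mx0 -!scalar_mx_block.
Qed.

Lemma sigmahat_unit : sigmahat F n k \in unitmx.
Proof. by have [] := mulmx1_unit sigmahat_tr_mul. Qed.

Lemma sigmahat_inv : invmx (sigmahat F n k) = block_mx c (- p) p c.
Proof.
have -> : block_mx c (- p) p c = (sigmahat F n k)^T.
  rewrite /sigmahat tr_block_mx linearN /= copid_mx_block pid_mx_block.
  by rewrite !tr_block_mx !trmx0 !trmx1.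
by rewrite -[RHS](mulKmx sigmahat_unit) sigmahat_tr_mul mulmx1.
Qed.

Lemma sigmahat_form : (sigmahat F n k)^T *m symp_form F n *m sigmahat F n k =
  symp_form F n.
Proof.
rewrite /sigmahat /symp_form tr_block_mx linearN /= copid_mx_block pid_mx_block.
rewrite !tr_block_mx !trmx0 !trmx1 !mulmx_block
  !(mulNmx, mulmxN, mulmx0, mul0mx, mulmx1) !(addr0, add0r).
rewrite !mulmx_block !(mulmx0, mul0mx, mulmx1) !(addr0, add0r).
rewrite ?subr0 ?opprK !mulNmx !mulmx_block !(mulmx0, mul0mx, mulmx1) !(addr0, add0r)
  !opp_block_mx.
rewrite !add_block_mx !oppr0 !(addr0, add0r) ?block_mx0 ?opprK -?scalar_mx_block.
by congr block_mx; rewrite scalar_mx_block opp_block_mx !oppr0.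
Qed.

Lemma sigmahat_inv_form :
  (invmx (sigmahat F n k))^T *m symp_form F n *m invmx (sigmahat F n k) = symp_form
    F n.
Proof.
have us := sigmahat_unit.
rewrite -[in LHS]sigmahat_form -!mulmxA mulmxV // mulmx1 mulmxA.
by rewrite -trmx_mul mulmxV // trmx1 mul1mx.
Qed.

Lemma mem_symp_param j (A B : 'M[F]_j) :
  A \in unitmx -> B \in eps_sym 1 j -> symp_param A B \in Phat F j.
Proof.
rewrite inE scale1r => uA hB; rewrite inE; apply/existsP; exists A.
by apply/existsP; exists B; rewrite uA hB -symp_paramE /=.
Qed.

Lemma symp_stab (A B : 'M[F]_n) : A \in unitmx -> B \in eps_sym 1 n ->
  (sigmahat F n k *m symp_param A B *m invmx (sigmahat F n k) \in Phat F n) =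
  (ursubmx A == 0) && (ulsubmx B == 0).
Proof.
move=> uA hB; have := mem_symp_param uA hB; rewrite mem_Phat => /andP[/eqP wJ _].
have sJ := sigmahat_form; have sJ' := sigmahat_inv_form.
rewrite mem_Phat !form_mul // eqxx /= sigmahat_inv -(sigma_block_param (-1)) //.
rewrite /sigmahat /symp_param !mulmx_block block_mxKdl; move: c => c'.
rewrite !(mulmx0, addr0) !(mulNmx, mulmxDl) -oppr_eq0.
by rewrite scaleN1r mulmxN mulNmx !opprD !opprK addrA.
Qed.

Lemma card_Phat : #|Phat F n| = (card_unitmx F n * q ^ 'C(n.+1, 2))%N.
Proof.
rewrite -sum1_card (sum_Phat (fun=> 1%N)).
rewrite (eq_bigr (fun=> q ^ 'C(n.+1, 2))%N) ?sum_nat_const // => A _.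
by rewrite muln1 card_sym.
Qed.

Lemma card_symp_stab : #|coset_stab (Phat F n) (sigmahat F n k)| =
  (card_unitmx F k * card_unitmx F m * q ^ (2 * (k * m)) * q ^ 'C(m.+1, 2))%N.
Proof.
rewrite -sum1_card big_mkcond (eq_bigr (fun x => if x \in Phat F n then
  if sigmahat F n k *m x *m invmx (sigmahat F n k) \in Phat F n then 1%N else 0%N
    else 0%N)); last first.
  by move=> x _; rewrite inE; case: (x \in Phat F n).
rewrite -big_mkcond (sum_Phat
  (fun x => if sigmahat F n k *m x *m invmx (sigmahat F n k) \in Phat F n then 1%N
    else 0%N)).
rewrite (eq_bigr (fun A : 'M[F]_n => if ursubmx A == 0 then
  (q ^ (k * m) * q ^ 'C(m.+1, 2))%N else 0%N)).
  rewrite -big_mkcondr sum_unit_lblock !sumr_const !natmulE card_mx.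
  rewrite mulnC [(m * k)%N]mulnC mul2n -addnn expnD; ring.
move=> A uA; case: (eqVneq (ursubmx A) 0) => A0; last first.
  by rewrite big1 // => B hB; rewrite symp_stab // (negPf A0).
rewrite -card_sym -card_eps_sym_ul0 ?mulr1 //.
rewrite (eq_bigr (fun B : 'M[F]_n => if ulsubmx B == 0 then 1%N else 0%N));
  last first.
  by move=> B hB; rewrite symp_stab // A0 !eqxx.
by rewrite -big_mkcondr -sum1_card; apply: eq_bigl => S; rewrite inE.
Qed.

Lemma symp_param_trace (A B : 'M[F]_n) :
  \tr (symp_param A B *m sigmahat F n k) =
  \tr (A *m c) - \tr (A *m B *m p) + \tr (invmx A^T *m c).
Proof.
rewrite /symp_param /sigmahat !mulmx_block !(mulmx0, mul0mx, mul1mx, mulmx1)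
  !(addr0, add0r).
by rewrite !mxtrace_block mulmxN linearB.
Qed.

Section Character.
Variables (C : numFieldType) (psi : F -> C).
Hypothesis hpsi : nontrivial_character psi.

(** There is no vector [h] and hence no Gauss sum: every invertible alternating upper left block
    contributes the same amount, so the count [inv_sym (-1) k] appears directly. *)
Lemma char_sum_Phat (a : F) : a != 0 ->
  \sum_(x in Phat F n) psi (a * \tr (x *m sigmahat F n k))
  = (q ^ 'C(n.+1, 2) * q ^ (m * k) * inv_sym (-1 : F) k)%:R * kloosterman_GL psi m
    a.
Proof.
move=> a0; have [psi0 psiD _] := hpsi.
rewrite sum_Phat.
have termE (A : 'M[F]_n) : \sum_(B in eps_sym 1 n)
   psi (a * \tr (symp_param A B *m sigmahat F n k)) =
   (p *m A \in eps_sym (-1) n)%:R *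
     (psi (a * (\tr (A *m c) + \tr (invmx A^T *m c))) *
     (q ^ 'C(n.+1, 2))%:R).
  rewrite (eq_bigr (fun B => psi (a * (\tr (A *m c) + \tr (invmx A^T *m c))) *
     psi (- a * \tr (p *m A *m B)))).
    rewrite -mulr_sumr (sum_char_eps_sym _ hpsi ch3) ?mulr1 ?oppr_eq0 // card_sym.
    ring.
  move=> S _; rewrite symp_param_trace -!psiD; congr psi.
  rewrite [\tr (A *m S *m p)]mxtrace_mulC mulmxA.
  ring.
rewrite (eq_bigr _ (fun A _ => termE A)) sum_unit_eps_sym ?mulrNN ?mulr1 //.
rewrite (eq_bigr (fun=> (q ^ 'C(n.+1, 2))%:R * (q ^ (m * k))%:R * kloosterman_GL psi
  m a)).
  rewrite (eq_bigl (fun S => S \in [set S in eps_sym (-1 : F) k | S \in unitmx])).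
    rewrite sumr_const -/(inv_sym _ _) -[LHS]mulr_natl !natrM; ring.
  by move=> S; rewrite inE.
move=> A1 /andP[_ u1]; rewrite mulr_sumr; apply: eq_bigr => A4 u4.
rewrite (eq_bigr (fun=> psi (a * (\tr A4 + \tr (invmx A4))) *
  (q ^ 'C(n.+1, 2))%:R)).
  by rewrite sumr_const card_mx -mulr_natl; ring.
by move=> A3 _; rewrite trace_lblock // unitmx_lblock u1 u4.
Qed.
End Character.

End SymplecticSums.

(** * Group orders *)

Section GroupOrders.
Variable F : finFieldType.
Local Notation q := #|F|.

Lemma card_unitmxE n :
  card_unitmx F n = (q ^ 'C(n, 2) * \prod_(1 <= i < n.+1) (q ^ i - 1))%N.
Proof.
case: n => [|n].
  rewrite big_geq // muln1 expn0; apply: (@eq_card1 _ (0 : 'M_0)) => A.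
  by rewrite !inE [A]flatmx0 eqxx unitmxE det_mx00 unitr1.
by rewrite -card_GL // cardsT /= card_sub; apply: eq_card => A; rewrite inE.
Qed.

Lemma card_unitmxS n :
  card_unitmx F n.+1 = (card_unitmx F n * (q ^ n * (q ^ n.+1 - 1)))%N.
Proof.
rewrite !card_unitmxE big_nat_recr //= binS bin1 expnD; ring.
Qed.

Definition odd_prod l := (\prod_(1 <= j < l.+1) (q ^ (2 * j - 1) - 1))%N.
Definition even_prod l := (\prod_(1 <= j < l.+1) (q ^ (2 * j) - 1))%N.

Lemma odd_prodS l : odd_prod l.+1 = (odd_prod l * (q ^ l.*2.+1 - 1))%N.
Proof.
rewrite /odd_prod big_nat_recr //= (_ : (2 * l.+1 - 1 = l.*2.+1)%N) //.
by rewrite -mul2n mulnS addSn subn1.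
Qed.

Lemma even_prodS l : even_prod l.+1 = (even_prod l * (q ^ l.*2.+2 - 1))%N.
Proof. by rewrite /even_prod big_nat_recr //= mul2n doubleS. Qed.

Lemma inv_skew_even l : 3%N \in [pchar F] ->
  inv_sym (-1 : F) l.*2 = (q ^ (l * (l - 1)) * odd_prod l)%N.
Proof.
move=> ch3; elim: l => [|l IH]; first by rewrite inv_sym0 /odd_prod big_geq.
rewrite doubleS inv_skewSS // IH odd_prodS.
rewrite (_ : (l.+1 * (l.+1 - 1) = l.*2 + l * (l - 1))%N); last first.
  by case: (l) => [|u] //; rewrite !subn1 /=; lia.
rewrite expnD; ring.
Qed.

Lemma card_unitmx_even l :
  card_unitmx F l.*2 = (q ^ (l * (2 * l - 1)) * odd_prod l * even_prod l)%N.
Proof.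
elim: l => [|l IH].
  by rewrite card_unitmxE /odd_prod /even_prod !big_geq.
rewrite doubleS !card_unitmxS IH odd_prodS even_prodS.
rewrite (_ : (2 * l.+1 - 1 = l.*2.+1)%N); last by rewrite mul2n doubleS subn1.
rewrite (_ : (l.+1 * l.*2.+1 = l.*2 + l.*2.+1 + l * (2 * l - 1))%N); last first.
  by rewrite -!mul2n; case: (l) => [|u] //;
    rewrite (_ : 2 * u.+1 - 1 = 2 * u + 1)%N; lia.
rewrite !expnD. ring.
Qed.

Lemma qbinom1 n : (qbinom q n 1 * (q - 1) = q ^ n - 1)%N.
Proof.
rewrite /qbinom !big_ord_recl !big_ord0 !muln1 !subn0 expn1 divnK //.
by rewrite !subn1 predn_exp dvdn_mulr.
Qed.

Lemma qbinom2 l : (qbinom q l.*2.+2 2 * ((q ^ 2 - 1) * (q - 1)) =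
  (q ^ l.*2.+2 - 1) * (q ^ l.*2.+1 - 1))%N.
Proof.
rewrite /qbinom !big_ord_recl !big_ord0 !muln1 /bump /= !subn0 !subSS subn0 expn1.
rewrite divnK // dvdn_mul //; last by rewrite !subn1 predn_exp dvdn_mulr.
by rewrite -doubleS -mul2n expnM !subn1 [X in (_ %| X)%N]predn_exp dvdn_mulr.
Qed.

Lemma card_unitmx0 : card_unitmx F 0 = 1%N.
Proof. by rewrite card_unitmxE big_geq. Qed.

Lemma AmE l : Am (l.*2 + 1) q =
  (q ^ (5 * l ^ 2 + 5 * l + 1) * qbinom q (l.*2 + 1) 1 * odd_prod l)%N.
Proof.
rewrite /Am /odd_prod addnK -muln2 mulnK //; congr (_ ^ _ * _ * _)%N.
rewrite (_ : (5 * _ - 1 = (5 * l ^ 2 + 5 * l + 1) * 4)%N) ?mulnK //.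
rewrite muln2 -mul2n !expnS !expn0; lia.
Qed.

Lemma BmE l : Bm (l.*2 + 1) q =
  (q ^ (l ^ 2) * (q ^ l.*2.+1 - 1) * even_prod l)%N.
Proof.
rewrite /Bm /even_prod addnK -muln2 mulnK // addn1; congr (_ ^ _ * _ * _)%N.
by rewrite expnMn mulnK.
Qed.

Lemma ApE l : Ap (l.*2 + 2) q =
  (q ^ (5 * l ^ 2 + 9 * l + 4) * qbinom q l.*2.+2 2 * odd_prod l)%N.
Proof.
rewrite /Ap /odd_prod addnK -muln2 mulnK // addn2; congr (_ ^ _ * _ * _)%N.
rewrite (_ : (5 * (l * 2).+2 ^ 2 = (5 * l ^ 2 + 9 * l + 4) * 4 + 2 * (l * 2).+2)%N).
  by rewrite addnK mulnK.
rewrite !expnS !expn0; lia.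
Qed.

Lemma BpE l : Bp (l.*2 + 2) q =
  (q ^ (l ^ 2) * (q ^ l.*2.+2 - 1) * (q ^ l.*2.+1 - 1) * even_prod l)%N.
Proof.
rewrite /Bp /even_prod addnK -muln2 mulnK // addn2 subn1;
  congr (_ ^ _ * _ * _ * _)%N.
by rewrite expnMn mulnK.
Qed.

Lemma bin2_double l : 'C(l.*2.+2, 2) = (2 * l ^ 2 + 3 * l + 1)%N.
Proof.
rewrite bin2 (_ : (l.*2.+2 * l.*2.+2.-1 = (2 * l ^ 2 + 3 * l + 1).*2)%N) ?doubleK
  //.
by rewrite -!mul2n !expnS expn0 /=; lia.
Qed.

Lemma bin2_doubleS l : 'C(l.*2.+3, 2) = (2 * l ^ 2 + 5 * l + 3)%N.
Proof. rewrite binS bin1 bin2_double -mul2n; lia. Qed.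

(** [Am] is the order of the parabolic times the constant of its character sum, divided by the order
    of the stabiliser; the division is cleared to stay in [nat]. Here k = 2l and m = 1. *)
Lemma Am_identity l : 3%N \in [pchar F] -> let n := (l.*2 + 1)%N in
  (card_unitmx F n * q ^ 'C(n.+1, 2) *
     (q ^ 'C(n.+1, 2) * q ^ (1 * l.*2) * inv_sym (-1 : F)%R l.*2)
   = card_unitmx F l.*2 * card_unitmx F 1 * q ^ (2 * (l.*2 * 1)) * q ^ 'C(2, 2)
     * Am n q)%N.
Proof.
move=> ch3 n; rewrite /n AmE inv_skew_even // ![(l.*2 + 1)%N]addn1 !card_unitmxS
  card_unitmx0.
rewrite (_ : (1 * (q ^ 0 * (q ^ 1 - 1)) = q - 1)%N);
  last by rewrite expn0 expn1 !mul1n.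
have := qbinom1 l.*2.+1.
move: (qbinom _ _ _) (q - 1)%N (q ^ l.*2.+1 - 1)%N => X Y Z <-.
set G := card_unitmx _ _; set P := odd_prod l; rewrite bin2_double.
transitivity (q ^ (l.*2 + (2 * l ^ 2 + 3 * l + 1) +
  ((2 * l ^ 2 + 3 * l + 1) + 1 * l.*2 + l * (l - 1))) *
  (G * X * Y * P))%N; first by rewrite !expnD; ring.
transitivity (q ^ (2 * (l.*2 * 1) + 'C(2, 2) + (5 * l ^ 2 + 5 * l + 1)) *
  (G * X * Y * P))%N. 2: by rewrite !expnD; ring.
(* Only the exponents of q remain to be compared; the case split on [l] removes the truncated
   [l - 1]. *)
congr (_ ^ _ * _)%N; rewrite binn -mul2n; case: (l) => [|u] //.
rewrite !expnS expn0 subSS subn0; lia.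
Qed.

(** [Bm] is the order of the coset divided by [Am]: the order of the coset is |G|^2 / |stab|, so the
    quotient is |G| over the constant of the character sum, and the powers of q counting the
    unipotent part cancel. *)
Lemma Bm_identity l : 3%N \in [pchar F] -> let n := (l.*2 + 1)%N in
  (card_unitmx F n = q ^ (1 * l.*2) * inv_sym (-1 : F)%R l.*2 * Bm n q)%N.
Proof.
move=> ch3 n; rewrite /n BmE inv_skew_even // ![(l.*2 + 1)%N]addn1 !card_unitmxS
  card_unitmx_even.
set P := odd_prod l; set P' := even_prod l; set Z := (q ^ l.*2.+1 - 1)%N.
transitivity (q ^ (l * (2 * l - 1) + l.*2) * (P * P' * Z))%N;
  first by rewrite !expnD; ring.
transitivity (q ^ (1 * l.*2 + l * (l - 1) + l ^ 2) * (P * P' * Z))%N;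
  last by rewrite !expnD; ring.
congr (_ ^ _ * _)%N; rewrite -mul2n; case: (l) => [|u] //.
have E : (2 * u.+1 - 1 = 2 * u + 1)%N by lia.
rewrite !expnS expn0 E subSS subn0; lia.
Qed.

(** The analogue of [Am_identity] for m = 2; the extra factor [q] is the one in
    [kloosterman_GL2]. *)
Lemma Ap_identity l : 3%N \in [pchar F] -> let n := (l.*2 + 2)%N in
  (card_unitmx F n * q ^ 'C(n.+1, 2) *
     (q ^ 'C(n.+1, 2) * q ^ (2 * l.*2) * inv_sym (-1 : F)%R l.*2) * q
   = card_unitmx F l.*2 * card_unitmx F 2 * q ^ (2 * (l.*2 * 2)) * q ^ 'C(3, 2)
     * Ap n q)%N.
Proof.
move=> ch3 n; rewrite /n ApE inv_skew_even // ![(l.*2 + 2)%N]addn2 !card_unitmxS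
  card_unitmx0.
rewrite (_ : (1 * (q ^ 0 * (q ^ 1 - 1)) = q - 1)%N);
  last by rewrite expn0 expn1 !mul1n.
have := qbinom2 l.
move: (qbinom _ _ _) (q - 1)%N (q ^ 2 - 1)%N (q ^ l.*2.+1 - 1)%N (q ^ l.*2.+2 - 1)%N
  => X Y Y' Z Z' XE.
set G := card_unitmx _ _; set P := odd_prod l; rewrite bin2_doubleS.
transitivity (q ^ (l.*2 + l.*2.+1 + (2 * l ^ 2 + 5 * l + 3) +
  ((2 * l ^ 2 + 5 * l + 3) + 2 * l.*2 + l * (l - 1)) + 1) *
  (G * (Z' * Z) * P))%N; first by rewrite !expnD expn1; ring.
rewrite -XE.
transitivity (q ^ (1 + 2 * (l.*2 * 2) + 'C(3, 2) + (5 * l ^ 2 + 9 * l + 4)) *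
  (G * (X * (Y' * Y)) * P))%N; last by rewrite !expnD; ring.
congr (_ ^ _ * _)%N; rewrite [in RHS]binS bin1 binn -mul2n; case: (l) => [|u] //.
rewrite !expnS expn0 subSS subn0; lia.
Qed.

Lemma Bp_identity l : 3%N \in [pchar F] -> let n := (l.*2 + 2)%N in
  (card_unitmx F n = q ^ (2 * l.*2) * inv_sym (-1 : F)%R l.*2 * q * Bp n q)%N.
Proof.
move=> ch3 n; rewrite /n BpE inv_skew_even // ![(l.*2 + 2)%N]addn2 !card_unitmxS
  card_unitmx_even.
set P := odd_prod l; set P' := even_prod l; set Z := (q ^ l.*2.+1 - 1)%N;
  set Z' := (q ^ l.*2.+2 - 1)%N.
transitivity (q ^ (l * (2 * l - 1) + l.*2 + l.*2.+1) * (P * P' * Z * Z'))%N;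
  first by rewrite !expnD; ring.
transitivity (q ^ (2 * l.*2 + l * (l - 1) + l ^ 2 + 1) * (P * P' * Z * Z'))%N;
  last by rewrite !expnD expn1; ring.
congr (_ ^ _ * _)%N; rewrite -mul2n; case: (l) => [|u] //.
have E : (2 * u.+1 - 1 = 2 * u + 1)%N by lia.
rewrite !expnS expn0 E subSS subn0; lia.
Qed.

End GroupOrders.

(** * Character sums over the double cosets *)

Section CosetSums.
Variables (C : numFieldType) (F : finFieldType) (psi : F -> C).
Hypothesis hpsi : nontrivial_character psi.
Hypothesis ch3 : 3%N \in [pchar F].
Local Notation q := #|F|.

Definition coset_sign (i : nat) : F := if i == 1%N then 1 else -1.

(** Common bookkeeping for the four families of cosets: [st], [g] and [w] are the orders of the
    stabiliser, the parabolic and the coset, [x] is the constant of the parabolic sum, and [y] is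
    the factor between the sum [GL] over GL(m) and [K]. *)
Lemma coset_sum_solve (st g w x y A B : nat) (S c GL K : F -> C) :
  (0 < st)%N -> (st * w = g * g)%N -> (g * x * y = st * A)%N -> (g = x * y * B)%N ->
  (forall a, a != 0 -> st%:R * S a = g%:R * (c a * x%:R * GL a)) ->
  (forall a, a != 0 -> GL a = y%:R * K a) ->
  w = (A * B)%N /\ (forall a, a != 0 -> S a = c a * A%:R * K a).
Proof.
move=> st0 hw hA hg hs hGL; split=> [|a a0].
  apply/eqP; rewrite -(eqn_pmul2l st0) hw {2}hg !mulnA -hA; apply/eqP; ring.
have st0' : st%:R != 0 :> C by rewrite pnatr_eq0 -lt0n.
apply: (mulfI st0'); rewrite hs // hGL //.
have := congr1 (fun u : nat => u%:R : C) hA; rewrite !natrM => hA'.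
transitivity (c a * (st%:R * A%:R) * K a); last by ring.
by rewrite -hA'; ring.
Qed.

Lemma coset_stab_gt0 mm (G : {set 'M[F]_mm}) s : 1%:M \in G -> s \in unitmx ->
  (0 < #|coset_stab G s|)%N.
Proof.
move=> G1 us; apply/card_gt0P; exists 1%:M.
by rewrite inE G1 mulmx1 mulmxV.
Qed.

Lemma orth_coset_sum k m i : ~~ odd k -> i \in [:: 1; 2]%N ->
  let n := (k + m)%N in
  let W := if i == 1%N then QsigmaQ F n k else rhoQsigmaQ F n k in
  (#|coset_stab (Q F n) (sigma F n k)| * #|W| = #|Q F n| * #|Q F n|)%N /\
  forall a, a != 0 ->
  #|coset_stab (Q F n) (sigma F n k)|%:R * \sum_(w in W) psi (a * \tr w) =
  #|Q F n|%:R * (psi (a * coset_sign i) *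
   (q ^ 'C(n.+1, 2) * q ^ (m * k) * inv_sym (-1 : F)%R k)%:R * kloosterman_GL psi m
     a).
Proof.
move=> ek hi n W.
have rK : cancel (mulmx (rho F n)) (mulmx (rho F n) : 'M_(n + n + 1) -> _).
  by move=> x; rewrite mulmxA rho_mul mul1mx.
have rinj := can_inj rK.
have us := sigma_unit F k m.
have rho1 x : x \in Q F n -> 1%:M *m x *m 1%:M \in Q F n by rewrite mulmx1 mul1mx.
have cardD := card_double_coset C (@Q_1 F n) (@Q_mul F n) (@Q_unit F n) us
  (mulmx1 1%:M) rho1.
have cardW : #|W| = #|QsigmaQ F n k|.
  by rewrite /W; case: ifP => // _; rewrite card_imset.
have sE : block_mx (1%:M : 'M[F]_(n + n)) 0 0 (coset_sign i)%:M =
          (if i == 1%N then 1%:M else rho F n).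
  rewrite /coset_sign; case: ifP => _; first by rewrite -scalar_mx_block.
  by rewrite /rho raddfN.
split=> [|a a0]; first by rewrite cardW.
rewrite -(char_sum_Q m ch3 hpsi) // sE.
have := sum_double_coset (@Q_1 F n) (@Q_mul F n) (@Q_unit F n) us.
rewrite /W; case: ifP => _ sumD.
  rewrite -(sumD C 1%:M (mulmx1 _) rho1 (fun x => psi (a * x))).
  by congr (_ * _); apply: eq_bigr => w _; rewrite mul1mx.
rewrite -(sumD C (rho F n) (@rho_mul F n) (@rho_conj_Q F n) (fun x => psi (a * x))).
by rewrite big_imset //= => x y _ _; exact: rinj.
Qed.

Lemma symp_coset_sum k m :
  let n := (k + m)%N in let W := PsigmaP F n k in
  (#|coset_stab (Phat F n) (sigmahat F n k)| * #|W| = #|Phat F n| * #|Phat F n|)%N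
    /\
  forall a, a != 0 ->
  #|coset_stab (Phat F n) (sigmahat F n k)|%:R * \sum_(w in W) psi (a * \tr w) =
  #|Phat F n|%:R * (1 *
   (q ^ 'C(n.+1, 2) * q ^ (m * k) * inv_sym (-1 : F)%R k)%:R * kloosterman_GL psi m
     a).
Proof.
move=> n W; have us := sigmahat_unit F k m.
have rho1 x : x \in Phat F n -> 1%:M *m x *m 1%:M \in Phat F n by rewrite mulmx1
  mul1mx.
have G1 := @Phat_1 F n; have GM := @Phat_mul F n; have Gu := @Phat_unit F n.
split=> [|a a0]; first exact: (card_double_coset C G1 GM Gu us (mulmx1 1%:M) rho1).
rewrite mul1r -(char_sum_Phat k m ch3 hpsi) //.
have := sum_double_coset G1 GM Gu us (mulmx1 1%:M) rho1 (fun x => psi (a * x)).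
under eq_bigr do rewrite mul1mx.
by under [X in _ = _ * X -> _]eq_bigr do rewrite mul1mx.
Qed.

Lemma kloosterman_GL1E a : a != 0 -> kloosterman_GL psi 1 a = 1%:R * kloosterman_sum
  psi a.
Proof. by move=> _; rewrite mul1r; apply: kloosterman_GL1. Qed.

Lemma odd_split n : odd n -> n = (n./2.*2 + 1)%N.
Proof. by move=> on; rewrite -[LHS]odd_double_half on addnC. Qed.

Lemma even_split n : (2 <= n)%N -> ~~ odd n -> n = ((n - 2)./2.*2 + 2)%N.
Proof. by move=> n2 en; rewrite even_halfK ?subnK // oddB // (negPf en). Qed.

Lemma DCm_sum n i : odd n -> i \in [:: 1; 2]%N ->
  #|DCm F n i| = (Am n q * Bm n q)%N /\
  forall a, a != 0 -> \sum_(w in DCm F n i) psi (a * \tr w) =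
    psi (a * coset_sign i) * (Am n q)%:R * kloosterman_sum psi a.
Proof.
move=> /odd_split -> hi; move: n./2 => l.
have ol : ~~ odd l.*2 by rewrite odd_double.
have [cW sW] := orth_coset_sum 1 ol hi; rewrite /DCm addnK.
apply: (coset_sum_solve (coset_stab_gt0 (@Q_1 F _) (sigma_unit F l.*2 1)) cW _ _ sW
  kloosterman_GL1E).
  by rewrite muln1 card_Q // card_orth_stab // Am_identity.
by rewrite card_Q // Bm_identity //; ring.
Qed.

Lemma DCSpm_sum n : odd n ->
  #|DCSpm F n| = (Am n q * Bm n q)%N /\
  forall a, a != 0 -> \sum_(w in DCSpm F n) psi (a * \tr w) =
    1 * (Am n q)%:R * kloosterman_sum psi a.
Proof.
move=> /odd_split ->; move: n./2 => l.
have [cW sW] := symp_coset_sum l.*2 1; rewrite /DCSpm addnK.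
apply: (coset_sum_solve (c := fun=> 1)
  (coset_stab_gt0 (@Phat_1 F _) (sigmahat_unit F l.*2 1)) cW _ _ sW
    kloosterman_GL1E).
  by rewrite muln1 card_Phat // card_symp_stab // Am_identity.
by rewrite card_Phat // Bm_identity //; ring.
Qed.

Lemma DCp_sum n i : (2 <= n)%N -> ~~ odd n -> i \in [:: 1; 2]%N ->
  #|DCp F n i| = (Ap n q * Bp n q)%N /\
  forall a, a != 0 -> \sum_(w in DCp F n i) psi (a * \tr w) =
    psi (a * coset_sign i) * (Ap n q)%:R *
      (kloosterman_sum psi a ^+ 2 + q%:R ^+ 2 - q%:R).
Proof.
move=> n2 /(even_split n2) -> hi; move: (n - 2)./2 => l.
have ol : ~~ odd l.*2 by rewrite odd_double.
have [cW sW] := orth_coset_sum 2 ol hi; rewrite /DCp addnK.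
apply: (coset_sum_solve (coset_stab_gt0 (@Q_1 F _) (sigma_unit F l.*2 2)) cW _ _ sW
  (kloosterman_GL2 hpsi)).
  by rewrite card_Q // card_orth_stab // Ap_identity.
by rewrite card_Q // Bp_identity //; ring.
Qed.

Lemma DCSpp_sum n : (2 <= n)%N -> ~~ odd n ->
  #|DCSpp F n| = (Ap n q * Bp n q)%N /\
  forall a, a != 0 -> \sum_(w in DCSpp F n) psi (a * \tr w) =
    1 * (Ap n q)%:R * (kloosterman_sum psi a ^+ 2 + q%:R ^+ 2 - q%:R).
Proof.
move=> n2 /(even_split n2) ->; move: (n - 2)./2 => l.
have [cW sW] := symp_coset_sum l.*2 2; rewrite /DCSpp addnK.
apply: (coset_sum_solve (c := fun=> 1)
  (coset_stab_gt0 (@Phat_1 F _) (sigmahat_unit F l.*2 2)) cW _ _ sW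
    (kloosterman_GL2 hpsi)).
  by rewrite card_Phat // card_symp_stab // Ap_identity.
by rewrite card_Phat // Bp_identity //; ring.
Qed.

End CosetSums.

(** * Power moments of a ternary code *)

Section Stirling.
Variable C : numFieldType.

(** The t-th finite difference of x^h at 0, equal to t! S(h,t); it avoids the division by t! in
    [stirling2]. *)
Definition diff_power (h t : nat) : C :=
  \sum_(j < t.+1) (-1) ^+ (t - j) * 'C(t, j)%:R * (j%:R : C) ^+ h.

Lemma fact_stirling2 h t : t`!%:R * stirling2 C h t = diff_power h t.
Proof. by rewrite mulrA mulfV ?mul1r // pnatr_eq0 -lt0n fact_gt0. Qed.

Lemma diff_power0 h : diff_power h.+1 0 = 0.
Proof. by rewrite /diff_power big_ord1 expr0n mulr0. Qed.

(** The recurrence S(h+1,t+1) = (t+1) S(h,t+1) + S(h,t), multiplied by (t+1)!. *)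
Lemma diff_powerS h t :
  diff_power h.+1 t.+1 = t.+1%:R * (diff_power h t.+1 + diff_power h t).
Proof.
have eqj (j : nat) : 'C(t.+1, j)%:R * (j%:R : C) ^+ h.+1 =
    t.+1%:R * (('C(t.+1, j)%:R - 'C(t, j)%:R) * j%:R ^+ h).
  case: j => [|j]; first by rewrite !bin0 subrr expr0n mulr0 mul0r mulr0.
  have hd := congr1 (fun x : nat => x%:R : C) (mul_bin_diag t.+1 j).
  rewrite /= !natrM in hd.
  rewrite [in RHS]binS natrD [_ + 'C(t, j)%:R]addrC addrK exprS mulrA.
  rewrite [RHS]mulrA hd [_ * j.+1%:R]mulrC. by rewrite -natrD addnC -binS.
rewrite {1}/diff_power; under eq_bigr => j _ do rewrite -mulrA eqj mulrCA mulrBl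
  mulrBr.
rewrite -mulr_sumr sumrB; congr (_ * (_ + _)).
  by apply: eq_bigr => j _; rewrite mulrA.
rewrite big_ord_recr /= subnn bin_small // mul0r mulr0 addr0 -sumrN.
apply: eq_bigr => j _; rewrite subSn; last by rewrite -ltnS.
by rewrite exprS mulN1r mulrA !mulNr opprK.
Qed.

Lemma diff_power_big h t : (h < t)%N -> diff_power h t = 0.
Proof.
elim: h t => [|h IH] [|t] //; last by move=> ht;
  rewrite diff_powerS !IH ?addr0 ?mulr0 // ltnW.
move=> _; rewrite /diff_power.
transitivity ((-1 + 1 : C) ^+ t.+1); last by rewrite addNr expr0n.
rewrite exprDn; apply: eq_bigr => j _.
by rewrite expr0 expr1n !mulr1 mulr_natr.
Qed.

(** Newton expansion of the h-th power. It passes from power moments to binomial moments, which are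
    the coefficients of the polynomial in [macwilliams]. *)
Lemma power_bin (w h : nat) :
  (w%:R : C) ^+ h = \sum_(t < h.+1) diff_power h t * 'C(w, t)%:R.
Proof.
elim: h => [|h IH]; first by rewrite big_ord1 /diff_power big_ord1 !bin0 !expr0
  !mulr1.
rewrite exprSr IH mulr_suml [RHS]big_ord_recl diff_power0 mul0r add0r.
have wC t : 'C(w, t)%:R * w%:R = t.+1%:R * 'C(w, t.+1)%:R + t%:R * 'C(w, t)%:R :> C.
  rewrite -!natrM -natrD; congr (_%:R).
  have := mul_bin_left w t; case: (leqP t w) => tw; last first.
    by rewrite !bin_small ?mul0n ?muln0 // ltnS ltnW.
  by move=> ->; rewrite -mulnDl subnK // mulnC.
under eq_bigr => t _ do rewrite -mulrA wC mulrDr.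
rewrite big_split /= addrC big_ord_recl mul0r mulr0 add0r.
under [RHS]eq_bigr => t _ do rewrite /bump leq0n add1n diff_powerS mulrDr mulrDl.
rewrite big_split /=; congr (_ + _).
  rewrite [RHS]big_ord_recr /= (@diff_power_big h h.+1) // mulr0 mul0r addr0.
  by apply: eq_bigr => t _; rewrite /bump leq0n add1n; ring.
by apply: eq_bigr => t _; ring.
Qed.

End Stirling.

(** * The MacWilliams identity and the Pless power moments *)

Section PowerMoments.
Variables (C : numFieldType) (F : finFieldType) (psi : F -> C).
Hypothesis hpsi : nontrivial_character psi.
Hypothesis ch3 : 3%N \in [pchar F].
Variable Z : pred F.
Hypothesis psi3 : forall y, 1 + psi y + psi (- y) = 3 * (Z y)%:R.
Variables (N : nat) (v : 'I_N -> F).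
Local Notation q := #|F|.

(** For [v] the vector of traces this is C(D), seen as the dual of the code formed by the words
    indexed by [a]. *)
Definition ternary_dual : {set 'rV['F_3]_N} :=
  [set u : 'rV['F_3]_N | \sum_i ((u 0 i : nat)%:R : F) * v i == 0].

(** The Hamming weight of the word with entries tr(a v_i), as [Z] stands for the vanishing of tr. *)
Definition trace_weight (a : F) : nat := #|[set i | ~~ Z (a * v i)]|.

Lemma prod_char (I : finType) (P : pred I) (f : I -> F) :
  \prod_(i | P i) psi (f i) = psi (\sum_(i | P i) f i).
Proof.
case: hpsi => psi0 psiD _; symmetry.
by elim/big_rec2: _ => // i x y _ <-; rewrite psiD.
Qed.

Lemma prod_weight (u : 'rV['F_3]_N) (x y : {poly C}) :
  \prod_i (if u 0 i == 0 then x else y) =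
  x ^+ (N - hamming_weight u) * y ^+ hamming_weight u.
Proof.
rewrite (bigID (fun i => u 0 i == 0)) /=.
rewrite (eq_bigr (fun=> x)) => [|i /eqP->]; last by rewrite eqxx.
rewrite [X in _ * X](eq_bigr (fun=> y)) => [|i /negPf->] //.
rewrite !prodr_const; congr (_ ^+ _ * _ ^+ _); last first.
  by apply: eq_card => i; rewrite inE.
rewrite -[X in (X - _)%N]card_ord -(cardC [set i | u 0 i != 0]) addKn.
by apply: eq_card => i; rewrite !inE negbK.
Qed.

(* The indicator of tr (a v_i) <> 0 is expanded in characters of F_3 coordinatewise. *)
Lemma macwilliams :
  \sum_a (1 + 'X : {poly C}) ^+ trace_weight a =
  q%:R * \sum_(u in ternary_dual)
    (1 + (2 / 3) *: 'X) ^+ (N - hamming_weight u) * (- (1 / 3) *: 'X) ^+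
      hamming_weight u.
Proof.
case: (hpsi) => psi0 psiD _.
(* Fourier coefficients on F_3 of the function equal to 1 at 0 and to 1 + X elsewhere: its mean is 1
   + (2/3) X, and each nontrivial character has coefficient - X / 3. *)
pose c (x : 'F_3) : {poly C} := if x == 0 then 1 + (2 / 3) *: 'X else - (1 / 3) *:
  'X.
have pointE y : (if Z y then 1 else 1 + 'X) =
    \sum_(x : 'F_3) c x * (psi ((x : nat)%:R * y))%:P.
  rewrite !big_ord_recl big_ord0 /c /= !mul0r psi0 mul1r.
  have -> : 2%:R * y = - y.
    apply/eqP; rewrite -addr_eq0 -[X in _ + X]mul1r -mulrDl -(natrD _ 2 1).
    by rewrite (pcharf0 ch3) mul0r.
  rewrite (_ : (bump 0 0)%:R * y = y) ?mul1r // polyC1 mulr1 addr0 -!mul_polyC.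
  set t : {poly C} := (3^-1)%:P.
  have t3 : 3%:R * t = 1 by rewrite -polyC_natr -polyCM mulfV ?pnatr_eq0.
  have -> : (2 / 3)%:P = 2%:R * t by rewrite polyCM polyC_natr.
  rewrite polyCN -/t; have := psi3 y; case: (Z y) => h.
    have -> : psi y = 2 - psi (- y) by apply/eqP; rewrite -subr_eq0; apply/eqP;
      transitivity (1 + psi y + psi (- y) - 3); [ring | rewrite h mulr1 subrr].
    rewrite polyCB polyC_natr; ring.
  have -> : psi y = -1 - psi (- y).
    by apply/eqP; rewrite -subr_eq0; apply/eqP;
      transitivity (1 + psi y + psi (- y)); [ring | rewrite h mulr0].
  transitivity (1 + 3%:R * t * 'X); first by rewrite t3 mul1r.
  rewrite polyCB polyCN polyC1; ring.
have weightE a : (1 + 'X : {poly C}) ^+ trace_weight a =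
    \prod_i (if Z (a * v i) then 1 else 1 + 'X).
  rewrite [RHS](eq_bigr (fun i => if ~~ Z (a * v i) then 1 + 'X else 1));
    last first.
    by move=> i _; case: (Z _).
  by rewrite -big_mkcond prodr_const; congr (_ ^+ _); apply: eq_card => i;
    rewrite inE.
under eq_bigr => a _.
  rewrite weightE; under eq_bigr => i _ do rewrite pointE.
  rewrite bigA_distr_bigA /=.
  over.
(* Expanding the product selects one character of F_3 per coordinate, that is, a word [u]; the sum
   over [a] then tests whether [u] is orthogonal to [v]. *)
rewrite exchange_big /= mulr_sumr.
rewrite (reindex (fun u : 'rV['F_3]_N => [ffun i => u 0 i])) /=; last first.
  exists (fun f : {ffun 'I_N -> 'F_3} => \row_i f i) => [u _|f _].
    by apply/rowP => i; rewrite mxE ffunE.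
  by apply/ffunP => i; rewrite ffunE mxE.
rewrite [RHS]big_mkcond /=; apply: eq_bigr => u _.
under eq_bigr => a _ do rewrite big_split /=.
rewrite -mulr_sumr.
under [X in X * _]eq_bigr => i _ do rewrite ffunE /c.
rewrite prod_weight.
have -> : \sum_a \prod_i (psi (([ffun i1 => u 0 i1] i : nat)%:R * (a * v i)))%:P =
   (u \in ternary_dual)%:R * q%:R :> {poly C}.
  rewrite inE; set S := \sum_i (_ * v i).
  have <- : ((S == 0)%:R * q%:R : C)%:P = (S == 0)%:R * q%:R by rewrite polyCM
    !polyC_natr.
  rewrite -(sum_char_scale hpsi) raddf_sum /=; apply: eq_bigr => a _.
  rewrite -rmorph_prod /= prod_char; congr (psi _)%:P.
  by rewrite mulrC mulr_sumr; apply: eq_bigr => i _; rewrite ffunE; ring.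
case: (u \in _); last by rewrite mul0r mulr0.
by rewrite mulrC mulr1n mul1r.
Qed.

Lemma coef_1addX_exp w t : ((1 + 'X : {poly C}) ^+ w)`_t = 'C(w, t)%:R.
Proof.
rewrite exprDn coef_sum; under eq_bigr => i _ do rewrite expr1n mul1r coefMn coefXn.
case: (leqP t w) => ht.
  rewrite (bigD1 (Ordinal (ht : (t < w.+1)%N))) //= eqxx big1 ?addr0 //.
  by move=> i; rewrite -val_eqE /= eq_sym => /negPf ->; rewrite mul0rn.
rewrite bin_small // big1 // => i _; rewrite gtn_eqF ?mul0rn //.
by apply: leq_ltn_trans ht; rewrite -ltnS.
Qed.

Lemma coef_macwilliams (j t : nat) :
  ((1 + (2 / 3) *: 'X : {poly C}) ^+ (N - j) * (- (1 / 3) *: 'X) ^+ j)`_t =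
  if (j <= t)%N then (- (1 / 3)) ^+ j * ((2 / 3) ^+ (t - j) * 'C(N - j, t - j)%:R)
    else 0.
Proof.
rewrite exprZn -scalerAr coefZ coefMXn ltnNge.
case: leqP => //= jt; last by rewrite mulr0.
congr (_ * _); rewrite exprDn coef_sum.
under eq_bigr => i _ do rewrite expr1n mul1r coefMn exprZn coefZ coefXn.
case: (leqP (t - j) (N - j)) => hi.
  rewrite (bigD1 (Ordinal (hi : (t - j < (N - j).+1)%N))) //= eqxx mulr1 big1
    ?addr0.
    by rewrite mulr_natr.
  move=> i; rewrite -val_eqE /= eq_sym => /negPf ->.
  by rewrite mulr0 mul0rn.
rewrite bin_small // mulr0 big1 // => i _.
rewrite gtn_eqF ?mulr0 ?mul0rn //.
by apply: leq_ltn_trans hi; rewrite -ltnS.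
Qed.

Lemma hamming_weight_le (u : 'rV['F_3]_N) : (hamming_weight u <= N)%N.
Proof. by rewrite -[X in (_ <= X)%N]card_ord; apply: max_card. Qed.

(** Comparison of the coefficients of X^t on the two sides of [macwilliams]. *)
Lemma sum_bin_weight t :
  \sum_a ('C(trace_weight a, t)%:R : C) = q%:R *
    \sum_(u in ternary_dual | (hamming_weight u <= t)%N)
    (-1) ^+ hamming_weight u * 3 ^- t * 2 ^+ (t - hamming_weight u) *
    (binom_compl N (hamming_weight u) t)%:R.
Proof.
have := congr1 (fun p : {poly C} => p`_t) macwilliams.
have coefN (p : {poly C}) : (q%:R * p)`_t = q%:R * p`_t.
  by rewrite mulr_natl coefMn mulr_natl.
rewrite coefN !coef_sum => hE.
transitivity (\sum_a ((1 + 'X : {poly C}) ^+ trace_weight a)`_t).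
  by apply: eq_bigr => a _; rewrite coef_1addX_exp.
rewrite hE; congr (_ * _); rewrite [RHS]big_mkcondr /=; apply: eq_bigr => u _.
rewrite coef_macwilliams; case: leqP => // ut.
set j := hamming_weight u in ut *; have jN := hamming_weight_le u.
(* Symmetry of the binomial coefficient for t <= N; for t > N both sides are 0, thanks to the guard
   in [binom_compl]. *)
have -> : binom_compl N j t = 'C(N - j, t - j).
  rewrite /binom_compl; case: leqP => tN.
    by rewrite -[in RHS]bin_sub ?leq_sub2r // subnBA // subnK.
  by rewrite bin_small // ltn_sub2r // (leq_ltn_trans jN).
rewrite mulrA; congr (_ * _).
rewrite div1r [(- 3^-1) ^+ j]exprNn exprMn -!exprVn -[in (3^-1) ^+ t](subnKC ut)
  exprD. ring.
Qed.

(** The binomial moments are combined by [power_bin] and the words are grouped by weight. *)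
Lemma pless h :
  \sum_a (trace_weight a)%:R ^+ h = q%:R *
  \sum_(0 <= j < (minn N h).+1) (-1) ^+ j *
    #|[set u in ternary_dual | hamming_weight u == j]|%:R *
    (\sum_(j <= t < h.+1) t`!%:R * stirling2 C h t * 3 ^- t * 2 ^+ (t - j) *
       (binom_compl N j t)%:R).
Proof.
under eq_bigr => a _ do rewrite power_bin.
rewrite exchange_big /=.
under eq_bigr => t _ do rewrite -mulr_sumr sum_bin_weight mulrCA.
rewrite -mulr_sumr; congr (_ * _).
pose G j : C := (-1) ^+ j * \sum_(j <= t < h.+1) t`!%:R * stirling2 C h t * 3 ^- t *
  2 ^+ (t - j) *
       (binom_compl N j t)%:R.
transitivity (\sum_(u in ternary_dual) G (hamming_weight u)).
  under eq_bigr => t _ do rewrite big_mkcondr mulr_sumr.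
  rewrite exchange_big /=; apply: eq_bigr => u _; rewrite /G.
  rewrite [X in _ = _ * X]big_geq_mkord [X in _ = _ * X]big_mkcond [RHS]mulr_sumr;
    apply: eq_bigr => t _ /=.
  by case: ifP => _; rewrite ?mulr0 // fact_stirling2; ring.
rewrite (eq_bigr (fun j => \sum_(u in ternary_dual) if hamming_weight u == j then G
  j else 0)).
  rewrite exchange_big /=; apply: eq_bigr => u _; rewrite big_mkord.
  set j := hamming_weight u; case: (ltnP j (minn N h).+1) => hj.
    rewrite (bigD1 (Ordinal hj)) //= eqxx big1 ?addr0 // => i.
    by rewrite -val_eqE /= eq_sym => /negPf ->.
  (* No weight exceeds N, so a weight outside the range of summation exceeds h, and its inner sum
     over t is empty. *)
  rewrite big1 => [|i _]; last by rewrite gtn_eqF // (leq_trans _ hj) // ltn_ord.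
  rewrite /G big_geq ?mulr0 //; move: hj; rewrite gtn_min => /orP[|//].
  by rewrite ltnNge hamming_weight_le.
move=> j _; rewrite -big_mkcondr /= mulrAC -/(G j) -sumr_const mulr_sumr.
apply: eq_big => u; first by rewrite inE.
by rewrite mulr1.
Qed.

End PowerMoments.

(** * Weight distributions *)

Section TernaryWords.
Variable I : finType.
Implicit Types (u : {ffun I -> 'F_3}) (D : {set I}).

Lemma F3_cases (x : 'F_3) : [|| x == 0, x == 1 | x == 2].
Proof. by case: x => -[|[|[|]]]. Qed.

Lemma trinomE c a b : trinom c a b = ('C(c, a) * 'C(c - a, b))%N.
Proof.
rewrite /trinom; case: leqP => h; last first.
  case: (leqP a c) => ac; last by rewrite bin_small.
  by rewrite [X in (_ * X)%N]bin_small ?muln0 // ltn_subLR.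
have ac : (a <= c)%N by rewrite (leq_trans (leq_addr _ _) h).
have bc : (b <= c - a)%N by rewrite leq_subRL.
rewrite -{1}(bin_fact ac) -{1}(bin_fact bc).
rewrite (_ : (_ * _ = 'C(c, a) * 'C(c - a, b) * (a`! * b`! * (c - a - b)`!))%N);
  last by ring.
by rewrite mulnK // !muln_gt0 !fact_gt0.
Qed.

Lemma card_ternary_words D a b :
  #|[set u : {ffun I -> 'F_3} | [&& [forall i, (u i != 0) ==> (i \in D)],
      #|[set i | u i == 1]| == a & #|[set i | u i == 2]| == b]]| = trinom #|D| a b.
Proof.
pose f (u : {ffun I -> 'F_3}) := ([set i | u i == 1], [set i | u i == 2]).
pose g (p : {set I} * {set I}) : {ffun I -> 'F_3} :=
  [ffun i => if i \in p.1 then 1 else if i \in p.2 then 2 else 0].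
have fK : cancel f g.
  move=> u; apply/ffunP => i; rewrite ffunE !inE.
  by have := F3_cases (u i); case: eqP => [->|] //; case: eqP => [->|] //;
    case: eqP => [->|].
rewrite -(card_imset _ (can_inj fK)) trinomE.
transitivity #|[set p : {set I} * {set I} | [&& p.1 \subset D, #|p.1| == a,
    p.2 \subset D :\: p.1 & #|p.2| == b]]|.
  apply: eq_card => -[X Y]; rewrite inE /=; apply/imsetP/and4P.
    case=> u; rewrite inE => /and3P[/forallP hD h1 h2] [-> ->]; split=> //.
      apply/subsetP => i; rewrite inE => /eqP ui; have := hD i; by rewrite ui.
    apply/subsetP => i; rewrite !inE => /eqP ui; have := hD i; by rewrite ui.
  case=> XD hX YD hY; have fg : f (g (X, Y)) = (X, Y).
    congr (_, _); apply/setP => i; rewrite !inE ffunE /=; case: ifP => iX //.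
    - by case: ifP.
    - have := subsetP YD i; rewrite !inE iX /=; case: (i \in Y) => // /(_ isT);
      done.
    - by case: ifP.
  exists (g (X, Y)) => //; rewrite inE.
  case: fg => -> ->; rewrite hX hY !andbT; apply/forallP => i; rewrite ffunE /=.
  case: ifP => iX; first by rewrite (subsetP XD).
  by case: ifP => // iY; have := subsetP YD i iY; rewrite !inE => /andP[_ ->].
rewrite -sum1_card (eq_bigl (fun p : {set I} * {set I} =>
  ((p.1 \subset D) && (#|p.1| == a)) &&
    ((p.2 \subset D :\: p.1) && (#|p.2| == b)))); last first.
  by move=> p; rewrite inE !andbA.
rewrite -(pair_big_dep (fun X : {set I} => (X \subset D) && (#|X| == a))
   (fun X Y : {set I} => (Y \subset D :\: X) && (#|Y| == b)) (fun _ _ => 1%N)) /=.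
rewrite (eq_bigr (fun=> 'C(#|D| - a, b))) => [|X /andP[XD /eqP hX]].
  by rewrite sum_nat_const -cards_draws; congr (_ * _)%N; apply: eq_card => X;
    rewrite !inE.
rewrite -hX -cardsDS // -cards_draws -sum1_card.
by apply: eq_bigl => Y; rewrite inE.
Qed.

(** A word is the family of its restrictions to the fibres of [v], extended by 0. The conditions
    bear on each restriction separately, so the counts multiply. *)
Lemma card_ternary_words_fibres (J : finType) (v : I -> J) (nu mu : J -> nat) :
  #|[set u : {ffun I -> 'F_3} |
    [forall b, (#|[set i | (v i == b) && (u i == 1)]| == nu b)
       && (#|[set i | (v i == b) && (u i == 2)]| == mu b)]]|
  = (\prod_b trinom #|[set i | v i == b]| (nu b) (mu b))%N.
Proof.
pose S b := [set u : {ffun I -> 'F_3} |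
  [&& [forall i, (u i != 0) ==> (i \in [set i | v i == b])],
      #|[set i | u i == 1]| == nu b & #|[set i | u i == 2]| == mu b]].
rewrite (eq_bigr (fun b => \sum_(w in S b) 1)%N) => [|b _]; last first.
  by rewrite sum1_card card_ternary_words.
rewrite bigA_distr_big_dep /= (eq_bigr (fun=> 1%N)) => [|f _]; last by rewrite big1.
pose h (u : {ffun I -> 'F_3}) : {ffun J -> {ffun I -> 'F_3}} :=
  [ffun b => [ffun i => if v i == b then u i else 0]].
pose k (f : {ffun J -> {ffun I -> 'F_3}}) : {ffun I -> 'F_3} :=
  [ffun i => f (v i) i].
rewrite (reindex_onto h k) /=; last first.
  move=> f /familyP hf; apply/ffunP => b; apply/ffunP => i; rewrite !ffunE.
  case: eqP => [->//|/eqP vb]; have := hf b;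
    rewrite unfold_in /= inE => /and3P[/forallP/(_ i) + _ _].
  by rewrite inE (negPf vb) implybF negbK => /eqP.
rewrite -sum1_card; apply: eq_bigl => u; rewrite inE.
have kh : k (h u) = u by apply/ffunP => i; rewrite !ffunE eqxx.
rewrite kh eqxx andbT; apply/forallP/familyP => H b; have := H b; rewrite inE.
  case/andP=> h1 h2; apply/and3P; split.
  - by apply/forallP => i; rewrite !ffunE inE; case: ifP; rewrite ?implybT ?eqxx.
  - rewrite -(eqP h1); apply/eqP/eq_card => i; rewrite !inE !ffunE.
    by case: ifP.
  - rewrite -(eqP h2); apply/eqP/eq_card => i; rewrite !inE !ffunE.
    by case: ifP.
case/and3P=> _ h1 h2; apply/andP; split.
- rewrite -(eqP h1); apply/eqP/eq_card => i; rewrite !inE !ffunE.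
  by case: ifP.
- rewrite -(eqP h2); apply/eqP/eq_card => i; rewrite !inE !ffunE.
  by case: ifP.
Qed.

End TernaryWords.

(** * Codewords counted by their entries on each trace class *)

Section WeightDistribution.
Variable F : finFieldType.
Hypothesis ch3 : 3%N \in [pchar F].

(** [nu b] and [mu b] count the coordinates with v_i = b at which the word is 1 and 2 respectively.
    As 2 = -1 in [F], orthogonality to [v] becomes equality of the two weighted sums. *)
Lemma card_ternary_dual N (v : 'I_N -> F) j :
  #|[set u in ternary_dual v | hamming_weight u == j]| =
  family_sum j (fun nu mu => \prod_b trinom #|[set i | v i == b]| (nu b) (mu b))%N.
Proof.
pose cnt (u : {ffun 'I_N -> 'F_3}) (x : 'F_3) b :=
  #|[set i | (v i == b) && (u i == x)]|.
pose toF (u : 'rV['F_3]_N) := [ffun i => u 0 i].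
have cntE (V : nmodType) (G : F -> V) (u : {ffun 'I_N -> 'F_3}) (x : 'F_3) : \sum_b
  G b *+ cnt u x b = \sum_(i | u i == x) G (v i).
  rewrite (partition_big v xpredT) //=; apply: eq_bigr => b _.
  rewrite -sumr_const; apply: eq_big => [i|i]; rewrite inE; first exact: andbC.
  by case/andP=> /eqP ->.
have cnt1 (u : {ffun 'I_N -> 'F_3}) (x : 'F_3) :
  (\sum_b cnt u x b = #|[set i | u i == x]|)%N.
  rewrite -sum1_card (partition_big v xpredT) //=; apply: eq_bigr => b _.
  by rewrite /cnt -sum1_card; apply: eq_bigl => i; rewrite !inE andbC.
have wtE (u : 'rV['F_3]_N) : (\sum_b cnt (toF u) 1%R b + \sum_b cnt (toF u) 2%R b)%N
  = hamming_weight u.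
  rewrite !cnt1 -cardsUI [X in (_ + X)%N]eq_card0 ?addn0.
    apply: eq_card => i; rewrite !inE !ffunE.
    by have := F3_cases (u 0 i); case: eqP => [->|] //= _; case: eqP => [->|].
  by move=> i; rewrite !inE; case: eqP => [->|].
have dualE (u : 'rV['F_3]_N) : (u \in ternary_dual v) =
   (\sum_b b *+ cnt (toF u) 1 b == \sum_b b *+ cnt (toF u) 2 b).
  rewrite !(cntE _ id) inE -[RHS]subr_eq0 [in RHS]big_mkcond /=
    [X in _ = (_ - X == 0)]big_mkcond /=.
  rewrite -sumrB; congr (_ == 0); apply: eq_bigr => i _; rewrite !ffunE.
  have := F3_cases (u 0 i); case/or3P => /eqP -> /=.
  - by rewrite mul0r subr0.
  - by rewrite mul1r subr0.
  rewrite sub0r; apply/eqP; rewrite -addr_eq0 -[X in _ + X]mul1r -mulrDl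
    -(natrD _ 2 1).
  by rewrite (pcharf0 ch3) mul0r.
pose fits (u : 'rV['F_3]_N) (p : {ffun F -> 'I_j.+1} * {ffun F -> 'I_j.+1}) :=
  [forall b, (cnt (toF u) 1%R b == p.1 b) && (cnt (toF u) 2%R b == p.2 b)].
pose ok (p : {ffun F -> 'I_j.+1} * {ffun F -> 'I_j.+1}) :=
  (\sum_b (p.1 b : nat) + \sum_b (p.2 b : nat) == j)%N &&
         ((\sum_b b *+ p.1 b)%R == (\sum_b b *+ p.2 b)%R).
transitivity (\sum_(p | ok p) \sum_(u | fits u p) 1)%N; last first.
  rewrite /family_sum [RHS]pair_big_dep /=; apply: eq_bigr => p _.
  rewrite -card_ternary_words_fibres -sum1_card.
  rewrite [RHS](reindex toF) /=; first by apply: eq_bigl => u; rewrite inE.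
  exists (fun f : {ffun 'I_N -> 'F_3} => \row_i f i) => [u _|f _].
    by apply/rowP => i; rewrite mxE ffunE.
  by apply/ffunP => i; rewrite ffunE mxE.
rewrite (exchange_big_dep xpredT) //= -sum1_card [LHS]big_mkcond /=.
apply: eq_bigr => u _; rewrite inE.
have okE p : fits u p -> ok p = (u \in ternary_dual v) && (hamming_weight u == j).
  move=> /forallP hp; rewrite dualE -wtE andbC /ok.
  have e1 b : p.1 b = cnt (toF u) 1%R b :> nat by have /andP[/eqP-> _] := hp b.
  have e2 b : p.2 b = cnt (toF u) 2%R b :> nat by have /andP[_ /eqP->] := hp b.
  congr (_ && _); [congr ((_ + _)%N == _) | congr (_ == _)];
    by apply: eq_bigr => b _; rewrite ?e1 ?e2.
case: ifP => [hu|hu]; last first.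
  rewrite big1 // => p /andP[okp fp]; by move: okp; rewrite okE // hu.
have [_ /eqP wj] := andP hu.
(* Every count is at most the weight [j], so the family [p0] with values in ['I_j.+1] represents it
   exactly despite the default value of [inord]. *)
have le_cnt x b : x \in [:: 1%R; 2%R : 'F_3] -> (cnt (toF u) x b < j.+1)%N.
  move=> hx; rewrite ltnS -wj -wtE; move: hx; rewrite !inE => /orP[] /eqP ->.
    by rewrite (leq_trans _ (leq_addr _ _)) // (bigD1 b) //= leq_addr.
  by rewrite (leq_trans _ (leq_addl _ _)) // (bigD1 b) //= leq_addr.
pose p0 : {ffun F -> 'I_j.+1} * {ffun F -> 'I_j.+1} :=
  ([ffun b => inord (cnt (toF u) 1%R b)], [ffun b => inord (cnt (toF u) 2%R b)]).
have fits0 : fits u p0.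
  by apply/forallP => b; rewrite !ffunE !inordK ?eqxx //; apply: le_cnt;
    rewrite !inE eqxx.
rewrite (big_pred1 p0) // => p; apply/andP/eqP => [[_ /forallP hp]|->]; last first.
  by rewrite okE // hu.
rewrite /p0; case: p hp => p1 p2 /= hp; congr (_, _); apply/ffunP => b;
  apply: val_inj;
  rewrite ffunE /= inordK; have /andP[/eqP e1 /eqP e2] := hp b;
    rewrite ?e1 ?e2 ?ltn_ord //.
Qed.

Lemma eq_family_sum j (T T' : (F -> nat) -> (F -> nat) -> nat) :
  (forall nu mu, T nu mu = T' nu mu) -> family_sum j T = family_sum j T'.
Proof.
by move=> TT; apply: eq_bigr => nu _; apply: eq_bigr => mu _; rewrite TT.
Qed.

Lemma weight_dist_family m (D : {set 'M[F]_m}) j :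
  weight_dist D j = family_sum j (fun nu mu =>
    \prod_b trinom #|[set g in D | \tr g == b]| (nu b) (mu b))%N.
Proof.
rewrite -[LHS]/(#|[set u in ternary_dual (trace_vec D 0) | hamming_weight u == j]|).
rewrite card_ternary_dual; apply: eq_family_sum => nu mu; apply: eq_bigr => b _.
congr trinom; rewrite -(card_imset _ enum_val_inj); apply: eq_card => g.
apply/imsetP/idP => [[i + ->]|]; first by rewrite !inE mxE enum_valP.
rewrite inE => /andP[gD gb]; exists (enum_rank_in gD g);
  last by rewrite enum_rankK_in.
by rewrite inE mxE enum_rankK_in.
Qed.
End WeightDistribution.

(** * The recursion *)

Section Recursion.
Variables (C : numFieldType) (F : finFieldType) (psi : F -> C).
Hypothesis hpsi : nontrivial_character psi.
Hypothesis ch3 : 3%N \in [pchar F].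
Variable Z : pred F.
Hypothesis psi3 : forall y, 1 + psi y + psi (- y) = 3 * (Z y)%:R.
Local Notation q := #|F|.

Definition trace_sum m (D : {set 'M[F]_m}) (a : F) : C := \sum_(g in D) psi
  (a * \tr g).

(** By [psi3] the indicator of a nonzero entry at y is (2 - psi y - psi (- y)) / 3; this is summed
    over D. *)
Lemma trace_weightE m (D : {set 'M[F]_m}) a :
  (trace_weight Z (trace_vec D 0) a)%:R =
  (2 * #|D|%:R - trace_sum D a - trace_sum D (- a)) / 3 :> C.
Proof.
have three : (3 : C) != 0 by rewrite pnatr_eq0.
apply: (mulIf three); rewrite mulfVK //.
have sE b : trace_sum D b = \sum_(i < #|D|) psi (b * trace_vec D 0 i).
  by rewrite /trace_sum big_enum_val; apply: eq_bigr => i _; rewrite mxE.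
have -> : 2 * #|D|%:R = \sum_(i < #|D|) (2 : C).
  by rewrite sumr_const card_ord mulr_natr.
rewrite !sE -!sumrB /trace_weight -sum1_card natr_sum.
rewrite (eq_bigl (fun i => ~~ Z (a * trace_vec D 0 i))); last by move=> i;
  rewrite inE.
rewrite big_mkcond mulr_suml; apply: eq_bigr => i _; rewrite mulNr.
have := psi3 (a * trace_vec D 0 i); move: (psi _) (psi _) => y x.
case: (Z _) => /= /(congr1 (fun w => 3 - w)) h.
  by rewrite mul0r; apply/esym; transitivity (3 - (1 + x + y));
    [ring | rewrite h mulr1 subrr].
by rewrite mul1r; apply/esym; transitivity (3 - (1 + x + y));
  [ring | rewrite h mulr0 subr0].
Qed.

Lemma trivial_on0 : Z 0.
Proof.
have [psi0 _ _] := hpsi; have := psi3 0; rewrite oppr0 psi0; case: (Z 0) => //.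
rewrite mulr0 -(natrD _ 1 1) -(natrD _ 2 1) => /eqP; by rewrite pnatr_eq0.
Qed.

Lemma trace_sum0 m (D : {set 'M[F]_m}) : trace_sum D 0 = #|D|%:R.
Proof.
have [psi0 _ _] := hpsi.
by rewrite /trace_sum (eq_bigr (fun=> 1)) ?sumr_const // => g _; rewrite mul0r.
Qed.

Lemma pless_trace m (D : {set 'M[F]_m}) h :
  \sum_a (trace_weight Z (trace_vec D 0) a)%:R ^+ h = q%:R *
  \sum_(0 <= j < (minn #|D| h).+1) (-1) ^+ j * (weight_dist D j)%:R *
    (\sum_(j <= t < h.+1) t`!%:R * stirling2 C h t * 3 ^- t * 2 ^+ (t - j) *
       (binom_compl #|D| j t)%:R).
Proof. exact: (pless hpsi ch3 psi3). Qed.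

(** The weights are multiples of 2A/3, so isolating A^h multiplies the power moment identity by
    (3/2)^h; this is the source of the exponents h - t and t - h - j. *)
Lemma exponent_shift (h j t : nat) : (j <= t)%N -> (t <= h)%N ->
  (3 / 2) ^+ h * (3 ^- t * 2 ^+ (t - j)) =
  3 ^+ (h - t) * 2 ^ (t%:Z - h%:Z - j%:Z) :> C.
Proof.
move=> jt th.
have n2 : (2 : C) != 0 by rewrite pnatr_eq0.
have n3 : (3 : C) != 0 by rewrite pnatr_eq0.
rewrite exprMn exprVn -{1}(subnK th) exprD.
rewrite -[t%:Z - h%:Z]opprB subzn // -opprD -PoszD -exprnN.
have -> : 2 ^+ h = 2 ^+ (h - t + j) * 2 ^+ (t - j) :> C by rewrite -exprD;
  congr (_ ^+ _); lia.
have := expf_neq0 t n3; have := expf_neq0 (t - j) n2;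
  have := expf_neq0 (h - t + j) n2.
move: (3 ^+ t) (2 ^+ (t - j)) (2 ^+ (h - t + j)) => x y z z0 y0 x0.
by field; rewrite x0 y0 z0.
Qed.

(** Both parities at once: [k] is the Kloosterman sum and [s0 = 0] for n odd, while [k] is its
    square and [s0] is q^2 - q for n even. The sign [s] distinguishes a coset from its translate by
    [rho]. *)
Lemma moment_recursion m1 m2 (D1 : {set 'M[F]_m1}) (D2 : {set 'M[F]_m2})
    (A B : nat) (s : F) (k : F -> C) (s0 : C) :
  #|D1| = (A * B)%N -> #|D2| = (A * B)%N -> (0 < A)%N -> s \in [:: 1; -1] ->
  (forall a, k (- a) = k a) ->
  (forall a, a != 0 -> trace_sum D1 a = psi (a * s) * A%:R * (k a + s0)) ->
  (forall a, a != 0 -> trace_sum D2 a = 1 * A%:R * (k a + s0)) ->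
  forall h, (1 <= h)%N ->
  let U j := \sum_(a | ~~ Z a) k a ^+ j in
  ((-1) ^+ h.+1 + 2 ^- h) * U h =
  - (\sum_(0 <= j < h) 'C(h, j)%:R *
      ((-1) ^+ j.+1 * (B%:R - s0) ^+ (h - j) + 2 ^- j * (B%:R + 2^-1 * s0) ^+
        (h - j)) * U j)
  + q%:R * A%:R ^- h *
    (\sum_(0 <= j < (minn #|D1| h).+1) (-1) ^+ j *
      ((weight_dist D1 j)%:R - (weight_dist D2 j)%:R)
       * (\sum_(j <= t < h.+1) t`!%:R * stirling2 C h t * 3 ^+ (h - t)
                         * 2 ^ (t%:Z - h%:Z - j%:Z)
                         * (binom_compl #|D1| j t)%:R)).
Proof.
move=> c1 c2 A0 hs kN S1 S2 h h1 U.
have nA : (A%:R : C) != 0 by rewrite pnatr_eq0 -lt0n.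
have n2 : (2 : C) != 0 by rewrite pnatr_eq0.
have n3 : (3 : C) != 0 by rewrite pnatr_eq0.
have w2 (a : F) : a != 0 -> (trace_weight Z (trace_vec D2 0) a)%:R =
    (2 * A%:R / 3) * ((B%:R - s0) - k a) :> C.
  move=> a0; rewrite trace_weightE !S2 ?oppr_eq0 // kN c2 natrM; by field.
have w1 : forall x : F, x != 0 -> (trace_weight Z (trace_vec D1 0) x)%:R =
    (2 * A%:R / 3) * (if Z x then (B%:R - s0) - k x else (B%:R + 2^-1 * s0) + k x /
      2) :> C.
  move=> a a0; rewrite trace_weightE !S1 ?oppr_eq0 // kN c1 natrM mulNr.
  have hp : psi (a * s) + psi (- (a * s)) = 3 * (Z a)%:R - 1.
    move: hs; rewrite !inE => /orP[] /eqP ->; rewrite ?mulr1 ?mulrN1 ?opprK -psi3;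
      ring.
  transitivity ((2 * (A%:R * B%:R) - (psi (a * s) + psi (- (a * s))) * A%:R *
    (k a + s0)) / 3); first by field.
  by rewrite hp; case: (Z a) => /=; rewrite ?mulr1 ?mulr0; field.
have w0 m (D : {set 'M[F]_m}) : (trace_weight Z (trace_vec D 0) 0)%:R = 0 :> C.
  by rewrite trace_weightE oppr0 trace_sum0; field.
(* The terms with [Z a] cancel, among them a = 0, where both weights are 0. *)
have diffE : \sum_a ((trace_weight Z (trace_vec D1 0) a)%:R ^+ h : C) -
     \sum_a (trace_weight Z (trace_vec D2 0) a)%:R ^+ h =
   (2 * A%:R / 3) ^+ h * \sum_(a | ~~ Z a)
     (((B%:R + 2^-1 * s0) + k a / 2) ^+ h - ((B%:R - s0) - k a) ^+ h).
  rewrite -sumrB [in RHS]big_mkcond mulr_sumr; apply: eq_bigr => a _ /=.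
  case: (eqVneq a 0) => [->|a0]; first by rewrite trivial_on0 !w0 subrr mulr0.
  rewrite w1 // w2 // !exprMn; case: (Z a) => /=; ring.
have binE : \sum_(a | ~~ Z a)
  (((B%:R + 2^-1 * s0) + k a / 2) ^+ h - ((B%:R - s0) - k a) ^+ h) =
   \sum_(0 <= j < h.+1) 'C(h, j)%:R *
      ((-1) ^+ j.+1 * (B%:R - s0) ^+ (h - j) + 2 ^- j * (B%:R + 2^-1 * s0) ^+
        (h - j)) * U j.
  rewrite big_mkord; under eq_bigr => a _ do rewrite !exprDn -sumrB.
  rewrite exchange_big /=; apply: eq_bigr => j _; rewrite /U mulr_sumr.
  apply: eq_bigr => a _; rewrite exprMn [(- k a) ^+ j]exprNn exprVn exprS.
  rewrite -[X in X - _]mulr_natl -[X in _ - X]mulr_natl. ring.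
(* The term j = h carries the moment to be determined; the lower ones move to the other side. *)
rewrite big_nat_recr //= binn subnn !expr0 in binE.
have := diffE; rewrite binE !pless_trace c1 c2.
set P := \sum_(0 <= j < _) _ * (\sum_(j <= t < h.+1) _ * 2 ^ _ * _).
set L1 := (X in X - _ = _ -> _); set L2 := (X in _ - X = _ -> _); move=> hE.
have PE : q%:R * P = (3 / 2) ^+ h * (L1 - L2).
  rewrite /L1 /L2 -mulrBr mulrCA; congr (_ * _); rewrite -sumrB mulr_sumr.
  apply: eq_bigr => j _; rewrite -mulrBl -mulrBr mulrCA; congr (_ * _).
  rewrite mulr_sumr; apply: eq_big_nat => t /andP[jt th].
  rewrite ltnS in th. have := exponent_shift jt th.
  set x3 := 3 ^+ (h - t); set x2 := 2 ^ _ => e.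
  transitivity (t`!%:R * stirling2 C h t * (x3 * x2) *
    (binom_compl (A * B) j t)%:R).
    by rewrite -[_ * x3 * x2]mulrA.
  have rearr (x1 x4 x5 x6 x7 : C) : x1 * (x4 * (x5 * x6)) * x7 = x4 *
    (x1 * x5 * x6 * x7) by ring.
  by rewrite -e rearr.
rewrite mulrAC PE hE.
have -> : (3 / 2) ^+ h * ((2 * A%:R / 3) ^+ h * (\sum_(0 <= i < h)
        'C(h, i)%:R *
        ((-1) ^+ i.+1 * (B%:R - s0) ^+ (h - i) +
         2 ^- i * (B%:R + 2^-1 * s0) ^+ (h - i)) *
        U i +
     1 * ((-1) ^+ h.+1 * 1 + 2 ^- h * 1) * U h)) / A%:R ^+ h = (\sum_(0 <= i < h)
        'C(h, i)%:R *
        ((-1) ^+ i.+1 * (B%:R - s0) ^+ (h - i) +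
         2 ^- i * (B%:R + 2^-1 * s0) ^+ (h - i)) *
        U i) + ((-1) ^+ h.+1 + 2 ^- h) * U h.
  rewrite mulrA -exprMn (_ : 3 / 2 * (2 * A%:R / 3) = A%:R); last by field.
  rewrite mulrAC mulfV ?expf_neq0 // !mulr1 !mul1r.
  by [].
by rewrite addKr.
Qed.

End Recursion.

(** * Trace distributions *)

Section TraceCounts.
Variables (C : numFieldType) (F : finFieldType) (psi : F -> C).
Hypothesis hpsi : nontrivial_character psi.
Hypothesis ch3 : 3%N \in [pchar F].
Local Notation q := #|F|.

Definition trace_count m (D : {set 'M[F]_m}) (b : F) : nat :=
  #|[set g in D | \tr g == b]|.

Definition sqrt_count (d : F) : nat := #|[set y : F | y ^+ 2 == d]|.

Lemma sum_char_nonzero y : \sum_(a | a != 0) psi (a * y) = (y == 0)%:R * q%:R - 1.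
Proof.
have [psi0 _ _] := hpsi; have := sum_char_scale hpsi y.
under eq_bigr do rewrite mulrC.
by rewrite (bigD1 0) //= mul0r psi0 => <-; rewrite addrAC subrr add0r.
Qed.

Lemma trace_count_sum m (D : {set 'M[F]_m}) b :
  q%:R * (trace_count D b)%:R =
  #|D|%:R + \sum_(a | a != 0) psi (a * - b) * trace_sum psi D a.
Proof.
have [psi0 psiD _] := hpsi.
transitivity (\sum_a psi (a * - b) * trace_sum psi D a); last first.
  by rewrite (bigD1 0) //= mul0r psi0 mul1r trace_sum0.
rewrite /trace_sum; under eq_bigr => a _ do rewrite mulr_sumr.
rewrite exchange_big /= /trace_count -sum1_card natr_sum mulr_sumr.
rewrite (eq_bigl (fun g => (g \in D) && (\tr g == b))); last by move=> g;
  rewrite inE.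
rewrite big_mkcondr; apply: eq_bigr => g _.
under eq_bigr => a _ do rewrite -psiD -mulrDr mulrC.
by rewrite sum_char_scale // addrC subr_eq0; case: ifP;
  rewrite ?mulr1 ?mul1r ?mul0r.
Qed.

(* In characteristic 3, x + 1/x = c is equivalent to (x + c)^2 = c^2 - 1. *)
Lemma kloosterman_fourier c :
  \sum_(a | a != 0) psi (a * - c) * kloosterman_sum psi a =
  q%:R * (sqrt_count (c ^+ 2 - 1))%:R - (q%:R - 1).
Proof.
have [psi0 psiD _] := hpsi.
rewrite /kloosterman_sum; under eq_bigr => a _ do rewrite mulr_sumr.
rewrite exchange_big /=.
under eq_bigr => x _ do (under eq_bigr => a _ do rewrite -psiD -mulrDr;
  rewrite sum_char_nonzero).
rewrite sumrB sumr_const card_nonzero -mulr_suml mulrC; congr (_ * _ - _);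
  last first.
  by rewrite natrB // ltnW // card_finNzRing_gt1.
rewrite /sqrt_count -sum1_card natr_sum big_mkcond [RHS]big_mkcond /=.
rewrite [RHS](reindex_inj (addIr c)) /=; apply: eq_bigr => x _; rewrite inE.
have three : 3%:R = 0 :> F := pcharf0 ch3.
case: (eqVneq x 0) => [->|x0] /=.
  by rewrite add0r -subr_eq0 opprB addrC subrK oner_eq0.
have e : (x + c) ^+ 2 - (c ^+ 2 - 1) = x * (- c + (x + x^-1)).
  transitivity (x * (- c + (x + x^-1)) + 3%:R * (x * c)); first by field.
  by rewrite three mul0r addr0.
by rewrite -[X in if X then _ else _]subr_eq0 e mulf_eq0 (negPf x0) /=;
  case: (_ == 0).
Qed.

Lemma kloosterman_sq_fourier c :
  \sum_(a | a != 0) psi (a * - c) * kloosterman_sum psi a ^+ 2 =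
  q%:R * (delta2 c)%:R - (q%:R - 1) ^+ 2.
Proof.
have [psi0 psiD _] := hpsi.
have sqE a : kloosterman_sum psi a ^+ 2 =
    \sum_(p : F * F | (p.1 != 0) && (p.2 != 0)) psi
      (a * (p.1 + p.2 + p.1^-1 + p.2^-1)).
  rewrite /kloosterman_sum expr2 big_distrlr /= pair_big /=; apply: eq_bigr => p _.
  by rewrite -psiD; congr psi; ring.
under eq_bigr => a _ do rewrite sqE mulr_sumr.
rewrite exchange_big /=.
under eq_bigr => x _ do (under eq_bigr => a _ do rewrite -psiD -mulrDr;
  rewrite sum_char_nonzero).
rewrite sumrB -mulr_suml mulrC; congr (_ * _ - _).
  rewrite /delta2 -sum1_card natr_sum big_mkcond [RHS]big_mkcond /=;
    apply: eq_bigr => p _.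
  rewrite inE addrC subr_eq0 andbA; case: (_ && _) => //=.
  by case: (_ == c).
rewrite -(pair_big (fun x : F => x != 0) (fun x : F => x != 0) (fun _ _ => 1)) /=.
by rewrite !sumr_const card_nonzero -[LHS]mulr_natr natrB ?expr2 // ltnW //
  card_finNzRing_gt1.
Qed.

Section Counts.
Variables (m : nat) (D : {set 'M[F]_m}) (A B : nat) (s : F).
Hypothesis hD : #|D| = (A * B)%N.

(** Fourier inversion with the negative terms moved across, so that the identity holds in [nat]. *)
Lemma trace_count_odd b :
  (forall a, a != 0 -> trace_sum psi D a = psi (a * s) * A%:R * kloosterman_sum psi
    a) ->
  (q * trace_count D b + A * q = A *
    (B + q * sqrt_count ((b - s) ^+ 2 - 1)%R + 1))%N.
Proof.
have [psi0 psiD _] := hpsi.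
move=> hS; apply/eqP; rewrite -(eqr_nat C) natrD !natrM trace_count_sum hD.
rewrite [X in _ + X + _](eq_bigr
  (fun a => A%:R * (psi (a * - (b - s)) * kloosterman_sum psi a))).
  by rewrite -mulr_sumr kloosterman_fourier !natrD !natrM; apply/eqP; ring.
move=> a a0; rewrite hS // opprB
  (_ : psi (a * (s - b)) = psi (a * s) * psi (a * - b)); first by ring.
by rewrite -psiD -mulrDr.
Qed.

Lemma trace_count_even b :
  (forall a, a != 0 -> trace_sum psi D a = psi (a * s) * A%:R *
     (kloosterman_sum psi a ^+ 2 + (q%:R ^+ 2 - q%:R))) ->
  (q * trace_count D b + A * (2 * q ^ 2 + 1) =
    A * (B + q * delta2 (b - s)%R + 3 * q + (b == s) * (q ^ 3 - q ^ 2)))%N.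
Proof.
have [psi0 psiD _] := hpsi.
move=> hS; apply/eqP; rewrite -(eqr_nat C) natrD !natrM trace_count_sum hD.
rewrite [X in _ + X + _](eq_bigr
  (fun a => A%:R * (psi (a * - (b - s)) * kloosterman_sum psi a ^+ 2) +
   A%:R * (q%:R ^+ 2 - q%:R) * psi (a * - (b - s)))).
  rewrite big_split -!mulr_sumr /= kloosterman_sq_fourier sum_char_nonzero oppr_eq0
    subr_eq0.
  rewrite !natrD !natrM natrB ?leq_pexp2l ?natrX //;
    last by rewrite ltnW // card_finNzRing_gt1.
  by apply/eqP; ring.
move=> a a0; rewrite hS // opprB
  (_ : psi (a * (s - b)) = psi (a * s) * psi (a * - b)); first by ring.
by rewrite -psiD -mulrDr.
Qed.

End Counts.
End TraceCounts.

(** * Closed formulas for the weight distributions *)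

Section ClosedFormulas.
Variables (C : numFieldType) (F : finFieldType) (psi : F -> C).
Hypothesis hpsi : nontrivial_character psi.
Hypothesis ch3 : 3%N \in [pchar F].
Local Notation q := #|F|.

Lemma double_char3 (x : F) : x + x = - x.
Proof.
apply/eqP; rewrite -addr_eq0 -mulr2n -mulrSr -mulr_natl.
by rewrite (pcharf0 ch3) mul0r.
Qed.

Lemma sqrt_count0 : sqrt_count (0 : F) = 1%N.
Proof.
apply: (@eq_card1 _ 0) => y; by rewrite inE sqrf_eq0 -topredE.
Qed.

Lemma sqrt_count_square (d : F) : d != 0 -> is_square d -> sqrt_count d = 2%N.
Proof.
move=> d0 /existsP[y /eqP dy]; have y0 : y != 0 by apply: contraNneq d0 => y0;
  rewrite dy y0 expr0n.
have yN : y != - y.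
  by rewrite -addr_eq0 double_char3 oppr_eq0.
rewrite /sqrt_count (_ : [set _ | _] = [set y; - y]) ?cards2 ?yN //.
by apply/setP => x; rewrite !inE dy eqf_sqr.
Qed.

Lemma sqrt_count_nonsquare (d : F) : ~~ is_square d -> sqrt_count d = 0%N.
Proof.
move=> hd; apply/eqP; rewrite cards_eq0; apply/eqP/setP => y; rewrite !inE.
by apply: contraNF hd => /eqP <-; apply/existsP; exists y.
Qed.

Lemma q_gt0 : (0 < q)%N.
Proof. exact: ltnW (card_finNzRing_gt1 F). Qed.

Section Dist.
Variables (m : nat) (D : {set 'M[F]_m}) (A B : nat) (s : F).
Hypothesis hD : #|D| = (A * B)%N.

(** The number of square roots of [d b], namely 1, 2 or 0, decides between [top0], [topS] and
    [topN]. The points [x] and [y] are the two roots s + 1 and s - 1 of [d], split off as separate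
    factors. *)
Lemma weight_dist_odd (x y : F) (d : F -> F) j :
  (forall a, a != 0 -> trace_sum psi D a = psi (a * s) * A%:R * kloosterman_sum psi
    a) ->
  x != y -> (forall b, d b = (b - x) * (b - y)) ->
    (forall b, d b = (b - s) ^+ 2 - 1) ->
  weight_dist D j = family_sum j (fun nu mu : F -> nat =>
    (trinom (top0 A B q) (nu x) (mu x) * trinom (top0 A B q) (nu y) (mu y) *
     \prod_(b : F | (d b != 0%R) && is_square (d b)) trinom (topS A B q) (nu b)
       (mu b) *
     \prod_(b : F | ~~ is_square (d b)) trinom (topN A B q) (nu b) (mu b))%N).
Proof.
move=> hS xy dxy ds; rewrite weight_dist_family //; apply: eq_family_sum => nu mu.
have cnt b := trace_count_odd hpsi ch3 hD b hS.
have d0 b : (d b == 0) = (b == x) || (b == y) by rewrite dxy mulf_eq0 !subr_eq0.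
have c0 b : d b = 0 -> trace_count D b = top0 A B q.
  move=> db; have := cnt b; rewrite -ds db sqrt_count0 /top0 => h.
  rewrite -(mulKn (trace_count D b) q_gt0); congr (_ %/ _)%N; lia.
have cS b : d b != 0 -> is_square (d b) -> trace_count D b = topS A B q.
  move=> db sb; have := cnt b; rewrite -ds sqrt_count_square // /topS => h.
  rewrite -(mulKn (trace_count D b) q_gt0); congr (_ %/ _)%N; lia.
have cN b : ~~ is_square (d b) -> trace_count D b = topN A B q.
  move=> sb; have := cnt b; rewrite -ds sqrt_count_nonsquare // /topN muln0 addn0 =>
    h.
  rewrite -(mulKn (trace_count D b) q_gt0); congr (_ %/ _)%N.
  (* The additive identity [h] ensures that the subtraction in [topN] is exact. *)
  by rewrite mulnBr -h addnK.
have sq0 b : d b = 0 -> is_square (d b).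
  by move=> ->; apply/existsP; exists 0; rewrite expr0n.
rewrite (bigID (fun b => is_square (d b))) /=; congr (_ * _)%N; last first.
  by apply: eq_bigr => b hb; rewrite -/(trace_count D b) cN.
rewrite (bigID (fun b => d b == 0)) /=; congr (_ * _)%N; last first.
  by apply: eq_big => [b|b /andP[h1 h2]]; rewrite 1?andbC // -/(trace_count D b) cS.
have dx : d x = 0 by apply/eqP; rewrite d0 eqxx.
have dy : d y = 0 by apply/eqP; rewrite d0 eqxx orbT.
rewrite (bigD1 x) /=; last by rewrite sq0 // dx eqxx.
rewrite -/(trace_count D x) c0 //; congr (_ * _)%N.
rewrite (big_pred1 y) => [|b /=]; first by rewrite -/(trace_count D y) c0.
rewrite d0; case: (eqVneq b y) => [->|by'].
  by rewrite orbT eq_sym xy sq0.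
by rewrite orbF; case: eqP; rewrite ?andbF.
Qed.

Lemma weight_dist_even j :
  (forall a, a != 0 -> trace_sum psi D a = psi (a * s) * A%:R *
     (kloosterman_sum psi a ^+ 2 + (q%:R ^+ 2 - q%:R))) ->
  weight_dist D j = family_sum j (fun nu mu : F -> nat =>
    (trinom (topE A B q (delta2 (0%R : F))) (nu s) (mu s) *
     \prod_(b : F | b != s) trinom (topG A B q (delta2 (b - s)%R)) (nu b)
       (mu b))%N).
Proof.
move=> hS; rewrite weight_dist_family //; apply: eq_family_sum => nu mu.
have cnt b := trace_count_even hpsi hD b hS.
rewrite (bigD1 s) //=; congr (_ * _)%N.
  rewrite -/(trace_count D s); congr trinom; have := cnt s;
    rewrite subrr eqxx mul1n /topE => h.
  rewrite -(mulKn (trace_count D s) q_gt0); congr (_ %/ _)%N.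
  (* At the point [s] the constants combine by q^3 - 3 q^2 + 3 q - 1 = (q - 1)^3. *)
  apply/eqP; rewrite -(eqn_add2r (A * (2 * q ^ 2 + 1))) h -mulnDr; apply/eqP;
    congr (_ * _)%N.
  have [p qE] : exists p, q = p.+1 by exists q.-1; rewrite prednK // q_gt0.
  rewrite [(q ^ 3)%N]expnS -[X in (_ - X)%N]mul1n -mulnBl -!addnA;
    congr (_ + (_ + _))%N.
  by rewrite qE !subSS !subn0; ring.
apply: eq_bigr => b bs; rewrite -/(trace_count D b); congr trinom.
have := cnt b; rewrite (negPf bs) mul0n addn0 /topG => h.
rewrite -(mulKn (trace_count D b) q_gt0); congr (_ %/ _)%N.
by rewrite mulnBr -h addnK.
Qed.

End Dist.

Lemma C1m_dist m (D : {set 'M[F]_m}) n j : #|D| = (Am n q * Bm n q)%N ->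
  (forall a, a != 0 -> trace_sum psi D a = psi (a * 1) * (Am n q)%:R *
    kloosterman_sum psi a) ->
  weight_dist D j = C1m F n j.
Proof.
move=> hD hS; rewrite (weight_dist_odd (x := 0) (y := 2)
  (d := fun b => b ^+ 2 - 2 * b) hD j hS) //.
- by rewrite eq_sym -[2]/(1 + 1) double_char3 oppr_eq0 oner_eq0.
- by move=> b; ring.
- by move=> b; ring.
Qed.

Lemma two_char3 : (2 : F) = -1.
Proof. by rewrite -[2]/(1 + 1) double_char3. Qed.

Lemma C2m_dist m (D : {set 'M[F]_m}) n j : #|D| = (Am n q * Bm n q)%N ->
  (forall a, a != 0 -> trace_sum psi D a = psi (a * -1) * (Am n q)%:R *
    kloosterman_sum psi a) ->
  weight_dist D j = C2m F n j.
Proof.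
move=> hD hS; rewrite (weight_dist_odd (x := 0) (y := 1)
  (d := fun b => b ^+ 2 + 2 * b) hD j hS) //.
- by rewrite eq_sym oner_eq0.
- by move=> b; rewrite two_char3; ring.
- by move=> b; ring.
Qed.

Lemma CSpm_dist m (D : {set 'M[F]_m}) n j : #|D| = (Am n q * Bm n q)%N ->
  (forall a, a != 0 -> trace_sum psi D a = 1 * (Am n q)%:R * kloosterman_sum psi a)
    ->
  weight_dist D j = CSpm F n j.
Proof.
have [psi0 _ _] := hpsi.
move=> hD hS; rewrite (weight_dist_odd (x := 1) (y := -1) (s := 0)
  (d := fun b => b ^+ 2 - 1) hD j) //.
- by move=> a a0; rewrite mulr0 psi0 hS.
- by rewrite -addr_eq0 double_char3 oppr_eq0 oner_eq0.
- by move=> b; ring.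
- by move=> b; rewrite subr0.
Qed.

Lemma C1p_dist m (D : {set 'M[F]_m}) n j : #|D| = (Ap n q * Bp n q)%N ->
  (forall a, a != 0 -> trace_sum psi D a = psi (a * 1) * (Ap n q)%:R *
     (kloosterman_sum psi a ^+ 2 + (q%:R ^+ 2 - q%:R))) ->
  weight_dist D j = C1p F n j.
Proof. by move=> hD hS; rewrite (weight_dist_even hD j hS). Qed.

Lemma C2p_dist m (D : {set 'M[F]_m}) n j : #|D| = (Ap n q * Bp n q)%N ->
  (forall a, a != 0 -> trace_sum psi D a = psi (a * -1) * (Ap n q)%:R *
     (kloosterman_sum psi a ^+ 2 + (q%:R ^+ 2 - q%:R))) ->
  weight_dist D j = C2p F n j.
Proof.
move=> hD hS; rewrite (weight_dist_even hD j hS); apply: eq_family_sum => nu mu.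
by congr (_ * _)%N; apply: eq_bigr => b _; rewrite opprK.
Qed.

Lemma CSpp_dist m (D : {set 'M[F]_m}) n j : #|D| = (Ap n q * Bp n q)%N ->
  (forall a, a != 0 -> trace_sum psi D a = 1 * (Ap n q)%:R *
     (kloosterman_sum psi a ^+ 2 + (q%:R ^+ 2 - q%:R))) ->
  weight_dist D j = CSpp F n j.
Proof.
have [psi0 _ _] := hpsi.
move=> hD hS; rewrite (weight_dist_even (s := 0) hD j) => [|a a0];
  last by rewrite mulr0 psi0 hS.
apply: eq_family_sum => nu mu.
by congr (_ * _)%N; apply: eq_bigr => b _; rewrite subr0.
Qed.

End ClosedFormulas.

(** * The canonical character *)

Section Omega.
Variable R : realType.

Lemma expiD (s t : R) : expi (s + t) = expi s * expi t.
Proof.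
rewrite /expi cosD sinD.
apply/eqP; rewrite eq_complex /= eqxx /=; apply/eqP; ring.
Qed.

Lemma expi_nat (t : R) k : expi (t * k%:R) = expi t ^+ k.
Proof.
elim: k => [|k IH]; first by rewrite mulr0 /expi cos0 sin0.
by rewrite exprS -IH -expiD -natr1 mulrDr mulr1 addrC.
Qed.

Definition omega : R[i] := expi (2 * pi / 3).

Lemma omega3 : omega ^+ 3 = 1.
Proof.
rewrite /omega -expi_nat mulfVK ?pnatr_eq0 // /expi mulr_natl cos2pi sin2pi //.
Qed.

Lemma omega_neq1 : omega != 1.
Proof.
apply/eqP => /eqP; rewrite eq_complex /= => /andP[/eqP c1 _].
have pi0 := pi_gt0 R.
have : 2 * pi / 3 = 0 :> R.
  (* Both angles lie in [0, pi], where cos is injective. *)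
  apply: cos_inj; rewrite ?in_itv /= ?cos0 //; lra.
lra.
Qed.

Lemma omega_sum : 1 + omega + omega ^+ 2 = 0.
Proof.
have h : (omega - 1) * (1 + omega + omega ^+ 2) = 0.
  by transitivity (omega ^+ 3 - 1); [ring | rewrite omega3 subrr].
by move/eqP: h; rewrite mulf_eq0 subr_eq0 (negPf omega_neq1) => /eqP.
Qed.

End Omega.

(** * The trace to the prime field and the character it defines *)

Section Trace.
Variables (F : finFieldType) (r : nat).
Hypothesis hr : (1 <= r)%N.
Hypothesis hF : #|F| = (3 ^ r)%N.

Lemma pchar3 : 3%N \in [pchar F].
Proof. exact: card_finPcharP hF isT. Qed.

Lemma trD : {morph tr r : x y / x + y >-> x + y :> F}.
Proof.
move=> x y; rewrite /tr -big_split /=; apply: eq_bigr => i _.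
by rewrite exprDn_pchar // pnatX pnatE ?pchar3.
Qed.

(** Cubing permutes the summands cyclically, because x^q = x; so the trace lies in the prime
    field. *)
Lemma tr_cube (x : F) : tr r x ^+ 3 = tr r x.
Proof.
have cubeD : {morph (fun z : F => z ^+ 3) : y z / y + z >-> y + z}.
  by move=> y z; rewrite exprDn_pchar // pnatE ?pchar3.
have xq := expf_card x; rewrite hF in xq.
rewrite /tr (big_morph _ cubeD (expr0n F 3)).
case: r hr xq => // r' _ xq; rewrite big_ord_recr [RHS]big_ord_recl /= addrC.
rewrite -exprM -expnSr xq expn0 expr1; congr (_ + _).
by apply: eq_bigr => i _; rewrite -exprM -expnSr.
Qed.

(** The trace is a nonzero polynomial of degree below q, so it cannot vanish at all q points. *)
Lemma tr_nontriv : exists x : F, tr r x != 0.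
Proof.
apply/existsP; apply: contraT; rewrite negb_exists => /forallP h.
pose p : {poly F} := \sum_(i < r) 'X^(3 ^ i).
have p0 : p != 0.
  apply: contraTneq isT => p0; have := congr1 (fun p : {poly F} => p`_1) p0.
  rewrite coef0 /p coef_sum; case: r hr => // r' _.
  rewrite big_ord_recl coefXn eqxx big1 ?addr0 => [/eqP|i _].
    by rewrite oner_eq0.
  by rewrite coefXn /= expnS; case: (3 ^ _)%N (expn_gt0 3 i) => // k _;
    rewrite mulnS.
(* [size] is the degree plus one; it is still at most 3^r = q, so q roots are too many. *)
have sp : (size p <= 3 ^ r)%N.
  apply: (leq_trans (size_sum _ _ _)); apply/bigmax_leqP => i _.
  by rewrite size_polyXn ltn_exp2l.
have := max_poly_roots p0 _ (enum_uniq F); rewrite -cardT hF ltnNge sp => /(_ _).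
apply; apply/allP => x _; rewrite /root /p horner_sum.
by rewrite (eq_bigr (fun i : 'I_r => x ^+ (3 ^ i))) ?(negPn (h x)) // => i _;
  rewrite hornerXn.
Qed.

(** In characteristic 3, y^3 - y = y (y - 1) (y - 2), so a representative exists and the default
    value of [F3rep] is not reached. *)
Lemma F3repE (y : F) : y ^+ 3 = y -> (F3rep y)%:R = y.
Proof.
move=> y3; rewrite /F3rep; case: pickP => [k /eqP //|h].
have : y * (y - 1) * (y - 2%:R) = 0.
  transitivity (y ^+ 3 - y - 3%:R * (y ^+ 2 - y)); first by ring.
  by rewrite y3 (pcharf0 pchar3) mul0r subr0 subrr.
move/eqP; rewrite !mulf_eq0 !subr_eq0 -orbA => /or3P[] /eqP yE.
- by have := h (@Ordinal 3 0 isT); rewrite yE eqxx.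
- by have := h (@Ordinal 3 1 isT); rewrite yE eqxx.
- by have := h (@Ordinal 3 2 isT); rewrite yE eqxx.
Qed.

Lemma F3rep_lt (y : F) : (F3rep y < 3)%N.
Proof. by rewrite /F3rep; apply: ltn_ord. Qed.

Lemma lambdaE (R : realType) (x : F) : lambda R r x = omega R ^+ F3rep (tr r x).
Proof. by rewrite /lambda -expi_nat /omega; congr expi; ring. Qed.

Lemma natr_mod3 (i j : nat) : i%:R = j%:R :> F -> i = j %[mod 3].
Proof.
wlog ij : i j / (i <= j)%N => [hw h|/esym/eqP].
  by case/orP: (leq_total i j) => ij; [exact: hw | apply/esym/hw].
rewrite -subr_eq0 -natrB // -(dvdn_pcharf pchar3) => h.
by apply/esym/eqP; rewrite eqn_mod_dvd.
Qed.

Lemma lambdaD (R : realType) : {morph lambda R r : x y / (x : F) + y >-> x * y}.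
Proof.
move=> x y; rewrite !lambdaE -exprD trD -(expr_mod _ (omega3 R))
  -[RHS](expr_mod _ (omega3 R)).
congr (_ ^+ _); apply: natr_mod3; rewrite natrD !F3repE ?tr_cube //.
by rewrite -trD tr_cube.
Qed.

Lemma F3rep_eq0 (y : F) : y ^+ 3 = y -> (F3rep y == 0%N) = (y == 0).
Proof.
move=> y3; apply/eqP/eqP => [h|->]; first by rewrite -(F3repE y3) h.
have := @natr_mod3 (F3rep (0 : F)) 0; rewrite F3repE ?expr0n // => /(_ erefl).
by rewrite !modn_small // F3rep_lt.
Qed.

Lemma lambda_eq1 (R : realType) (x : F) : (lambda R r x == 1) = (tr r x == 0).
Proof.
rewrite lambdaE -F3rep_eq0 ?tr_cube //; have := F3rep_lt (tr r x).
case: (F3rep _) => [|[|[|//]]] _ /=; first by rewrite expr0 eqxx.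
  by rewrite expr1 (negPf (omega_neq1 R)).
apply/negbTE/eqP => h; have := omega3 R; rewrite exprS h mulr1 => h1.
by have := omega_neq1 R; rewrite h1 eqxx.
Qed.

Lemma lambda_character (R : realType) : nontrivial_character (lambda R r : F -> _).
Proof.
have l0 : lambda R r (0 : F) = 1.
  apply/eqP; rewrite lambda_eq1 /tr big1 // => i _.
  by rewrite expr0n expn_eq0.
split=> //; first exact: lambdaD.
have [x0] := tr_nontriv; rewrite -(lambda_eq1 R) => hx; apply/eqP.
have : lambda R r x0 * (\sum_(x : F) lambda R r x) = \sum_(x : F) lambda R r x.
  rewrite mulr_sumr [RHS](reindex_inj (addrI x0)) /=.
  by apply: eq_bigr => x _; rewrite lambdaD.
move/eqP; rewrite -subr_eq0; set s := \sum_x _.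
by rewrite -[X in _ - X]mul1r -mulrBl mulf_eq0 subr_eq0 (negPf hx).
Qed.

(** Orthogonality of the cube roots of unity; it supplies the hypothesis [psi3], with [Z] the kernel
    of the trace. *)
Lemma lambda_sum3 (R : realType) (y : F) :
  1 + lambda R r y + lambda R r (- y) = 3 * (tr r y == 0)%:R.
Proof.
have -> : - y = y + y.
  apply/eqP; rewrite eq_sym -addr_eq0 -mulr2n -mulrSr -mulr_natl.
  by rewrite (pcharf0 pchar3) mul0r.
rewrite lambdaD -expr2; case: (eqVneq (tr r y) 0) => [/eqP|] /=.
  by rewrite -(lambda_eq1 R) => /eqP ->; ring.
move=> t0; rewrite mulr0 lambdaE; have := F3rep_lt (tr r y).
move: t0; rewrite -F3rep_eq0 ?tr_cube //.
case: (F3rep _) => [|[|[|//]]] // _ _; first by rewrite expr1 omega_sum.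
rewrite -[RHS](omega_sum R) -exprM (_ : (2 * 2 = 3 + 1)%N) // exprD omega3; ring.
Qed.

(** The substitution x |-> a x makes the two terms symmetric, which is how the square arguments
    arise. *)
Lemma KloostermanE (R : realType) (a : F) : a != 0 ->
  Kloosterman R r (a ^+ 2) = kloosterman_sum (lambda R r) a.
Proof.
move=> a0; rewrite /Kloosterman (reindex_inj (mulfI a0)) /=.
apply: eq_big => [x|x]; rewrite mulf_eq0 (negPf a0) //= => x0.
by congr lambda; field; rewrite x0.
Qed.

End Trace.

(** * Assembly of the recursions and weight distributions *)

Lemma kloosterman_sumN (C : numFieldType) (F : finFieldType) (psi : F -> C) a :
  kloosterman_sum psi (- a) = kloosterman_sum psi a.
Proof.
rewrite /kloosterman_sum (reindex_inj oppr_inj) /=; apply: eq_big => x.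
  by rewrite oppr_eq0.
by move=> _; rewrite invrN -opprD mulrNN.
Qed.

Lemma coset_sign_mem (F : finFieldType) i : coset_sign F i \in [:: 1; -1].
Proof. by rewrite /coset_sign; case: ifP; rewrite !inE eqxx ?orbT. Qed.

(** Nonemptiness of the coset is the source of A > 0, through its order A B; the recursion divides
    by A^h. *)
Lemma QsigmaQ_gt0 (F : finFieldType) n k : (0 < #|QsigmaQ F n k|)%N.
Proof.
apply/card_gt0P; exists (1%:M *m sigma F n k *m 1%:M).
by apply/imset2P; exists 1%:M 1%:M; rewrite ?Q_1.
Qed.

Lemma rhoQsigmaQ_gt0 (F : finFieldType) n k : (0 < #|rhoQsigmaQ F n k|)%N.
Proof.
have /card_gt0P[w wQ] := QsigmaQ_gt0 F n k.
by apply/card_gt0P; exists (rho F n *m w); apply: imset_f.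
Qed.

Lemma DCm_gt0 (F : finFieldType) n i : (0 < #|DCm F n i|)%N.
Proof. by rewrite /DCm; case: ifP => _;
  [exact: QsigmaQ_gt0 | exact: rhoQsigmaQ_gt0]. Qed.

Lemma DCp_gt0 (F : finFieldType) n i : (0 < #|DCp F n i|)%N.
Proof. by rewrite /DCp; case: ifP => _;
  [exact: QsigmaQ_gt0 | exact: rhoQsigmaQ_gt0]. Qed.

Theorem theorem1p1 (R : realType) (r : nat) (F : finFieldType)
    (hr : (1 <= r)%N) (hF : #|F| = (3 ^ r)%N) :
  let q := #|F| in
  let T := T12SK R F r in
  (forall n : nat, odd n ->
     let A := Am n q in
     let B := Bm n q in
     let C := weight_dist (DCSpm F n) in
     (forall i : nat, i \in [:: 1; 2]%N ->
        let N := #|DCm F n i| in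
        let Ci := weight_dist (DCm F n i) in
        N = (A * B)%N /\
        (forall h : nat, (1 <= h)%N ->
           ((-1) ^+ h.+1 + 2 ^- h) * T h
           = - (\sum_(1 <= j < h)
                  ((-1) ^+ j.+1 + 2 ^- j) * 'C(h, j)%:R
                  * B%:R ^+ (h - j) * T j)
             + q%:R * A%:R ^- h
               * (\sum_(0 <= j < (minn N h).+1)
                    (-1) ^+ j * ((Ci j)%:R - (C j)%:R)
                    * (\sum_(j <= t < h.+1)
                         t`!%:R * stirling2 _ h t * 3 ^+ (h - t)
                         * 2 ^ (t%:Z - h%:Z - j%:Z)
                         * (binom_compl N j t)%:R))) /\
        (forall j : nat, (j <= N)%N ->
           Ci j = (if i == 1%N then C1m F n j else C2m F n j) /\
           C j = CSpm F n j))) /\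
  (forall n : nat, (2 <= n)%N -> ~~ odd n ->
     let A := Ap n q in
     let B := Bp n q in
     let C := weight_dist (DCSpp F n) in
     (forall i : nat, i \in [:: 1; 2]%N ->
        let N := #|DCp F n i| in
        let Ci := weight_dist (DCp F n i) in
        N = (A * B)%N /\
        (forall h : nat, (1 <= h)%N ->
           ((-1) ^+ h.+1 + 2 ^- h) * T (2 * h)%N
           = - (\sum_(0 <= j < h)
                  'C(h, j)%:R
                  * ((-1) ^+ j.+1 * (B%:R - q%:R ^+ 2 + q%:R) ^+ (h - j)
                     + 2 ^- j
                       * (B%:R + 2^-1 * q%:R ^+ 2 - 2^-1 * q%:R) ^+ (h - j))
                  * T (2 * j)%N)
             + q%:R * A%:R ^- h
               * (\sum_(0 <= j < (minn N h).+1)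
                    (-1) ^+ j * ((Ci j)%:R - (C j)%:R)
                    * (\sum_(j <= t < h.+1)
                         t`!%:R * stirling2 _ h t * 3 ^+ (h - t)
                         * 2 ^ (t%:Z - h%:Z - j%:Z)
                         * (binom_compl N j t)%:R))) /\
        (forall j : nat, (j <= N)%N ->
           Ci j = (if i == 1%N then C1p F n j else C2p F n j) /\
           C j = CSpp F n j))).
Proof.
move=> q T; have ch3 := pchar3 hF.
have hpsi := lambda_character hr hF R.
have psi3 := lambda_sum3 hr hF R.
pose Z : pred F := fun a => tr r a == 0.
have TE h : T h = \sum_(a | ~~ Z a) kloosterman_sum (lambda R r) a ^+ h.
  rewrite /T /T12SK; apply: eq_big => [a|a /andP[a0 _]];
    last by rewrite KloostermanE.
  rewrite /Z andbC; case: (eqVneq a 0) => [->|//]; last by rewrite andbT.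
  by have := trivial_on0 hpsi psi3; rewrite /Z => ->.
split=> n.
  move=> on A B Cs i hi N Ci.
  have [c1 S1] := DCm_sum hpsi ch3 on hi; have [c2 S2] := DCSpm_sum hpsi ch3 on.
  split=> //; split=> [h h1|j _]; last first.
    split; last exact: (CSpm_dist hpsi ch3 _ c2 S2).
    move: S1; rewrite /Ci /coset_sign; case: ifP => _ S1.
      exact: (C1m_dist hpsi ch3 _ c1 S1).
    exact: (C2m_dist hpsi ch3 _ c1 S1).
  have A0 : (0 < A)%N by have := DCm_gt0 F n i; rewrite c1 muln_gt0 => /andP[].
  have S1' a : a != 0 -> trace_sum (lambda R r) (DCm F n i) a =
     lambda R r (a * coset_sign F i) * A%:R * (kloosterman_sum (lambda R r) a + 0).
    by move=> a0; rewrite addr0 -S1.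
  have S2' a : a != 0 -> trace_sum (lambda R r) (DCSpm F n) a =
     1 * A%:R * (kloosterman_sum (lambda R r) a + 0).
    by move=> a0; rewrite addr0 -S2.
  have := moment_recursion hpsi ch3 psi3 c1 c2 A0
    (coset_sign_mem F i) (kloosterman_sumN _) S1' S2' h1.
  rewrite /= -TE => ->; congr (- _ + _).
  (* With s0 = 0 the term j = 0 has coefficient - B^h + B^h = 0, so the sum starts at 1. *)
  rewrite big_ltn // -TE !subr0 mulr0 addr0 expr1 expr0 invr1 mul1r mulN1r addNr
    mulr0 mul0r add0r.
  by apply: eq_big_nat => j _; rewrite -TE; ring.
move=> n2 en A B Cs i hi N Ci.
have [c1 S1] := DCp_sum hpsi ch3 n2 en hi; have [c2 S2] := DCSpp_sum hpsi ch3 n2 en.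
(* Here s0 is q^2 - q, the constant left beside the square in [kloosterman_GL2]. *)
have S1' a : a != 0 -> trace_sum (lambda R r) (DCp F n i) a =
     lambda R r (a * coset_sign F i) * A%:R *
       (kloosterman_sum (lambda R r) a ^+ 2 + (q%:R ^+ 2 - q%:R)).
  by move=> a0; rewrite addrA -S1.
have S2' a : a != 0 -> trace_sum (lambda R r) (DCSpp F n) a =
     1 * A%:R * (kloosterman_sum (lambda R r) a ^+ 2 + (q%:R ^+ 2 - q%:R)).
  by move=> a0; rewrite addrA -S2.
split=> //; split=> [h h1|j _]; last first.
  split; last exact: (CSpp_dist hpsi ch3 _ c2 S2').
  move: S1'; rewrite /Ci /coset_sign; case: ifP => _ S1'.
    exact: (C1p_dist hpsi ch3 _ c1 S1').
  exact: (C2p_dist hpsi ch3 _ c1 S1').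
have A0 : (0 < A)%N by have := DCp_gt0 F n i; rewrite c1 muln_gt0 => /andP[].
have kN (a : F) : kloosterman_sum (lambda R r) (- a) ^+ 2 = kloosterman_sum
  (lambda R r) a ^+ 2.
  by rewrite kloosterman_sumN.
have TE2 j : T (2 * j)%N = \sum_(a | ~~ Z a) (kloosterman_sum (lambda R r) a ^+ 2)
  ^+ j.
  by rewrite TE; apply: eq_bigr => a _; rewrite exprM.
have := moment_recursion (k := fun a => kloosterman_sum (lambda R r) a ^+ 2)
  hpsi ch3 psi3 c1 c2 A0 (coset_sign_mem F i) kN S1' S2' h1.
rewrite /= -TE2 => ->; congr (- _ + _).
apply: eq_big_nat => j _; rewrite -TE2.
by rewrite opprB mulrBr !addrA [_ + q%:R - _]addrAC.
Qed.
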